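(* Let $(M^n,g)$ be a connected conformally Euclidean Riemannian manifold of dimension $n\geq 4$ on which the multiplicities of the principal Ricci curvatures are constant. Then $(M^n,g)$ is Deszcz symmetric if and only if it is a real space form or it is a quasi space form.
   Context: Conformally Euclidean: every point has a neighbourhood that is conformally diffeomorphic to an open subset of Euclidean space $\mathbb{E}^n$. Principal Ricci curvatures: the eigenvalues (with respect to $g$) of the Ricci tensor $S(X,Y)=\sum_t R(X,E_t,E_t,Y)$, $E_1,\dots,E_n$ any orthonormal tangent frame. Their multiplicities are constant if the number of distinct eigenvalues and their multiplicities are the same at all points. Curvature conventions: $R(X,Y)=\nabla_X\nabla_Y-\nabla_Y\nabla_X-\nabla_{[X,Y]}$, $R(X,Y,V,W)=g(R(X,Y)V,W)$, $(X\wedge_g Y)V=g(Y,V)X-g(X,V)Y$. The sectional curvature of the plane spanned by orthonormal $v,w$ is $K(v\wedge w)=R(v,w,w,v)$. The $(0,6)$ tensors $R\cdot R$ and $\wedge_g\cdot R$ (Tachibana tensor) are obtained by letting $R(X,Y)$, respectively $X\wedge_g Y$, act as a derivation on the $(0,4)$ tensor $R$: for $A=R(X,Y)$, respectively $A=X\wedge_g Y$, the value at $(V_1,V_2,V_3,V_4;X,Y)$ is $-R(AV_1,V_2,V_3,V_4)-R(V_1,AV_2,V_3,V_4)-R(V_1,V_2,AV_3,V_4)-R(V_1,V_2,V_3,AV_4)$. Deszcz symmetric: there is a function $L:M\to\mathbb{R}$ with $R\cdot R=L\,(\wedge_g\cdot R)$. Real space form: there is one real number $c$ such that $K(\tilde\pi)=c$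 for all tangent 2-planes $\tilde\pi$ at all points. Quasi space form: for $1\le q\le n/2$, $(M^n,g)$ is a $(q)$ quasi space form if it admits two orthogonally complementary distributions $D$ and $D^\perp$ with $TM=D\oplus D^\perp$, of fixed dimensions $q$ and $q^\perp=n-q\geq q$, such that: - if $q=1$: there are real functions $\overline{K},K^\perp$ on $M$, distinct at every point, such that for all orthonormal $X\in D$, $X^\perp,Y^\perp\in D^\perp$ (at any point) and all $\theta\in[0,\pi/2]$, the plane $\tilde\pi=(X\cos\theta+X^\perp\sin\theta)\wedge Y^\perp$ satisfies $K(\tilde\pi)=\overline{K}\cos^2\theta+K^\perp\sin^2\theta$; - if $q>1$: there are real functions $K,K^\perp$ on $M$, distinct at every point, such that, with $\overline{K}=(K+K^\perp)/2$, for all orthonormal $X,Y\in D$ and $X^\perp,Y^\perp\in D^\perp$ (at any point) and all $\theta,\varphi\in[0,\pi/2]$, the plane $\tilde\pi=(X\cos\theta+X^\perp\sin\theta)\wedge(Y\cos\varphi+Y^\perp\sin\varphi)$ satisfies $K(\tilde\pi)=K\cos^2\theta\cos^2\varphi+K^\perp\sin^2\theta\sin^2\varphi+\overline{K}(\cos^2\theta\sin^2\varphi+\sin^2\theta\cos^2\varphi)$. $(M^n,g)$ is a quasi space form if it is a $(q)$ quasi space form for some $q$. *)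

(* Defs.v *)
From HB Require Import structures.
From mathcomp Require Import all_boot all_order all_algebra.
From mathcomp Require Import all_classical all_reals.
From mathcomp Require Import topology normedtype derive trigo.

Set Implicit Arguments.
Unset Strict Implicit.
Unset Printing Implicit Defensive.

Import Order.TTheory GRing.Theory Num.Theory.
Import numFieldNormedType.Exports.

Local Open Scope classical_set_scope.
Local Open Scope ring_scope.

(* The libraries have no manifolds: a smooth manifold is a Hausdorff,
   second countable space with a maximal smooth atlas, and tangent vectors,
   tensors and distributions are given by their components in the charts of the
   atlas. A tangent vector at p has, in a chart c around p, a component vector
   in 'rV_n; going from c to another chart d, the component vector v at
   x = cmap c p becomes 'D_v (transition c d) x. A property of tangent vectors
   or tensors is required in all charts of the atlas. *)

Section Smooth.
Variables (R : realType) (n : nat) (W : normedModType R).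

Fixpoint Ck_on (k : nat) (U : set 'rV[R]_n) (f : 'rV[R]_n -> W) : Prop :=
  if k is k'.+1 then
    (forall x v, U x -> derivable f x v) /\
    (forall v, Ck_on k' U (fun x => 'D_v f x))
  else forall x, U x -> {for x, continuous f}.

(* Meant for open U. *)
Definition smooth_on (U : set 'rV[R]_n) (f : 'rV[R]_n -> W) : Prop :=
  forall k, Ck_on k U f.

End Smooth.

(* A homeomorphism from the open set cdom onto the open set cimg; the values of
   cmap outside cdom and of cinv outside cimg are irrelevant. *)
Record chart (R : realType) (n : nat) (M : topologicalType) := Chart {
  cdom : set M;
  cimg : set 'rV[R]_n;
  cmap : M -> 'rV[R]_n;
  cinv : 'rV[R]_n -> M;
  cdom_open : open cdom;
  cimg_open : open cimg;
  cmap_cimg : forall p, cdom p -> cimg (cmap p);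
  cinv_cdom : forall x, cimg x -> cdom (cinv x);
  cmapK : forall p, cdom p -> cinv (cmap p) = p;
  cinvK : forall x, cimg x -> cmap (cinv x) = x;
  cmap_continuous : forall p, cdom p -> {for p, continuous cmap};
  cinv_continuous : forall x, cimg x -> {for x, continuous cinv} }.

Section Charts.
Variables (R : realType) (n : nat) (M : topologicalType).
Implicit Types c d : chart R n M.

Definition overlap c d : set 'rV[R]_n :=
  [set x | cimg c x /\ cdom d (cinv c x)].

Definition transition c d : 'rV[R]_n -> 'rV[R]_n := cmap d \o cinv c.

Definition smoothly_compatible c d : Prop :=
  smooth_on (overlap c d) (transition c d) /\
  smooth_on (overlap d c) (transition d c).

End Charts.

Record smoothManifold (R : realType) (n : nat) := SmoothManifold {
  carrier :> topologicalType;
  atlas : set (chart R n carrier);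
  manifold_hausdorff : hausdorff_space carrier;
  manifold_second_countable : @second_countable carrier;
  atlas_cover : forall p : carrier, exists2 c, atlas c & cdom c p;
  atlas_compatible : forall c d, atlas c -> atlas d -> smoothly_compatible c d;
  atlas_maximal : forall c,
    (forall d, atlas d -> smoothly_compatible c d) -> atlas c }.

Section Inner.
Variables (R : realType) (n : nat).

Definition inner (h : 'M[R]_n) (u v : 'rV[R]_n) : R := (u *m h *m v^T) 0 0.

Definition orthonormal (h : 'M[R]_n) (s : seq 'rV[R]_n) : Prop :=
  forall i j, (i < size s)%N -> (j < size s)%N ->
    inner h s`_i s`_j = (i == j)%:R.

End Inner.

(* metric c x is the Gram matrix of g in the chart c at the point cinv c x. *)
Record riemannianMetric (R : realType) (n : nat) (M : smoothManifold R n) :=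
  RiemannianMetric {
  metric :> chart R n M -> 'rV[R]_n -> 'M[R]_n;
  metric_smooth : forall c, atlas c -> smooth_on (cimg c) (metric c);
  metric_sym : forall c x, atlas c -> cimg c x -> (metric c x)^T = metric c x;
  metric_pos : forall c x (v : 'rV[R]_n), atlas c -> cimg c x -> v != 0 ->
    0 < inner (metric c x) v v;
  metric_change : forall c d x (u v : 'rV[R]_n), atlas c -> atlas d ->
    overlap c d x ->
    inner (metric c x) u v =
    inner (metric d (transition c d x))
      ('D_u (transition c d) x) ('D_v (transition c d) x) }.

(* Curvature of a metric G given on an open subset of R^n. *)
Section Curvature.
Variables (R : realType) (n : nat) (G : 'rV[R]_n -> 'M[R]_n).
Implicit Types X Y V : 'rV[R]_n -> 'rV[R]_n.
Implicit Types x u v w z : 'rV[R]_n.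

(* Sum_ij u^i v^j Gamma_ij^k, as a vector in k: for every w,
   g (Gamma (u, v), w) = (D_u g(v, w) + D_v g(u, w) - D_w g(u, v)) / 2. *)
Definition christoffel x u v : 'rV[R]_n :=
  (\row_k (2^-1 * ('D_u (fun y => inner (G y) v (delta_mx 0 k)) x
                   + 'D_v (fun y => inner (G y) u (delta_mx 0 k)) x
                   - 'D_(delta_mx 0 k) (fun y => inner (G y) u v) x)))
  *m invmx (G x).

(* Levi-Civita connection *)
Definition nabla X Y : 'rV[R]_n -> 'rV[R]_n :=
  fun x => 'D_(X x) Y x + christoffel x (X x) (Y x).

Definition lie_bracket X Y : 'rV[R]_n -> 'rV[R]_n :=
  fun x => 'D_(X x) Y x - 'D_(Y x) X x.

Definition curvature_field X Y V : 'rV[R]_n -> 'rV[R]_n :=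
  fun x => nabla X (nabla Y V) x - nabla Y (nabla X V) x
           - nabla (lie_bracket X Y) V x.

(* R(X, Y)V at x depends only on the values of X, Y, V at x, so vectors are
   extended to constant fields. *)
Definition curvature_op x u v w : 'rV[R]_n :=
  curvature_field (cst u) (cst v) (cst w) x.

Definition curvature x u v w z : R := inner (G x) (curvature_op x u v w) z.

Definition wedge_op x u v w : 'rV[R]_n :=
  inner (G x) v w *: u - inner (G x) u w *: v.

(* Action of the endomorphism A as a derivation on the (0,4) tensor R. *)
Definition derivation_curvature x (A : 'rV[R]_n -> 'rV[R]_n) v1 v2 v3 v4 : R :=
  - curvature x (A v1) v2 v3 v4 - curvature x v1 (A v2) v3 v4
  - curvature x v1 v2 (A v3) v4 - curvature x v1 v2 v3 (A v4).

Definition R_dot_R x v1 v2 v3 v4 u v : R :=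
  derivation_curvature x (curvature_op x u v) v1 v2 v3 v4.

Definition tachibana x v1 v2 v3 v4 u v : R :=
  derivation_curvature x (wedge_op x u v) v1 v2 v3 v4.

(* K(v /\ w), for orthonormal v, w. *)
Definition sectional x v w : R := curvature x v w w v.

(* Ricci tensor, computed in the orthonormal frame E. *)
Definition ricci (E : n.-tuple 'rV[R]_n) x u v : R :=
  \sum_(e <- E) curvature x u e e v.

Definition ricci_mx (E : n.-tuple 'rV[R]_n) x : 'M[R]_n :=
  \matrix_(i, j) ricci E x (delta_mx 0 i) (delta_mx 0 j).

(* The v such that S(v, w) = lambda g(v, w) for all w. *)
Definition ricci_eigenspace (E : n.-tuple 'rV[R]_n) x (lambda : R) : 'M[R]_n :=
  kermx (ricci_mx E x - lambda *: G x).

(* lambda is a principal Ricci curvature if this is nonzero. *)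
Definition ricci_multiplicity (E : n.-tuple 'rV[R]_n) x (lambda : R) : nat :=
  \rank (ricci_eigenspace E x lambda).

End Curvature.

Section Properties.
Variables (R : realType) (n : nat) (M : smoothManifold R n).
Variable g : riemannianMetric M.
Implicit Types c d : chart R n M.

(* As the atlas is maximal, its charts are all the diffeomorphisms from open
   subsets of M onto open subsets of R^n. *)
Definition conformally_euclidean : Prop :=
  forall p : M, exists c, [/\ atlas c, cdom c p &
    exists lambda : 'rV[R]_n -> R,
      [/\ smooth_on (cimg c) (lambda : 'rV[R]_n -> R^o),
          forall x, cimg c x -> 0 < lambda x &
          forall x, cimg c x -> g c x = (lambda x)%:M]].

(* k distinct principal Ricci curvatures, with multiplicities m. *)
Definition constant_ricci_multiplicities : Prop :=
  exists (k : nat) (m : 'I_k -> nat),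
  forall c x (E : n.-tuple 'rV[R]_n), atlas c -> cimg c x ->
    orthonormal (g c x) E ->
    exists lambda : 'I_k -> R,
      [/\ injective lambda,
          forall i, ricci_multiplicity (g c) E x (lambda i) = m i &
          forall a, (0 < ricci_multiplicity (g c) E x a)%N <->
                    exists i, lambda i = a].

Definition deszcz_symmetric : Prop :=
  exists L : M -> R, forall c x, atlas c -> cimg c x ->
    forall v1 v2 v3 v4 u v : 'rV[R]_n,
      R_dot_R (g c) x v1 v2 v3 v4 u v =
      L (cinv c x) * tachibana (g c) x v1 v2 v3 v4 u v.

Definition real_space_form : Prop :=
  exists a : R, forall c x (v w : 'rV[R]_n), atlas c -> cimg c x ->
    orthonormal (g c x) [:: v; w] -> sectional (g c) x v w = a.

Definition distribution (q : nat)
    (D : chart R n M -> 'rV[R]_n -> {vspace 'rV[R]_n}) : Prop :=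
  [/\ forall c x, atlas c -> cimg c x -> \dim (D c x) = q,
      forall c d x (v : 'rV[R]_n), atlas c -> atlas d -> overlap c d x ->
        (v \in D c x) =
        ('D_v (transition c d) x \in D d (transition c d x)) &
      forall c x, atlas c -> cimg c x ->
        exists (U : set 'rV[R]_n) (F : 'I_q -> 'rV[R]_n -> 'rV[R]_n),
          [/\ open U, U x, U `<=` cimg c,
              forall i, smooth_on U (F i) &
              forall y, U y -> D c y = <<[seq F i y | i <- enum 'I_q]>>%VS]].

Definition orthogonally_complementary
    (D D' : chart R n M -> 'rV[R]_n -> {vspace 'rV[R]_n}) : Prop :=
  forall c x, atlas c -> cimg c x ->
    (forall u v, u \in D c x -> v \in D' c x -> inner (g c x) u v = 0) /\
    (D c x + D' c x)%VS = fullv.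

(* D' stands for the orthogonal complement of D. *)
Definition quasi_space_form_1
    (D D' : chart R n M -> 'rV[R]_n -> {vspace 'rV[R]_n}) : Prop :=
  exists Kbar K' : M -> R, (forall p, Kbar p <> K' p) /\
  forall c x (X X' Y' : 'rV[R]_n) (theta : R), atlas c -> cimg c x ->
    X \in D c x -> X' \in D' c x -> Y' \in D' c x ->
    orthonormal (g c x) [:: X; X'; Y'] -> 0 <= theta <= pi / 2 ->
    sectional (g c) x (cos theta *: X + sin theta *: X') Y' =
    Kbar (cinv c x) * cos theta ^+ 2 + K' (cinv c x) * sin theta ^+ 2.

Definition quasi_space_form_gt1
    (D D' : chart R n M -> 'rV[R]_n -> {vspace 'rV[R]_n}) : Prop :=
  exists K K' : M -> R, (forall p, K p <> K' p) /\
  forall c x (X Y X' Y' : 'rV[R]_n) (theta phi : R), atlas c -> cimg c x ->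
    X \in D c x -> Y \in D c x -> X' \in D' c x -> Y' \in D' c x ->
    orthonormal (g c x) [:: X; Y; X'; Y'] ->
    0 <= theta <= pi / 2 -> 0 <= phi <= pi / 2 ->
    let Kbar := (K (cinv c x) + K' (cinv c x)) / 2 in
    sectional (g c) x (cos theta *: X + sin theta *: X')
                      (cos phi *: Y + sin phi *: Y') =
    K (cinv c x) * (cos theta ^+ 2 * cos phi ^+ 2)
    + K' (cinv c x) * (sin theta ^+ 2 * sin phi ^+ 2)
    + Kbar * (cos theta ^+ 2 * sin phi ^+ 2 + sin theta ^+ 2 * cos phi ^+ 2).

Definition q_quasi_space_form (q : nat) : Prop :=
  (1 <= q)%N /\ (2 * q <= n)%N /\
  exists D D' : chart R n M -> 'rV[R]_n -> {vspace 'rV[R]_n},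
    [/\ distribution q D, distribution (n - q) D',
        orthogonally_complementary D D' &
        if q == 1%N then quasi_space_form_1 D D' else quasi_space_form_gt1 D D'].

Definition quasi_space_form : Prop := exists q, q_quasi_space_form q.

End Properties.

(* Main.v *)
From HB Require Import structures.
Require Import Defs.
From mathcomp Require Import all_boot all_order all_algebra.
From mathcomp Require Import all_classical all_reals.
From mathcomp Require Import interval_inference topology normedtype landau derive realfun trigo.
From mathcomp Require Import ring lra zify.

(** Write g /\ A for the Kulkarni-Nomizu product of the metric with an operator A.
   The curvature tensor of a conformally Euclidean manifold is g /\ A, where A is
   the self-adjoint Schouten operator. In a chart where g = phi^-2 g_E this is a
   computation ([conformal_curvature]) with A = phi Hess phi - |grad phi|^2 / 2.
   Tensoriality of the curvature ([curvature_op_change]) carries it to every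
   chart, and as A is recovered from the Ricci tensor ([schouten_of_kn]) it is a
   smooth (1,1) tensor ([smx_schouten], [schouten_change]).

   The rest is about A. A derivation that annihilates g acts on g /\ A through A
   alone, so that R.R - L (/\_g.R) is the Kulkarni-Nomizu product of g with a form
   built from A^2 - L A ([deszcz_defect]), which vanishes exactly when A^2 - L A is
   scalar ([deszcz_of_quadratic], [quadratic_of_deszcz]). Since A is
   diagonalizable, Deszcz symmetry means that A has at most two eigenvalues at each
   point; if there are two, L is their sum.

   The Ricci operator is (n - 2) A + tr A, hence the multiplicities of the
   eigenvalues of A are constant as well. If the number of principal Ricci
   curvatures is not two, A is scalar everywhere ([schouten_scalar]). By Schur's
   lemma ([conformal_schur]) and connectedness this scalar is constant, and the
   manifold is a real space form. If it is two, A has at every point eigenvalues a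
   and b of fixed multiplicities q <= n - q ([schouten_two_eigen]). They can be
   computed from traces of powers of A ([eigen1E], [eigen2E]), so they are smooth,
   the eigenspaces are smooth distributions because ranks are constant
   ([smooth_rowspan_frame]), and the sectional curvature of g /\ A is that of a
   quasi space form with K = 2 a, K' = 2 b and Kbar = a + b ([kn_sectional_two]).

   Conversely, the sectional curvature of g /\ A on the plane of orthonormal v and w
   is g(vA, v) + g(wA, w). Prescribing it as in a real space form makes A scalar
   ([scalar_of_constant_sectional]); prescribing it as in a quasi space form makes
   A equal to a on D and to b on the orthogonal complement of D, with a + b = Kbar
   ([two_eigen_of_quasi]). In both cases A^2 - L A is scalar for a function L. *)

Set Implicit Arguments.
Unset Strict Implicit.
Unset Printing Implicit Defensive.

Import Order.TTheory GRing.Theory Num.Theory.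
Import numFieldNormedType.Exports.

Local Open Scope classical_set_scope.
Local Open Scope ring_scope.

(** * Differentiability of C^1 functions *)

Section DirectionalMVT.
Variables (R : realType) (V : normedModType R).
Implicit Types (f : V -> R) (u v x y : V).

Lemma derive_dirZ (W : normedModType R) (f : V -> W) x v (a : R) :
  derivable f x v -> derivable f x (a *: v) /\ 'D_(a *: v) f x = a *: 'D_v f x.
Proof.
move=> df; have [->|a0] := eqVneq a 0.
  by rewrite !scale0r derive0; split => //; exact: derivable0.
suff H : (h^-1 *: (f (h *: (a *: v) + x) - f x)) @[h --> 0^'] --> a *: 'D_v f x.
  split; first by apply/cvg_ex; exists (a *: 'D_v f x).
  exact: cvg_lim.
have E : (fun h : R => h^-1 *: (f (h *: (a *: v) + x) - f x)) =
   (fun h : R => (a * h^-1) *: (f (h *: v + x) - f x)) \o (fun h : R => h * a).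
  apply/funext => h /=; rewrite scalerA invfM mulrCA divff ?mulr1 //.
rewrite E.
apply: (@cvg_comp _ _ _ _ _ _ (0 : R)^').
  move=> A [e e0 HA]; exists (e / `|a|) => /=; first by rewrite divr_gt0 ?normr_gt0.
  move=> h /=; rewrite sub0r normrN => he h0; apply: HA => /=; last first.
    by rewrite mulf_neq0.
  by rewrite sub0r normrN normrM -ltr_pdivlMr ?normr_gt0.
rewrite (_ : (fun h : R => _) = a \*: (fun h : R => h^-1 *: (f (h *: v + x) - f x))).
  exact: (@cvgZl_tmp R W R (0^') _ a _ _ df).
by apply/funext => h; rewrite /= scalerA.
Qed.

Lemma mvt_dir f y v :
  (forall t : R, 0 <= t <= 1 -> derivable f (y + t *: v) v) ->
  exists2 t : R, 0 <= t <= 1 & f (y + v) - f y = 'D_v f (y + t *: v).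
Proof.
move=> df; pose phi (t : R) := f (y + t *: v).
have D (t : R) : 0 <= t <= 1 -> is_derive t 1 phi ('D_v f (y + t *: v)).
  move=> t01; have := df t t01.
  have E : (fun h : R => h^-1 *: (phi (h *: 1 + t) - phi t)) =
     (fun h : R => h^-1 *: (f (h *: v + (y + t *: v)) - f (y + t *: v))).
    apply/funext => h; rewrite /phi /=; congr (_ *: (f _ - _)).
    by rewrite [h *: 1]mulr1 scalerDl addrCA.
  by rewrite /derivable /= => c; split; rewrite /derivable /derive /= E.
have [t t01] := @MVT_segment R phi (fun t : R => 'D_v f (y + t *: v)) 0 1 ler01
  (fun t ht => D t ltac:(move: ht; rewrite in_itv /= => /andP[/ltW -> /ltW ->]//))
  ltac:(apply: derivable_within_continuous => t; rewrite in_itv /= => /D []; by []).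
rewrite /phi scale0r addr0 scale1r subr0 mulr1 => E; exists t => //.
Qed.

End DirectionalMVT.

Section C1.
Variables (R : realType) (n : nat).
Implicit Types (f : 'rV[R]_n -> R) (u v x y h : 'rV[R]_n).

Let cut h (k : nat) : 'rV[R]_n := \row_j (if (j < k)%N then h 0 j else 0).

Let cutS h (k : 'I_n) : cut h k.+1 = cut h k + h 0 k *: delta_mx 0 k.
Proof.
apply/rowP => j; rewrite !mxE eqxx ltnS leq_eqVlt eq_sym -val_eqE /=.
case: (ltngtP (k : nat) j) => //= e; rewrite ?mulr0 ?addr0 ?mulr1 ?add0r //.
by rewrite (val_inj e).
Qed.

Let norm_entry h (k : 'I_n) : `|h 0 k| <= `|h|.
Proof.
by rewrite [leRHS]/Num.Def.normr /= mx_normrE; exact: (le_bigmax _ _ (0, k)).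
Qed.

Let norm_cut h (k : 'I_n) (t : R) : 0 <= t <= 1 ->
  `|cut h k + t *: (h 0 k *: delta_mx 0 k)| <= `|h|.
Proof.
move=> /andP[t0 t1]; rewrite [leLHS]/Num.Def.normr /= mx_normrE.
apply: bigmax_le => // -[i j] _ /=; rewrite !mxE ord1 eqxx /=.
case: (ltngtP (j : nat) k) => //= e; rewrite -val_eqE /=.
- by rewrite ltn_eqF // mulr0 mulr0 addr0; exact: norm_entry.
- by rewrite gtn_eqF // mulr0 mulr0 addr0 normr0.
rewrite e eqxx mulr1 add0r normrM ger0_norm //.
by rewrite (le_trans _ (norm_entry h k)) // ler_piMl.
Qed.

(** Smoothness is defined by iterated directional derivatives, while the chain
   rule and linearity in the direction need a differential. Going from x to x + h
   one coordinate at a time, the mean value theorem on each segment bounds the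
   remainder. *)
Lemma c1_differentiable f x :
  (\forall y \near x, forall v, derivable f y v) ->
  (forall v, {for x, continuous (fun y => 'D_v f y)}) ->
  differentiable f x.
Proof.
move=> df cdf.
pose d0 (h : 'rV[R]_n) : R := \sum_k h 0 k * 'D_(delta_mx 0 k) f x.
have d0lin : linear d0.
  move=> a u v; rewrite /d0 scaler_sumr -big_split /=; apply: eq_bigr => k _.
  by rewrite !mxE mulrDl -mulrA.
pose dlM := GRing.isLinear.Build _ _ _ _ _ d0lin.
pose dL : {linear 'rV[R]_n -> R} := HB.pack d0 dlM.
have dLc : continuous dL.
  move=> y; rewrite /dL /= /d0.
  apply: (continuous_big (@add_continuous R)) => k _ z; apply: (@cvgMr_tmp R _ (nbhs z)).
  exact: (@coord_continuous R 1 n 0 k z).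
have H : f \o shift x = cst (f x) + dL +o_ (0 : 'rV[R]_n) id.
  apply/eqaddoP => _/posnumP[e].
  (* n.+1 rather than n, as n may be 0 *)
  pose e' := e%:num / n.+1%:R.
  have e'0 : 0 < e' by rewrite divr_gt0.
  have : \forall y \near x, (forall v, derivable f y v) /\
     (forall k : 'I_n, `|'D_(delta_mx 0 k) f y - 'D_(delta_mx 0 k) f x| <= e').
    near=> y; split; first by near: y.
    near: y; apply: filter_forall => k.
    have /cvgrPdist_le /(_ _ e'0) := cdf (delta_mx 0 k).
    by apply: filterS => y; rewrite distrC.
  move=> /nbhs_ballP [r /= r0 Hr].
  near=> h.
  have hr : `|h| < r by near: h; apply/nbhs_ballP; exists r => // h; rewrite -ball_normE /= sub0r normrN.
  rewrite !fctE /=.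
  have E : f (h + x) - f x = \sum_(k < n) (f (x + cut h k.+1) - f (x + cut h k)).
    rewrite -(big_mkord xpredT (fun k => f (x + cut h k.+1) - f (x + cut h k))).
    rewrite telescope_sumr //; congr (f _ - f _).
      by rewrite addrC; congr (_ + _); apply/rowP => j; rewrite !mxE ltn_ord.
    by rewrite -[LHS]addr0; congr (_ + _); apply/rowP => j; rewrite !mxE ltn0.
  rewrite opprD addrA E -sumrB.
  apply: le_trans (ler_norm_sum _ _ _) _.
  apply: (@le_trans _ _ (\sum_(k < n) (e' * `|h|))).
    apply: ler_sum => k _; rewrite cutS addrA.
    have B t : 0 <= t <= 1 -> ball x r (x + cut h k + t *: (h 0 k *: delta_mx 0 k)).
      move=> t01; rewrite -ball_normE /= -addrA opprD addNKr normrN.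
      exact: le_lt_trans (norm_cut h k t01) hr.
    have [t t01 ->] : exists2 t : R, 0 <= t <= 1 &
        f (x + cut h k + h 0 k *: delta_mx 0 k) - f (x + cut h k) =
        'D_(h 0 k *: delta_mx 0 k) f (x + cut h k + t *: (h 0 k *: delta_mx 0 k)).
      by apply: mvt_dir => t t01; have [] := Hr _ (B _ t01).
    have [Hd Hk] := Hr _ (B _ t01).
    have [_ ->] := derive_dirZ (h 0 k) (Hd (delta_mx 0 k)).
    rewrite -[_ *: _]/(_ * _) -mulrBr normrM mulrC.
    by rewrite ler_pM.
  rewrite sumr_const card_ord -[_ *+ _]mulr_natl mulrA ler_wpM2r //.
  rewrite /e' mulrCA ler_piMr // ler_pdivrMr // mul1r ler_nat //.
apply/diff_locallyP; rewrite (diff_unique dLc H); split => //.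
Unshelve. all: by end_near. Qed.
End C1.

Section DirectionalLinearity.
Variables (R : realType) (V W : normedModType R).

Lemma deriveDdir (f : V -> W) x u v : differentiable f x ->
  'D_(u + v) f x = 'D_u f x + 'D_v f x.
Proof. by move=> df; rewrite !deriveE // linearD. Qed.

Lemma deriveZdir (f : V -> W) x (a : R) v : differentiable f x ->
  'D_(a *: v) f x = a *: 'D_v f x.
Proof. by move=> df; rewrite !deriveE // linearZ. Qed.

Lemma derive_sum_dir (f : V -> W) x (I : Type) (r : seq I) (a : I -> R) (v : I -> V) :
  differentiable f x ->
  'D_(\sum_(i <- r) a i *: v i) f x = \sum_(i <- r) a i *: 'D_(v i) f x.
Proof.
move=> df; rewrite deriveE // linear_sum; apply: eq_bigr => i _.
by rewrite linearZ deriveE.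
Qed.

Lemma derive_comp_dir (V' : normedModType R) (f : V -> V') (h : V' -> W) x v :
  differentiable f x -> differentiable h (f x) ->
  'D_v (h \o f) x = 'D_('D_v f x) h (f x).
Proof.
move=> df dh; rewrite !deriveE //; last exact: differentiable_comp.
by rewrite diff_comp.
Qed.

Lemma derive_mxE p q (M : V -> 'M[R]_(p, q)) x v i j :
  derivable M x v -> 'D_v M x i j = 'D_v (fun y => M y i j) x.
Proof. by move=> dM; rewrite derive_mx // mxE. Qed.

End DirectionalLinearity.

(** * Smooth functions *)

Lemma smooth_derive (R : realType) (n : nat) (U : set 'rV[R]_n)
    (W : normedModType R) (f : 'rV[R]_n -> W) v :
  smooth_on U f -> smooth_on U (fun x => 'D_v f x).
Proof. by move=> sf k; have [_] := sf k.+1; apply. Qed.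

Lemma smooth_differentiable (R : realType) (n : nat) (U : set 'rV[R]_n)
    (f : 'rV[R]_n -> R) x :
  open U -> smooth_on U (f : 'rV[R]_n -> R^o) -> U x -> differentiable f x.
Proof.
move=> openU sf Ux; apply: c1_differentiable => [|v].
  have : \forall y \near x, U y by exact: open_nbhs_nbhs.
  by apply: filterS => y Uy v; have [+ _] := sf 1%N; apply.
by have [_ /(_ v)] := sf 1%N; apply.
Qed.

Section SmoothFunctions.
Variables (R : realType) (n : nat) (U : set 'rV[R]_n).
Hypothesis openU : open U.

Lemma near_open x : U x -> \forall y \near x, U y.
Proof. by move=> Ux; exact: open_nbhs_nbhs. Qed.

Lemma continuous_near_eq (T : topologicalType) (f g : 'rV[R]_n -> T) x :
  U x -> (forall y, U y -> f y = g y) ->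
  {for x, continuous f} -> {for x, continuous g}.
Proof.
move=> Ux fg cf; rewrite /prop_for /continuous_at -(fg _ Ux).
apply: cvg_trans cf; apply: (@near_eq_cvg _ _ (nbhs x)).
by move: (near_open Ux); apply: filterS => y /fg.
Qed.

Lemma derive_eq_on (W : normedModType R) (f g : 'rV[R]_n -> W) x v :
  (forall y, U y -> f y = g y) -> U x -> 'D_v f x = 'D_v g x.
Proof.
move=> fg Ux; apply: near_eq_derive; near=> y; apply: fg; near: y; exact: near_open.
Unshelve. all: by end_near. Qed.

Lemma derivable_eq_on (W : normedModType R) (f g : 'rV[R]_n -> W) x v :
  (forall y, U y -> f y = g y) -> U x -> derivable f x v -> derivable g x v.
Proof.
move=> fg Ux; apply: near_eq_derivable; near=> y; apply: fg; near: y; exact: near_open.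
Unshelve. all: by end_near. Qed.

Section AnyTarget.
Variable W : normedModType R.
Implicit Types f g : 'rV[R]_n -> W.

Lemma Ck_on_ext k f g : (forall x, U x -> f x = g x) ->
  Ck_on k U f -> Ck_on k U g.
Proof.
elim: k f g => [|k IH] f g fg /=.
  by move=> cf x Ux; exact: continuous_near_eq fg (cf x Ux).
move=> [df kf]; split=> [x v Ux|v]; first exact: derivable_eq_on fg Ux (df x v Ux).
by apply: IH (kf v) => x Ux; exact: derive_eq_on.
Qed.

Lemma smooth_ext f g : (forall x, U x -> f x = g x) ->
  smooth_on U f -> smooth_on U g.
Proof. by move=> fg sf k; exact: Ck_on_ext fg (sf k). Qed.

Lemma smooth_derivable f x v : smooth_on U f -> U x -> derivable f x v.
Proof. by move=> sf Ux; have [+ _] := sf 1%N; apply. Qed.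

Lemma smooth_continuous f x : smooth_on U f -> U x -> {for x, continuous f}.
Proof. by move=> sf Ux; exact: (sf 0%N). Qed.

(** The coinduction principle behind the closure properties of smooth functions:
   a class stable under differentiation replaces a new induction on the order of
   differentiability for each of them. *)
Lemma smooth_coind (S : ('rV[R]_n -> W) -> Prop) :
  (forall f, S f -> [/\ forall x, U x -> {for x, continuous f},
     forall x v, U x -> derivable f x v &
     forall v, S (fun x => 'D_v f x)]) ->
  forall f, S f -> smooth_on U f.
Proof.
move=> H f Sf k; elim: k f Sf => [|k IH] f Sf /=; first by case: (H f Sf).
by have [_ df Sdf] := H f Sf; split => // v; apply: IH.
Qed.

End AnyTarget.

Lemma smooth_cst (W : normedModType R) (a : W) : smooth_on U (cst a).
Proof.
apply: (@smooth_coind _ (fun f => exists a, f = cst a)); last by exists a.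
move=> _ [b ->]; split=> [x _|x v _|v].
- exact: cst_continuous.
- exact: derivable_cst.
by exists 0; apply/funext => x; rewrite derive_cst.
Qed.

Notation Sm f := (smooth_on U (f : 'rV[R]_n -> R^o)).

Lemma mx_differentiable p q (M : 'rV[R]_n -> 'M[R]_(p, q)) x :
  (forall i j, differentiable (fun y => M y i j) x) -> differentiable M x.
Proof.
move=> dM; have -> : M = fun y =>
    \sum_(k < p) (\sum_(l < q) (M y k l *: (delta_mx k l : 'M[R]_(p, q)))).
  by apply/funext => y; rewrite [LHS]matrix_sum_delta.
have E k : (fun y => \sum_(l < q) (M y k l *: (delta_mx k l : 'M[R]_(p, q)))) =
   \sum_(l < q) (fun y => M y k l *: (delta_mx k l : 'M[R]_(p, q))).
  by apply/funext => y; rewrite fct_sumE.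
have -> : (fun y => \sum_(k < p) (\sum_(l < q) (M y k l *: (delta_mx k l : 'M[R]_(p, q))))) =
    \sum_(k < p) (\sum_(l < q) (fun y => M y k l *: (delta_mx k l : 'M[R]_(p, q)))).
  by apply/funext => y; rewrite fct_sumE; apply: eq_bigr => k _; rewrite -E.
apply: differentiable_sum => k; apply: differentiable_sum => l.
exact: differentiableZl (dM k l).
Qed.

(** Derivatives of products, inverses, square roots and composites mix these
   operations again, so that no single one of them yields a class stable under
   differentiation; all together do. *)
Inductive smooth_term : ('rV[R]_n -> R^o) -> Prop :=
| St_smooth f : smooth_on U f -> smooth_term f
| St_ext f g : (forall x, U x -> f x = g x) -> smooth_term f -> smooth_term g
| St_add f g : smooth_term f -> smooth_term g -> smooth_term (fun x => f x + g x)
| St_mul f g : smooth_term f -> smooth_term g ->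
    smooth_term (fun x => (f x : R) * g x)
| St_inv f : smooth_term f -> (forall x, U x -> f x != 0) ->
    smooth_term (fun x => (f x : R)^-1)
| St_sqrt f : smooth_term f -> (forall x, U x -> 0 < (f x : R)) ->
    smooth_term (fun x => Num.sqrt (f x : R))
| St_comp m (V : set 'rV[R]_m) (T : 'rV[R]_n -> 'rV[R]_m) (f : 'rV[R]_m -> R^o) :
    open V -> (forall x, U x -> V (T x)) -> (forall j, Sm (fun x => T x 0 j)) ->
    smooth_on V f -> smooth_term (f \o T).

Let derive_sqrt_comp (f : 'rV[R]_n -> R) x v : derivable f x v ->
  0 < f x -> is_derive x v (fun y => Num.sqrt (f y)) ('D_v f x * (2 * Num.sqrt (f x))^-1).
Proof.
move=> df f0.
pose phi (t : R) := f (t *: v + x).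
have dphi : derivable phi 0 1 := (derivable1P f x v).1 df.
have Dphi : 'D_1 phi 0 = 'D_v f x.
  have E : (fun h : R => h^-1 *: (phi (h *: 1 + 0) - phi 0)) =
     (fun h : R => h^-1 *: (f (h *: v + x) - f x)).
    by apply/funext => h; rewrite /phi scale0r add0r addr0 [h *: 1]mulr1.
  by rewrite /derive /= E.
have phi0 : phi 0 = f x by rewrite /phi scale0r add0r.
have s1 : is_derive (phi 0) 1 Num.sqrt (2 * Num.sqrt (phi 0))^-1.
  by apply: is_derive1_sqrt; rewrite phi0.
have [d Dd] := is_derive1_comp s1 (DeriveDef dphi Dphi).
apply: DeriveDef; first exact: (derivable1P _ x v).2 d.
have -> : 'D_v (fun y => Num.sqrt (f y)) x = 'D_1 (Num.sqrt \o phi) 0.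
  have E : (fun h : R => h^-1 *: (Num.sqrt (phi (h *: 1 + 0)) - Num.sqrt (phi 0))) =
     (fun h : R => h^-1 *: (Num.sqrt (f (h *: v + x)) - Num.sqrt (f x))).
    by apply/funext => h; rewrite /phi scale0r add0r addr0 [h *: 1]mulr1.
  by rewrite /derive /= E.
by rewrite Dd phi0 mulrC.
Qed.

Let smooth_term_sum (I : Type) (r : seq I) (F : I -> 'rV[R]_n -> R^o) :
  (forall i, smooth_term (F i)) -> smooth_term (fun x => \sum_(i <- r) F i x).
Proof.
move=> sF; elim: r => [|i r IH].
  by apply: St_ext (St_smooth (smooth_cst (0 : R^o))) => x _; rewrite big_nil.
by apply: St_ext (St_add (sF i) IH) => x _; rewrite big_cons.
Qed.

Lemma smooth_term_smooth f : smooth_term f -> smooth_on U f.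
Proof.
apply: (@smooth_coind R^o smooth_term) => {}f.
elim=> {f}.
- move=> f sf; split=> [x Ux|x v Ux|v]; first exact: smooth_continuous sf Ux.
    exact: smooth_derivable sf Ux.
  by apply: St_smooth; exact: smooth_derive.
- move=> f g fg _ [cf df tf]; split=> [x Ux|x v Ux|v].
  + exact: continuous_near_eq fg (cf x Ux).
  + exact: derivable_eq_on fg Ux (df x v Ux).
  by apply: St_ext (tf v) => x Ux; exact: derive_eq_on.
- move=> f g sf [cf df tf] sg [cg dg tg]; split=> [x Ux|x v Ux|v].
  + by apply: (@continuousD R R^o); [exact: cf|exact: cg].
  + by apply: derivableD; [exact: df|exact: dg].
  apply: St_ext (St_add (tf v) (tg v)) => x Ux.
  by rewrite [RHS]deriveD //; [exact: df|exact: dg].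
- move=> f g sf [cf df tf] sg [cg dg tg]; split=> [x Ux|x v Ux|v].
  + by apply: (@continuousM R); [exact: cf|exact: cg].
  + by apply: derivableM; [exact: df|exact: dg].
  apply: St_ext (St_add (St_mul sf (tg v)) (St_mul sg (tf v))) => x Ux.
  by rewrite [RHS]deriveM //; [exact: df|exact: dg].
- move=> f sf [cf df tf] f0; split=> [x Ux|x v Ux|v].
  + by apply: (@continuousV R); [exact: f0|exact: cf].
  + by apply: derivableV; [exact: f0|exact: df].
  have s2 := St_inv sf f0.
  apply: St_ext (St_mul (St_smooth (smooth_cst (-1 : R^o)))
    (St_mul (St_mul s2 s2) (tf v))) => x Ux.
  rewrite [RHS]deriveV //; [|exact: f0|exact: df].
  by rewrite /= mulN1r scaleNr expr2 invfM.
- move=> f sf [cf df tf] f0; split=> [x Ux|x v Ux|v].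
  + by apply: (@continuous_comp _ _ _ f Num.sqrt); [exact: cf|exact: sqrt_continuous].
  + by have [] := derive_sqrt_comp (df x v Ux) (f0 x Ux).
  have s2 := St_inv (St_mul (St_smooth (smooth_cst (2 : R^o))) (St_sqrt sf f0)).
  apply: St_ext (St_mul (tf v) (s2 _)) => [x Ux|x Ux].
    by have [_ ->] := derive_sqrt_comp (df x v Ux) (f0 x Ux).
  by apply: mulf_neq0; rewrite /cst ?pnatr_eq0 // gt_eqF // sqrtr_gt0 f0.
move=> m V T f oV TV sT sf.
have dT x : U x -> differentiable T x.
  by move=> Ux; apply: mx_differentiable => i j; rewrite ord1; exact: smooth_differentiable openU (sT j) Ux.
have df x : U x -> differentiable f (T x).
  by move=> Ux; exact: smooth_differentiable oV sf (TV x Ux).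
have dfT x : U x -> differentiable (f \o T) x.
  by move=> Ux; apply: differentiable_comp; [exact: dT|exact: df].
split=> [x Ux|x v Ux|v].
- exact/differentiable_continuous/dfT.
- exact/diff_derivable/dfT.
have s k : smooth_term (fun x => ('D_v (fun y => T y 0 k) x : R) *
    ((fun z => @derive _ _ R^o f z (delta_mx 0 k)) \o T) x).
  apply: St_mul; first by apply: St_smooth; exact: smooth_derive.
  by apply: (@St_comp m V) => //; exact: (@smooth_derive _ _ V _ f (delta_mx 0 k) sf).
apply: St_ext (smooth_term_sum (index_enum 'I_m) s) => x Ux /=.
have cT := derive_comp_dir v (dT x Ux) (df x Ux); apply/esym; apply: etrans cT _.
have dTx : derivable T x v := diff_derivable (dT x Ux).
rewrite {1}['D_v T x]row_sum_delta (derive_sum_dir _ _ _ (df x Ux)).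
by apply: eq_bigr => k _; rewrite derive_mxE.
Qed.

Lemma smoothD f g : Sm f -> Sm g -> Sm (fun x => f x + g x).
Proof. by move=> *; apply/smooth_term_smooth/St_add; exact: St_smooth. Qed.

Lemma smoothM f g : Sm f -> Sm g -> Sm (fun x => f x * g x : R).
Proof. by move=> *; apply/smooth_term_smooth/St_mul; exact: St_smooth. Qed.

Lemma smoothV (f : 'rV[R]_n -> R) : Sm f -> (forall x, U x -> f x != 0) ->
  Sm (fun x => (f x)^-1).
Proof. by move=> *; apply/smooth_term_smooth/St_inv => //; exact: St_smooth. Qed.

Lemma smooth_comp m (V : set 'rV[R]_m) (T : 'rV[R]_n -> 'rV[R]_m) (f : 'rV[R]_m -> R^o) :
  open V -> (forall x, U x -> V (T x)) -> (forall j, Sm (fun x => T x 0 j)) ->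
  smooth_on V f -> smooth_on U (f \o T).
Proof. by move=> *; apply/smooth_term_smooth; apply: (@St_comp m V). Qed.

Lemma smooth_sqrt (f : 'rV[R]_n -> R) : Sm f -> (forall x, U x -> 0 < f x) ->
  Sm (fun x => Num.sqrt (f x)).
Proof. by move=> *; apply/smooth_term_smooth/St_sqrt => //; exact: St_smooth. Qed.

Lemma smoothZ (a : R) f : Sm f -> Sm (fun x => a * f x : R).
Proof. by move=> sf; apply: smoothM => //; exact: smooth_cst. Qed.

Lemma smoothN f : Sm f -> Sm (fun x => - f x : R).
Proof.
move=> sf; apply: smooth_ext (smoothZ (-1) sf) => x _.
by rewrite mulN1r.
Qed.

Lemma smoothB f g : Sm f -> Sm g -> Sm (fun x => f x - g x : R).
Proof. by move=> sf sg; apply: smoothD => //; exact: smoothN. Qed.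

Lemma smooth_sum (I : Type) (r : seq I) (P : pred I) (F : I -> 'rV[R]_n -> R) :
  (forall i, Sm (F i)) -> Sm (fun x => \sum_(i <- r | P i) F i x).
Proof.
move=> sF; elim: r => [|i r IH].
  by apply: smooth_ext (smooth_cst (0 : R^o)) => x _; rewrite big_nil.
case Pi: (P i); last by apply: smooth_ext IH => x _; rewrite big_cons Pi.
by apply: smooth_ext (smoothD (sF i) IH) => x _; rewrite big_cons Pi.
Qed.

Lemma smooth_prod (I : Type) (r : seq I) (P : pred I) (F : I -> 'rV[R]_n -> R) :
  (forall i, Sm (F i)) -> Sm (fun x => \prod_(i <- r | P i) F i x).
Proof.
move=> sF; elim: r => [|i r IH].
  by apply: smooth_ext (smooth_cst (1 : R^o)) => x _; rewrite big_nil.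
case Pi: (P i); last by apply: smooth_ext IH => x _; rewrite big_cons Pi.
by apply: smooth_ext (smoothM (sF i) IH) => x _; rewrite big_cons Pi.
Qed.

End SmoothFunctions.

(** * Symmetry of second derivatives *)

Section Schwarz.
Variables (R : realType) (n : nat) (U : set 'rV[R]_n).
Hypothesis openU : open U.
Notation Sm f := (smooth_on U (f : 'rV[R]_n -> R^o)).
Implicit Types (f : 'rV[R]_n -> R) (u v x y : 'rV[R]_n).

Let is_derive_shift_arg f a z w : derivable f (z + a) w ->
  is_derive z w (fun y => f (y + a)) ('D_w f (z + a)).
Proof.
have E : (fun h : R => h^-1 *: (f (h *: w + (z + a)) - f (z + a))) =
     (fun h : R => h^-1 *: (f (h *: w + z + a) - f (z + a))).
  by apply/funext => h; rewrite addrA.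
by rewrite /derivable /= E => df; split; rewrite /derivable /derive /= ?E.
Qed.

(** The second difference is symmetric in u and v, while the derivative on the
   right is not: exchanging u and v equates the two mixed derivatives of f at
   points arbitrarily close to x. *)
Let second_difference f x u v (r t : R) : Sm f ->
  (forall y, `|y - x| < r -> U y) -> 0 < t -> t * (`|u| + `|v|) < r ->
  exists2 y, `|y - x| < r &
    f (x + t *: u + t *: v) - f (x + t *: u) - (f (x + t *: v) - f x) =
    t ^+ 2 * 'D_v (fun y => 'D_u f y) y.
Proof.
move=> sf Ur t0 tr.
have near_x (s s' : R) : 0 <= s <= 1 -> 0 <= s' <= 1 ->
    `|x + s *: (t *: u) + s' *: (t *: v) - x| < r.
  move=> /andP[s0 s1] /andP[s'0 s'1].
  rewrite -[x + _ + _]addrA [X in `|X|]addrAC subrr add0r; apply: le_lt_trans (ler_normD _ _) _.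
  apply: le_lt_trans tr; rewrite !normrZ (ger0_norm s0) (ger0_norm s'0) gtr0_norm //.
  rewrite mulrDr lerD // ler_piMl // mulr_ge0 //; exact: ltW.
have I0 : (0 : R) <= (0 : R) <= (1 : R) by rewrite lexx ler01.
have I1 : (0 : R) <= (1 : R) <= (1 : R) by rewrite lexx ler01.
have D w y : U y -> derivable f y w by move=> Uy; exact: smooth_derivable sf Uy.
pose g y := f (y + t *: v) - f y.
have U1 (s : R) : 0 <= s <= 1 -> U (x + s *: (t *: u) + t *: v).
  by move=> s01; apply: Ur; rewrite -[t *: v]scale1r; exact: near_x.
have U0 (s : R) : 0 <= s <= 1 -> U (x + s *: (t *: u)).
  by move=> s01; apply: Ur; have := near_x _ _ s01 I0; rewrite scale0r addr0.
have dg (s : R) w : 0 <= s <= 1 -> is_derive (x + s *: (t *: u)) w g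
   ('D_w f (x + s *: (t *: u) + t *: v) - 'D_w f (x + s *: (t *: u))).
  move=> s01; have d1 := is_derive_shift_arg (D w _ (U1 s s01)).
  have d0 := derivableP (D w _ (U0 s s01)).
  exact: is_deriveB.
have [|s s01] := @mvt_dir R _ g x (t *: u).
  by move=> s s01; have [] := dg s (t *: u) s01.
have [_ ->] := dg s (t *: u) s01.
have [_ ->] := derive_dirZ t (D u _ (U1 s s01)).
have [_ ->] := derive_dirZ t (D u _ (U0 s s01)).
have D2 w y : U y -> derivable (fun y => 'D_u f y) y w.
  by move=> Uy; exact: smooth_derivable (smooth_derive u sf) Uy.
have [|s' s'01] := @mvt_dir R _ (fun y => 'D_u f y) (x + s *: (t *: u)) (t *: v).
  by move=> s' s'01; apply: D2; apply: Ur; exact: near_x.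
have Us' := Ur _ (near_x _ _ s01 s'01).
have [_ ->] := derive_dirZ t (D2 v _ Us') => E1 E2.
exists (x + s *: (t *: u) + s' *: (t *: v)); first exact: near_x.
by move: E2; rewrite -scalerBr E1 /g => ->; rewrite expr2 -mulrA.
Qed.

Lemma schwarz f x u v : Sm f -> U x ->
  'D_u (fun y => 'D_v f y) x = 'D_v (fun y => 'D_u f y) x.
Proof.
move=> sf Ux; apply/eqP; rewrite -subr_eq0 -normr_le0.
apply/ler_addgt0Pr => e e0; rewrite add0r.
have e20 : 0 < e / 2 by rewrite divr_gt0.
have c1 := smooth_continuous (smooth_derive u (smooth_derive v sf)) Ux.
have c2 := smooth_continuous (smooth_derive v (smooth_derive u sf)) Ux.
move/cvgrPdist_le/(_ _ e20): c1 => c1; move/cvgrPdist_le/(_ _ e20): c2 => c2.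
have : \forall y \near x, [/\ U y,
    `|'D_u (fun y => 'D_v f y) x - 'D_u (fun y => 'D_v f y) y| <= e / 2 &
    `|'D_v (fun y => 'D_u f y) x - 'D_v (fun y => 'D_u f y) y| <= e / 2].
  apply: (@filterS3 _ (nbhs x) _ _ _ _ _ _ (near_open openU Ux) c1 c2) => y.
  exact: And3.
move=> /nbhs_ballP [r /= r0 Hr].
have {}Hr y : `|y - x| < r -> [/\ U y,
    `|'D_u (fun y => 'D_v f y) x - 'D_u (fun y => 'D_v f y) y| <= e / 2 &
    `|'D_v (fun y => 'D_u f y) x - 'D_v (fun y => 'D_u f y) y| <= e / 2].
  by move=> yr; apply: Hr; rewrite -ball_normE /= distrC.
have Ur y : `|y - x| < r -> U y by case/Hr.
pose t := r / (`|u| + `|v| + 1).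
have S0 : 0 < `|u| + `|v| + 1 by rewrite ltr_wpDl ?addr_ge0.
have t0 : 0 < t by rewrite divr_gt0.
have tr : t * (`|u| + `|v|) < r.
  by rewrite /t mulrAC ltr_pdivrMr // ltr_pM2l // ltrDl.
have [y yr E1] := second_difference sf Ur t0 tr.
have [z zr E2] := second_difference (u := v) (v := u) sf Ur t0 (ltac:(by rewrite addrC)).
have t2 : t ^+ 2 != 0 by rewrite expf_neq0 // gt_eqF.
have {}E : 'D_v (fun y => 'D_u f y) y = 'D_u (fun y => 'D_v f y) z.
  have alg (a b c d : R) : a - b - (c - d) = a - c - (b - d) by ring.
  apply: (mulfI t2).
  apply: etrans (esym E1) _; apply: etrans E2.
  by rewrite (addrAC x (t *: v)); exact: alg.
have [_ _ Hy] := Hr y yr; have [_ Hz _] := Hr z zr.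
rewrite [e]splitr; apply: le_trans (lerD Hz Hy).
rewrite -E [X in _ <= _ + X]distrC; apply: le_trans (ler_normD _ _).
by rewrite addrA subrK.
Qed.

End Schwarz.

(** * Matrix-valued smooth functions *)

Section MatrixCalculus.
Variables (R : realType) (n : nat) (U : set 'rV[R]_n).
Hypothesis openU : open U.
Notation Sm f := (smooth_on U (f : 'rV[R]_n -> R^o)).
Implicit Types (x u v w : 'rV[R]_n) (p q r : nat).

(** Equivalent to [smooth_on U M]; with entries, the closure properties reduce to
   those of scalar functions. *)
Definition smx p q (M : 'rV[R]_n -> 'M[R]_(p, q)) : Prop :=
  forall i j, Sm (fun x => M x i j).

(** The coinduction is on the class of the (i, j) entries of smooth matrices. *)
Lemma smooth_on_smx p q (M : 'rV[R]_n -> 'M[R]_(p, q)) :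
  smooth_on U M -> smx M.
Proof.
move=> sM i j; apply: (@smooth_coind _ _ U R^o (fun f => exists2 M : 'rV[R]_n -> 'M[R]_(p, q),
    smooth_on U M & forall x, U x -> f x = M x i j)); last by exists M.
move=> f [{}M {}sM fM]; have Mf x : U x -> M x i j = f x by move/fM.
split=> [x Ux|x v Ux|v].
- apply: (continuous_near_eq openU Ux Mf).
  apply: (@continuous_comp _ _ _ M (fun A : 'M[R]_(p, q) => A i j)).
    exact: smooth_continuous sM Ux.
  exact: coord_continuous.
- apply: (derivable_eq_on openU Mf Ux).
  by have /derivable_mxP := smooth_derivable (v := v) sM Ux; apply.
exists (fun x => 'D_v M x); first exact: smooth_derive.
move=> x Ux; rewrite (derive_eq_on openU v fM Ux) derive_mxE //.
exact: smooth_derivable sM Ux.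
Qed.

Lemma smx_derivable p q (M : 'rV[R]_n -> 'M[R]_(p, q)) x v :
  smx M -> U x -> derivable M x v.
Proof. by move=> sM Ux; apply/derivable_mxP => i j; exact: smooth_derivable (sM i j) Ux. Qed.

Lemma smx_ext p q (M N : 'rV[R]_n -> 'M[R]_(p, q)) :
  (forall x, U x -> M x = N x) -> smx M -> smx N.
Proof.
by move=> MN sM i j; apply: smooth_ext (sM i j) => // x Ux; rewrite MN.
Qed.

Lemma smx_derive p q (M : 'rV[R]_n -> 'M[R]_(p, q)) v :
  smx M -> smx (fun x => 'D_v M x).
Proof.
move=> sM i j; apply: smooth_ext (smooth_derive v (sM i j)) => // x Ux.
by rewrite derive_mxE //; exact: smx_derivable.
Qed.

Lemma smx_differentiable p q (M : 'rV[R]_n -> 'M[R]_(p, q)) x :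
  smx M -> U x -> differentiable M x.
Proof.
move=> sM Ux; apply: mx_differentiable => k l.
exact: (smooth_differentiable openU (sM k l) Ux).
Qed.

Lemma smx_smooth_on p q (M : 'rV[R]_n -> 'M[R]_(p, q)) :
  smx M -> smooth_on U M.
Proof.
apply: (@smooth_coind _ _ U 'M[R]_(p, q) (@smx p q)) => {}M sM; split=> [x Ux|x v Ux|v].
- exact/differentiable_continuous/smx_differentiable.
- exact: smx_derivable.
exact: smx_derive.
Qed.

Lemma smx_cst p q (A : 'M[R]_(p, q)) : smx (cst A).
Proof. by move=> i j; exact: smooth_cst. Qed.

Lemma smxD p q (M N : 'rV[R]_n -> 'M[R]_(p, q)) :
  smx M -> smx N -> smx (fun x => M x + N x).
Proof.
by move=> sM sN i j; apply: smooth_ext (smoothD openU (sM i j) (sN i j)) => // x _; rewrite mxE.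
Qed.

Lemma smxZ p q (f : 'rV[R]_n -> R) (N : 'rV[R]_n -> 'M[R]_(p, q)) :
  Sm f -> smx N -> smx (fun x => f x *: N x).
Proof.
by move=> sf sN i j; apply: smooth_ext (smoothM openU sf (sN i j)) => // x _; rewrite mxE.
Qed.

Lemma smxN p q (M : 'rV[R]_n -> 'M[R]_(p, q)) : smx M -> smx (fun x => - M x).
Proof.
by move=> sM i j; apply: smooth_ext (smoothN openU (sM i j)) => // x _; rewrite mxE.
Qed.

Lemma smxB p q (M N : 'rV[R]_n -> 'M[R]_(p, q)) :
  smx M -> smx N -> smx (fun x => M x - N x).
Proof. by move=> sM sN; apply: smxD => //; exact: smxN. Qed.

Lemma smx_mul p q r (M : 'rV[R]_n -> 'M[R]_(p, q)) (N : 'rV[R]_n -> 'M[R]_(q, r)) :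
  smx M -> smx N -> smx (fun x => M x *m N x).
Proof.
move=> sM sN i j.
have := smooth_sum openU (index_enum 'I_q) xpredT
  (fun k => smoothM openU (sM i k) (sN k j)).
by apply: smooth_ext => // x _; rewrite mxE.
Qed.

Lemma smx_trmx p q (M : 'rV[R]_n -> 'M[R]_(p, q)) : smx M -> smx (fun x => (M x)^T).
Proof. by move=> sM i j; apply: smooth_ext (sM j i) => // x _; rewrite mxE. Qed.

Lemma smx_tr p (M : 'rV[R]_n -> 'M[R]_p) : smx M -> Sm (fun x => \tr (M x)).
Proof. by move=> sM; apply: smooth_sum => // i; exact: sM. Qed.

Lemma smx_det p (M : 'rV[R]_n -> 'M[R]_p) : smx M -> Sm (fun x => \det (M x)).
Proof.
move=> sM; apply: (smooth_sum openU _ _ (F := fun s x => _)) => s.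
by apply: smoothZ => //; apply: smooth_prod => // i; exact: sM.
Qed.

Lemma smx_invmx p (M : 'rV[R]_n -> 'M[R]_p) : smx M ->
  (forall x, U x -> M x \in unitmx) -> smx (fun x => invmx (M x)).
Proof.
move=> sM uM; have d0 x : U x -> \det (M x) != 0.
  by move=> Ux; rewrite -unitfE -unitmxE uM.
suff sadj : smx (fun x => \adj (M x)).
  apply: smx_ext (smxZ (smoothV openU (smx_det sM) d0) sadj) => x Ux.
  by rewrite /invmx uM.
move=> i j.
have sc : Sm (fun x => cofactor (M x) j i).
  apply: smoothZ => //; apply: smx_det => k l.
  by apply: smooth_ext (sM (lift j k) (lift i l)) => // x _; rewrite !mxE.
by apply: smooth_ext sc => // x _; rewrite mxE.
Qed.

Lemma derive_mulmx p q r (M : 'rV[R]_n -> 'M[R]_(p, q)) (N : 'rV[R]_n -> 'M[R]_(q, r)) x v :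
  derivable M x v -> derivable N x v ->
  is_derive x v (fun y => M y *m N y) ('D_v M x *m N x + M x *m 'D_v N x).
Proof.
move=> dM dN; have /derivable_mxP dM' := dM; have /derivable_mxP dN' := dN.
have H i j : is_derive x v (fun y => (M y *m N y) i j)
    (('D_v M x *m N x + M x *m 'D_v N x) i j).
  have -> : (fun y => (M y *m N y) i j) = \sum_k (fun y => M y i k * N y k j).
    by apply/funext => y; rewrite fct_sumE mxE.
  rewrite 3!mxE -big_split /=; apply: is_derive_sum => k.
  rewrite !derive_mxE //.
  have := is_deriveM (derivableP (dM' i k)) (derivableP (dN' k j)).
  move/is_derive_eq; apply.
  by rewrite addrC; congr (_ + _); exact: mulrC.
have d : derivable (fun y => M y *m N y) x v.
  by apply/derivable_mxP => i j; case: (H i j).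
split => //; apply/matrixP => i j; rewrite derive_mxE //.
by case: (H i j).
Qed.

Lemma derive_trmx p q (M : 'rV[R]_n -> 'M[R]_(p, q)) x v :
  derivable M x v -> is_derive x v (fun y => (M y)^T) ('D_v M x)^T.
Proof.
move=> dM; have E i j : (fun y => (M y)^T i j) = (fun y => M y j i).
  by apply/funext => y; rewrite mxE.
have d : derivable (fun y => (M y)^T) x v.
  by apply/derivable_mxP => i j; rewrite E; move/derivable_mxP: dM; apply.
split=> //; apply/matrixP => i j; rewrite mxE (derive_mxE i j d).
by rewrite (derive_mxE j i dM) E.
Qed.

Lemma smx_schwarz p q (M : 'rV[R]_n -> 'M[R]_(p, q)) x u v : smx M -> U x ->
  'D_u (fun y => 'D_v M y) x = 'D_v (fun y => 'D_u M y) x.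
Proof.
move=> sM Ux; apply/matrixP => i j.
have d a b : derivable (fun y => 'D_a M y) x b.
  exact: (@smx_derivable p q (fun y => 'D_a M y) x b (@smx_derive p q M a sM) Ux).
have E a b : 'D_b (fun y => 'D_a M y) x i j = 'D_b (fun y => 'D_a (fun z => M z i j) y) x.
  apply: etrans (derive_mxE i j (d a b)) _.
  apply: (derive_eq_on openU) => // y Uy.
  by apply: derive_mxE; exact: smx_derivable.
apply: etrans (E v u) _; apply: etrans (esym (E u v)).
exact: schwarz (sM i j) Ux.
Qed.

End MatrixCalculus.

(** * Bilinear forms *)

Section InnerTheory.
Variables (R : realType) (n : nat).
Implicit Types (G H J A : 'M[R]_n) (u v w : 'rV[R]_n).

Lemma innerDl G u v w : inner G (u + v) w = inner G u w + inner G v w.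
Proof. by rewrite /inner !mulmxDl mxE. Qed.

Lemma innerDr G u v w : inner G w (u + v) = inner G w u + inner G w v.
Proof. by rewrite /inner linearD mulmxDr mxE. Qed.

Lemma innerZl G (a : R) u v : inner G (a *: u) v = a * inner G u v.
Proof. by rewrite /inner -!scalemxAl mxE. Qed.

Lemma innerZr G (a : R) u v : inner G u (a *: v) = a * inner G u v.
Proof. by rewrite /inner linearZ /= -!scalemxAr mxE. Qed.

Lemma innerNl G u v : inner G (- u) v = - inner G u v.
Proof. by rewrite -scaleN1r innerZl mulN1r. Qed.

Lemma innerNr G u v : inner G u (- v) = - inner G u v.
Proof. by rewrite -scaleN1r innerZr mulN1r. Qed.

Lemma inner0l G v : inner G 0 v = 0.
Proof. by rewrite -(scale0r 0) innerZl mul0r. Qed.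

Lemma inner0r G v : inner G v 0 = 0.
Proof. by rewrite -(scale0r 0) innerZr mul0r. Qed.

Definition innerE := (innerDl, innerDr, innerZl, innerZr, innerNl, innerNr).

Lemma innerDm G H u v : inner (G + H) u v = inner G u v + inner H u v.
Proof. by rewrite /inner mulmxDr mulmxDl mxE. Qed.

Lemma innerZm G (a : R) u v : inner (a *: G) u v = a * inner G u v.
Proof. by rewrite /inner -scalemxAr -scalemxAl mxE. Qed.

Lemma inner_delta G i j : inner G (delta_mx 0 i) (delta_mx 0 j) = G i j.
Proof. by rewrite /inner -rowE trmx_delta -colE !mxE. Qed.

Lemma inner_mulmx G H J u v :
  inner (J *m H *m G^T) u v = inner H (u *m J) (v *m G).
Proof. by rewrite /inner trmx_mul !mulmxA. Qed.

Lemma inner_mulmxl A G u v : inner (A *m G) u v = inner G (u *m A) v.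
Proof. by rewrite /inner !mulmxA. Qed.

Lemma inner_trmx G u v : inner G^T u v = inner G v u.
Proof.
rewrite /inner -[in RHS](trmxK (v *m G)) -trmx_mul [in RHS]mxE.
by rewrite trmx_mul !mulmxA.
Qed.

Lemma inner_sym G u v : G^T = G -> inner G u v = inner G v u.
Proof. by move=> sG; rewrite -{1}sG inner_trmx. Qed.

Lemma inner_ext G H : (forall u v, inner G u v = inner H u v) -> G = H.
Proof. by move=> E; apply/matrixP => i j; rewrite -!inner_delta. Qed.

Lemma inner_sum_deltal G u v : inner G u v = \sum_k u 0 k * inner G (delta_mx 0 k) v.
Proof.
rewrite {1}[u]row_sum_delta /inner !mulmx_suml summxE; apply: eq_bigr => k _.
by rewrite -!scalemxAl mxE.
Qed.

Lemma inner_sum_delta G u v : inner G u v = \sum_k v 0 k * inner G u (delta_mx 0 k).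
Proof.
by rewrite -inner_trmx inner_sum_deltal; apply: eq_bigr => k _; rewrite inner_trmx.
Qed.

Lemma innerEmx G u v : inner G u v = (u *m G *m v^T) 0 0.
Proof. by []. Qed.

Lemma inner_summ (I : Type) (r : seq I) (a : I -> R) (F : I -> 'M[R]_n) u v :
  inner (\sum_(k <- r) a k *: F k) u v = \sum_(k <- r) a k * inner (F k) u v.
Proof.
elim: r => [|k r IH]; first by rewrite !big_nil /inner mulmx0 mul0mx mxE.
by rewrite !big_cons innerDm innerZm IH.
Qed.

Definition posdef G : Prop := forall v, v != 0 -> 0 < inner G v v.

Lemma posdef_unit G : posdef G -> G \in unitmx.
Proof.
move=> pG; rewrite -row_free_unit; apply/inj_row_free => v vG.
apply/eqP/negP => /negP/pG; by rewrite /inner vG mul0mx mxE ltxx.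
Qed.

Lemma inner_nondegl G u v : G \in unitmx ->
  (forall w, inner G u w = inner G v w) -> u = v.
Proof.
move=> uG E; apply: (can_inj (mulmxK uG)); apply/rowP => k.
have := E (delta_mx 0 k); rewrite /inner trmx_delta -!colE.
by rewrite !mxE.
Qed.

End InnerTheory.

(** * Derivatives of matrix-valued functions *)

(** Derivatives and Christoffel symbols are sealed: identities between many
   derivatives in different directions follow, and unfolding a derivative to the
   limit that defines it never helps to compare two of them. *)
HB.lock Definition dmx (R : realType) (n p q : nat) (v : 'rV[R]_n)
    (M : 'rV[R]_n -> 'M[R]_(p, q)) (x : 'rV[R]_n) : 'M[R]_(p, q) := 'D_v M x.

HB.lock Definition chr (R : realType) (n : nat) (G : 'rV[R]_n -> 'M[R]_n)
  (u v x : 'rV[R]_n) : 'rV[R]_n := christoffel G x u v.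

Lemma dmxE (R : realType) (n p q : nat) (M : 'rV[R]_n -> 'M[R]_(p, q)) x v :
  dmx v M x = 'D_v M x.
Proof. by rewrite dmx.unlock. Qed.

Section MatrixDerivative.
Variables (R : realType) (n : nat) (U : set 'rV[R]_n).
Hypothesis openU : open U.
Implicit Types (x u v w : 'rV[R]_n) (p q r : nat).

Lemma smx_dmx p q (M : 'rV[R]_n -> 'M[R]_(p, q)) v : smx U M -> smx U (dmx v M).
Proof.
by move=> sM; apply: (smx_ext openU _ (smx_derive openU v sM)) => x _; rewrite dmxE.
Qed.

Lemma dmx_eq p q (M N : 'rV[R]_n -> 'M[R]_(p, q)) v x :
  (forall y, U y -> M y = N y) -> U x -> dmx v M x = dmx v N x.
Proof. by move=> MN Ux; rewrite !dmxE; exact: (derive_eq_on openU). Qed.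

Lemma dmx_cst p q (A : 'M[R]_(p, q)) v x : dmx v (fun _ => A) x = 0.
Proof. by rewrite dmxE (derive_cst A). Qed.

Lemma dmxM p q r (M : 'rV[R]_n -> 'M[R]_(p, q)) (N : 'rV[R]_n -> 'M[R]_(q, r)) v x :
  smx U M -> smx U N -> U x ->
  dmx v (fun y => M y *m N y) x = dmx v M x *m N x + M x *m dmx v N x.
Proof.
move=> sM sN Ux; rewrite !dmxE.
by have [_ ->] := derive_mulmx (smx_derivable (v := v) sM Ux) (smx_derivable (v := v) sN Ux).
Qed.

Lemma dmx_mull p q r (A : 'M[R]_(p, q)) (N : 'rV[R]_n -> 'M[R]_(q, r)) v x :
  smx U N -> U x -> dmx v (fun y => A *m N y) x = A *m dmx v N x.
Proof.
move=> sN Ux; rewrite (dmxM _ (smx_cst U A) sN Ux) -[cst A]/(fun _ => A).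
by rewrite dmx_cst mul0mx add0r.
Qed.

Lemma dmx_trmx p q (M : 'rV[R]_n -> 'M[R]_(p, q)) v x :
  smx U M -> U x -> dmx v (fun y => (M y)^T) x = (dmx v M x)^T.
Proof.
move=> sM Ux; rewrite !dmxE.
by have [_ ->] := derive_trmx (smx_derivable (v := v) sM Ux).
Qed.

Lemma dmxD p q (M N : 'rV[R]_n -> 'M[R]_(p, q)) v x :
  smx U M -> smx U N -> U x ->
  dmx v (fun y => M y + N y) x = dmx v M x + dmx v N x.
Proof.
move=> sM sN Ux; rewrite !dmxE.
exact: deriveD (smx_derivable (v := v) sM Ux) (smx_derivable (v := v) sN Ux).
Qed.

Lemma dmx_linear p q (M : 'rV[R]_n -> 'M[R]_(p, q)) x :
  smx U M -> U x -> linear (fun v => dmx v M x).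
Proof.
move=> sM Ux a u v; have dM := smx_differentiable openU sM Ux.
by rewrite !dmxE (deriveDdir _ _ dM) (deriveZdir _ _ dM).
Qed.

Lemma dmx_sum_dir p q (M : 'rV[R]_n -> 'M[R]_(p, q)) x v :
  smx U M -> U x -> dmx v M x = \sum_k v 0 k *: dmx (delta_mx 0 k) M x.
Proof.
move=> sM Ux; have dM := smx_differentiable openU sM Ux.
rewrite dmxE {1}[v]row_sum_delta (derive_sum_dir _ _ _ dM).
by apply: eq_bigr => k _; rewrite dmxE.
Qed.

Lemma dmx_schwarz p q (M : 'rV[R]_n -> 'M[R]_(p, q)) x u v :
  smx U M -> U x -> dmx u (dmx v M) x = dmx v (dmx u M) x.
Proof.
move=> sM Ux.
have E a : dmx a M = fun y => 'D_a M y by apply/funext => y; rewrite dmxE.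
by rewrite !E !dmxE (smx_schwarz openU u v sM Ux).
Qed.

Lemma smx_comp m p q (V : set 'rV[R]_m) (T : 'rV[R]_n -> 'rV[R]_m)
    (M : 'rV[R]_m -> 'M[R]_(p, q)) :
  open V -> (forall x, U x -> V (T x)) -> smx U T -> smx V M -> smx U (M \o T).
Proof.
move=> oV TV sT sM i j.
exact: (smooth_comp openU oV TV (fun k => sT 0 k) (sM i j)).
Qed.

Lemma dmx_comp m p q (V : set 'rV[R]_m) (T : 'rV[R]_n -> 'rV[R]_m)
    (M : 'rV[R]_m -> 'M[R]_(p, q)) v x :
  open V -> (forall x, U x -> V (T x)) -> smx U T -> smx V M -> U x ->
  dmx v (M \o T) x = dmx (dmx v T x) M (T x).
Proof.
move=> oV TV sT sM Ux; rewrite !dmxE.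
exact: (derive_comp_dir v (smx_differentiable openU sT Ux)
  (smx_differentiable oV sM (TV x Ux))).
Qed.

Lemma linmapE (L : 'rV[R]_n -> 'rV[R]_n) c : linear L ->
  L c = c *m (\matrix_i L (delta_mx 0 i) : 'M[R]_n).
Proof.
move=> linL; pose lM := GRing.isLinear.Build _ _ _ _ _ linL.
pose F : {linear 'rV[R]_n -> 'rV[R]_n} := HB.pack L lM.
rewrite -[LHS]/(F c) {1}[c]row_sum_delta linear_sum mulmx_sum_row.
by apply: eq_bigr => k _; rewrite linearZ rowK.
Qed.

(** Differentiates Christoffel symbols whose vector arguments vary with the
   point: a linear map of row vectors is a matrix product, which reduces the
   rule to [dmxM]. *)
Lemma dmx_linmap (L : 'rV[R]_n -> 'rV[R]_n -> 'rV[R]_n) (b : 'rV[R]_n -> 'rV[R]_n) u x :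
  (forall y, U y -> linear (L y)) -> (forall c, smx U (L^~ c)) -> smx U b -> U x ->
  smx U (fun y => L y (b y)) /\
  dmx u (fun y => L y (b y)) x = dmx u (L^~ (b x)) x + L x (dmx u b x).
Proof.
move=> linL sL sb Ux; pose M y : 'M[R]_n := \matrix_i L y (delta_mx 0 i).
have LM y c : U y -> L y c = c *m M y.
  by move=> Uy; rewrite (linmapE _ (linL y Uy)).
have sM : smx U M.
  by move=> i j; apply: smooth_ext (sL (delta_mx 0 i) 0 j) => // y _; rewrite mxE.
split; first by apply: (smx_ext openU _ (smx_mul openU sb sM)) => y Uy; rewrite LM.
have -> : dmx u (fun y => L y (b y)) x = dmx u (fun y => b y *m M y) x.
  by apply: dmx_eq => // y Uy; rewrite LM.
have -> : dmx u (L^~ (b x)) x = dmx u (fun y => b x *m M y) x.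
  by apply: dmx_eq => // y Uy; rewrite LM.
by rewrite (dmxM _ sb sM Ux) (dmx_mull _ _ sM Ux) LM // addrC.
Qed.

End MatrixDerivative.

(** * Christoffel symbols and curvature in a chart *)

Section Christoffel.
Variables (R : realType) (n : nat) (U : set 'rV[R]_n) (G : 'rV[R]_n -> 'M[R]_n).
Hypothesis openU : open U.
Hypothesis smG : smx U G.
Hypothesis symG : forall x, U x -> (G x)^T = G x.
Hypothesis unitG : forall x, U x -> G x \in unitmx.
Implicit Types x u v w : 'rV[R]_n.

Lemma derive_inner x u v w : U x ->
  'D_u (fun y => inner (G y) v w) x = inner (dmx u G x) v w.
Proof.
move=> Ux.
have s1 := smx_mul openU (smx_cst U v) smG.
have s2 := smx_mul openU s1 (smx_cst U w^T).
apply: etrans (esym (derive_mxE 0 0 (smx_derivable (v := u) s2 Ux))) _.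
rewrite -dmxE (dmxM _ s1 (smx_cst _ _) Ux) -[cst w^T]/(fun _ => w^T).
by rewrite dmx_cst mulmx0 addr0 (dmx_mull _ _ smG Ux).
Qed.

Lemma chrP x u v w : U x ->
  inner (G x) (chr G u v x) w =
  2^-1 * (inner (dmx u G x) v w + inner (dmx v G x) u w - inner (dmx w G x) u v).
Proof.
move=> Ux; rewrite innerEmx chr.unlock /christoffel mulmxKV ?unitG // mxE.
rewrite (inner_sum_delta (dmx u G x)) (inner_sum_delta (dmx v G x)).
rewrite (dmx_sum_dir openU w smG Ux) inner_summ.
rewrite -big_split -sumrB mulr_sumr /=; apply: eq_bigr => k _.
rewrite !mxE !derive_inner //.
by rewrite mulrC mulrCA -!mulrDr -mulrBr.
Qed.

Lemma chr_sym x u v : U x -> chr G u v x = chr G v u x.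
Proof.
move=> Ux; apply: (inner_nondegl (unitG Ux)) => w; rewrite !chrP //.
have -> : inner (dmx w G x) v u = inner (dmx w G x) u v.
  apply: inner_sym; rewrite -(dmx_trmx _ smG Ux).
  exact: (dmx_eq openU).
by congr (_ * (_ - _)); rewrite addrC.
Qed.

Lemma chr_linr x u : U x -> linear (fun v => chr G u v x).
Proof.
move=> Ux a v v'; apply: (inner_nondegl (unitG Ux)) => w.
rewrite !innerDl !innerZl !chrP // (dmx_linear openU smG Ux).
by rewrite !innerDm !innerZm !innerE; ring.
Qed.

Lemma chr_linl x v : U x -> linear (fun u => chr G u v x).
Proof.
by move=> Ux a u u'; rewrite !(chr_sym _ v) // chr_linr.
Qed.

Lemma smx_chr u v : smx U (chr G u v).
Proof.
have -> : chr G u v = fun x => christoffel G x u v.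
  by apply/funext => x; rewrite chr.unlock.
apply: smx_mul => //; last exact: smx_invmx.
move=> i j; pose I (a b : 'rV[R]_n) (x : 'rV[R]_n) : R := inner (G x) a b.
have sI a b : smooth_on U (I a b : _ -> R^o).
  have s1 := smx_mul openU (smx_mul openU (smx_cst U a) smG) (smx_cst U b^T).
  by apply: smooth_ext (s1 0 0) => // y _; rewrite /I innerEmx.
have := smoothZ openU 2^-1 (smoothB openU (smoothD openU (smooth_derive u (sI v (delta_mx 0 j)))
  (smooth_derive v (sI u (delta_mx 0 j)))) (smooth_derive (delta_mx 0 j) (sI u v))).
by apply: smooth_ext => // x _; rewrite mxE.
Qed.

Lemma curvature_opE x u v w : U x ->
  curvature_op G x u v w =
  dmx u (chr G v w) x - dmx v (chr G u w) x
  + chr G u (chr G v w x) x - chr G v (chr G u w x) x.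
Proof.
move=> Ux.
have nablaE X Y : nabla G X Y = fun y => dmx (X y) Y y + chr G (X y) (Y y) y.
  by apply/funext => y; rewrite chr.unlock dmxE.
have E a b : nabla G (cst a) (cst b) = chr G a b.
  by apply/funext => y; rewrite nablaE (dmx_cst b) add0r.
have L a b : lie_bracket (cst a) (cst b) = cst (0 : 'rV[R]_n).
  by apply/funext => y; rewrite /lie_bracket -!dmxE (dmx_cst a) (dmx_cst b) subrr.
rewrite /curvature_op /curvature_field L !E !nablaE /cst.
have -> : chr G 0 w x = 0.
  by have := chr_linl w Ux (-1) 0 0; rewrite scaler0 addr0 scaleN1r addNr.
rewrite subr0 opprD !addrA.
by congr (_ - _); rewrite addrAC.
Qed.

Lemma smx_curvature_op u v w : smx U (fun x => curvature_op G x u v w).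
Proof.
have sL a b : smx U (fun y => chr G a (chr G b w y) y).
  have sM : smx U (fun y => (\matrix_i chr G a (delta_mx 0 i) y : 'M[R]_n)).
    by move=> i j; apply: smooth_ext (smx_chr a (delta_mx 0 i) 0 j) => // y _; rewrite mxE.
  apply: (smx_ext openU _ (smx_mul openU (smx_chr b w) sM)) => y Uy.
  by rewrite (linmapE _ (chr_linr a Uy)).
have s1 := smxB openU (smx_dmx openU u (smx_chr v w)) (smx_dmx openU v (smx_chr u w)).
apply: (smx_ext openU _ (smxB openU (smxD openU s1 (sL u v)) (sL v u))) => x Ux.
by rewrite curvature_opE.
Qed.

End Christoffel.

(** * Change of coordinates *)

Section ChangeOfCoordinates.
Variables (R : realType) (n : nat) (U V : set 'rV[R]_n).
Variables (G H : 'rV[R]_n -> 'M[R]_n) (T : 'rV[R]_n -> 'rV[R]_n).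
Hypotheses (openU : open U) (openV : open V).
Hypotheses (smG : smx U G) (smH : smx V H) (smT : smx U T).
Hypothesis TV : forall x, U x -> V (T x).
Hypothesis symG : forall x, U x -> (G x)^T = G x.
Hypothesis symH : forall x, V x -> (H x)^T = H x.
Hypothesis unitG : forall x, U x -> G x \in unitmx.
Hypothesis unitH : forall x, V x -> H x \in unitmx.
Hypothesis GH : forall x u v, U x ->
  inner (G x) u v = inner (H (T x)) (dmx u T x) (dmx v T x).
Implicit Types x u v w : 'rV[R]_n.

Definition jacobian_mx x : 'M[R]_n := \matrix_i dmx (delta_mx 0 i) T x.
Let J := jacobian_mx.

Lemma jacobian_mxE x u : U x -> dmx u T x = u *m J x.
Proof. by move=> Ux; rewrite (linmapE _ (dmx_linear openU smT Ux)). Qed.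

Let smJ : smx U J.
Proof.
move=> i j; apply: smooth_ext (smx_dmx openU (delta_mx 0 i) smT 0 j) => // x _.
by rewrite mxE.
Qed.

Lemma metric_mx_change x : U x -> G x = J x *m H (T x) *m (J x)^T.
Proof.
move=> Ux; apply: inner_ext => u v.
by rewrite inner_mulmx GH // !jacobian_mxE.
Qed.

Lemma jacobian_mx_unit x : U x -> J x \in unitmx.
Proof.
move=> Ux; have := unitG Ux; rewrite metric_mx_change // -mulmxA unitmx_mul.
by case/andP.
Qed.

Let S u v x := dmx u (dmx v T) x.

Let SE u v x : U x -> S u v x = v *m dmx u J x.
Proof.
move=> Ux; rewrite -(dmx_mull _ _ smJ Ux); apply: (dmx_eq openU) => // y Uy.
exact: jacobian_mxE.
Qed.

Let S_sym u v x : U x -> S u v x = S v u x.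
Proof. by move=> Ux; exact: (dmx_schwarz openU u v smT Ux). Qed.

Let dG u v w x : U x -> inner (dmx u G x) v w =
  inner (H (T x)) (S u v x) (w *m J x) + inner (dmx (u *m J x) H (T x)) (v *m J x) (w *m J x)
  + inner (H (T x)) (v *m J x) (S u w x).
Proof.
move=> Ux.
have sHT := smx_comp openU openV TV smT smH.
have sJt := smx_trmx openU smJ.
have -> : dmx u G x = dmx u (fun y => J y *m (H \o T) y *m (J y)^T) x.
  by apply: (dmx_eq openU) => // y Uy; exact: metric_mx_change.
rewrite (dmxM _ (smx_mul openU smJ sHT) sJt Ux) (dmxM _ smJ sHT Ux) (dmx_trmx _ smJ Ux).
rewrite (dmx_comp openU _ openV TV smT smH Ux) jacobian_mxE //.
by rewrite mulmxDl !innerDm !inner_mulmx !SE.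
Qed.

(** Each of the three derivatives of G in the Koszul formula [chrP] contributes
   two second derivatives of T; as these are symmetric, four of the six cancel
   and the other two are equal. *)
Lemma chr_change u v x : U x ->
  chr G u v x *m J x = S u v x + chr H (u *m J x) (v *m J x) (T x).
Proof.
move=> Ux; have VT := TV Ux.
apply: (inner_nondegl (unitH VT)) => z.
rewrite -(mulmxKV (jacobian_mx_unit Ux) z); set w := z *m invmx _.
have E : inner (H (T x)) (chr G u v x *m J x) (w *m J x) = inner (G x) (chr G u v x) w.
  by rewrite [G x in RHS]metric_mx_change // inner_mulmx.
rewrite E innerDl (chrP openV smH unitH) // (chrP openU smG unitG) //.
rewrite !dG // (S_sym w u) // (S_sym w v) // (S_sym v u) //.
rewrite (inner_sym _ (v *m J x) (symH VT)).
rewrite (inner_sym (u *m J x) _ (symH VT)).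
move: (inner (H (T x)) _ _) (inner (H (T x)) _ _) (inner (H (T x)) _ _) => a b c.
by field.
Qed.

Let chrDr a b c y : V y -> chr H a (b + c) y = chr H a b y + chr H a c y.
Proof.
by move=> Vy; have := chr_linr openV smH unitH a Vy 1 b c; rewrite !scale1r.
Qed.

Let dmx_chr_change u v w x : U x ->
  dmx u (chr G v w) x *m J x = dmx u (S v w) x
  + dmx (u *m J x) (chr H (v *m J x) (w *m J x)) (T x)
  + chr H (S u v x) (w *m J x) (T x) + chr H (v *m J x) (S u w x) (T x)
  - S u (chr G v w x) x.
Proof.
move=> Ux; have VT := TV Ux.
have sJ (c : 'rV[R]_n) : smx U (fun y => c *m J y) := smx_mul openU (smx_cst U c) smJ.
have dJ a c : dmx a (fun y => c *m J y) x = S a c x by rewrite SE // (dmx_mull _ _ smJ Ux).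
have sHT a b : smx U (fun y => chr H a b (T y)).
  exact: (smx_comp openU openV TV smT (smx_chr openV smH unitH a b)).
have [_ E1] := dmx_linmap (L := fun y c => chr H c (w *m J x) (T y)) openU u
  (fun y Uy => chr_linl openV smH symH unitH (w *m J x) (TV Uy)) (sHT^~ _) (sJ v) Ux.
have sL c : smx U (fun y => chr H (v *m J y) c (T y)).
  exact: (dmx_linmap (L := fun y c' => chr H c' c (T y)) openU u
    (fun y Uy => chr_linl openV smH symH unitH c (TV Uy)) (sHT^~ _) (sJ v) Ux).1.
have [sLL E2] := dmx_linmap (L := fun y c => chr H (v *m J y) c (T y)) openU u
  (fun y Uy => chr_linr openV smH unitH (v *m J y) (TV Uy)) sL (sJ w) Ux.
have sZ := smx_chr openU smG unitG v w.
have E3 := dmxM u sZ smJ Ux.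
have E4 : dmx u (fun y => chr G v w y *m J y) x =
    dmx u (fun y => S v w y + chr H (v *m J y) (w *m J y) (T y)) x.
  by apply: (dmx_eq openU) => // y Uy; exact: chr_change.
have sS : smx U (S v w) := smx_dmx openU v (smx_dmx openU w smT).
have E5 := dmxD u sS sLL Ux.
have E6 := dmx_comp openU u openV TV smT (smx_chr openV smH unitH (v *m J x) (w *m J x)) Ux.
apply: (addIr (chr G v w x *m dmx u J x)).
have {}E6 : dmx u (fun y => chr H (v *m J x) (w *m J x) (T y)) x =
  dmx (dmx u T x) (chr H (v *m J x) (w *m J x)) (T x) := E6.
rewrite -E3 E4 E5 E2 E1 !dJ E6 -SE // jacobian_mxE //.
by rewrite subrK !addrA.
Qed.

(** The inhomogeneous terms of [chr_change] drop out of the curvature because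
   the third derivatives of T commute and its second derivatives enter
   symmetrically. *)
Lemma curvature_op_change u v w x : U x ->
  curvature_op G x u v w *m J x =
  curvature_op H (T x) (u *m J x) (v *m J x) (w *m J x).
Proof.
move=> Ux; have VT := TV Ux.
rewrite (curvature_opE openU smG symG unitG) // (curvature_opE openV smH symH unitH) //.
rewrite !mulmxDl !mulNmx !dmx_chr_change // !chr_change // !chrDr //.
have -> : dmx v (S u w) x = dmx u (S v w) x.
  exact: (dmx_schwarz openU v u (smx_dmx openU w smT) Ux).
rewrite (S_sym v u) //.
by apply/rowP => k; rewrite !mxE; ring.
Qed.

End ChangeOfCoordinates.

(** * Curvature of a conformally Euclidean metric *)

Section KulkarniNomizu.
Variables (R : realType) (n : nat).
Implicit Types (G A : 'M[R]_n) (u v w : 'rV[R]_n).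

(** The (1,3) tensor of the Kulkarni-Nomizu product of G with the bilinear form
   (u, v) |-> G(uA, v); vectors are rows, so operators act on the right. *)
Definition kn_op G A u v w : 'rV[R]_n :=
  inner G v w *: (u *m A) - inner G u w *: (v *m A)
  + inner G (v *m A) w *: u - inner G (u *m A) w *: v.

End KulkarniNomizu.

HB.lock Definition dsc (R : realType) (n : nat) (v : 'rV[R]_n)
  (f : 'rV[R]_n -> R) (x : 'rV[R]_n) : R := 'D_v f x.

Section ScalarDerivative.
Variables (R : realType) (n : nat) (U : set 'rV[R]_n).
Hypothesis openU : open U.
Notation Sm f := (smooth_on U (f : 'rV[R]_n -> R^o)).
Implicit Types (x u v w : 'rV[R]_n) (f g : 'rV[R]_n -> R).

Lemma dscE f v x : dsc v f x = 'D_v f x.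
Proof. by rewrite dsc.unlock. Qed.

Lemma smooth_dsc f v : Sm f -> Sm (dsc v f).
Proof.
move=> sf; apply: (smooth_ext openU _ (smooth_derive v sf)) => x _.
by rewrite dscE.
Qed.

Lemma dsc_eq f g v x : (forall y, U y -> f y = g y) -> U x -> dsc v f x = dsc v g x.
Proof. by move=> fg Ux; rewrite !dscE; exact: (derive_eq_on openU). Qed.

Lemma dscM f g v x : Sm f -> Sm g -> U x ->
  dsc v (fun y => f y * g y) x = dsc v f x * g x + f x * dsc v g x.
Proof.
move=> sf sg Ux; rewrite !dscE.
have df : derivable f x v by exact: smooth_derivable sf Ux.
have dg : derivable g x v by exact: smooth_derivable sg Ux.
by rewrite (deriveM df dg) addrC [_ * g x]mulrC.
Qed.

Lemma dscD f g v x : Sm f -> Sm g -> U x ->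
  dsc v (fun y => f y + g y) x = dsc v f x + dsc v g x.
Proof.
move=> sf sg Ux; rewrite !dscE.
have df : derivable f x v by exact: smooth_derivable sf Ux.
have dg : derivable g x v by exact: smooth_derivable sg Ux.
exact: deriveD df dg.
Qed.

Lemma dsc_cst (a : R) v x : dsc v (fun _ => a) x = 0.
Proof. by rewrite dscE (derive_cst a). Qed.

Lemma dscZ (a : R) f v x : Sm f -> U x -> dsc v (fun y => a * f y) x = a * dsc v f x.
Proof.
move=> sf Ux; rewrite (dscM v (smooth_cst U (a : R^o)) sf Ux) -[cst a]/(fun _ => a).
by rewrite dsc_cst mul0r add0r.
Qed.

Lemma dscV f v x : Sm f -> (forall y, U y -> f y != 0) -> U x ->
  dsc v (fun y => (f y)^-1) x = - (f x ^- 2 * dsc v f x).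
Proof.
move=> sf f0 Ux; have sV := smoothV openU sf f0.
have : dsc v (fun y => f y * (f y)^-1) x = 0.
  rewrite -(dsc_cst 1 v x); apply: dsc_eq => // y Uy; by rewrite divff ?f0.
rewrite (dscM _ sf sV Ux) => /eqP; rewrite addr_eq0 => /eqP E.
apply: (mulfI (f0 x Ux)); rewrite -[LHS]opprK -E mulrN mulrA; congr (- _).
by rewrite mulrC; congr (_ * _); field; exact: f0.
Qed.

Lemma dsc_mxE p q (M : 'rV[R]_n -> 'M[R]_(p, q)) v x i j : smx U M -> U x ->
  dsc v (fun y => M y i j) x = dmx v M x i j.
Proof.
move=> sM Ux; rewrite dscE dmxE.
by rewrite (derive_mxE i j (smx_derivable (v := v) sM Ux)).
Qed.

Lemma dmx_scale p q f (N : 'rV[R]_n -> 'M[R]_(p, q)) v x :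
  Sm f -> smx U N -> U x ->
  dmx v (fun y => f y *: N y) x = dsc v f x *: N x + f x *: dmx v N x.
Proof.
move=> sf sN Ux; apply/matrixP => i j.
rewrite -(dsc_mxE v i j (smxZ openU sf sN) Ux) !mxE -(dsc_mxE v i j sN Ux).
rewrite -(dscM v sf (sN i j) Ux); apply: dsc_eq => // y _; by rewrite mxE.
Qed.

Definition gradient f x : 'rV[R]_n := \row_k dsc (delta_mx 0 k) f x.

Lemma smx_gradient f : Sm f -> smx U (gradient f).
Proof.
move=> sf i j; apply: (smooth_ext openU _ (smooth_dsc (delta_mx 0 j) sf)) => x _.
by rewrite mxE.
Qed.

Lemma dsc_gradient f v x : Sm f -> U x -> dsc v f x = inner 1%:M (gradient f x) v.
Proof.
move=> sf Ux; have df : differentiable f x := smooth_differentiable openU sf Ux.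
rewrite inner_sum_delta dscE {1}[v]row_sum_delta (derive_sum_dir _ _ _ df).
apply: eq_bigr => k _; congr (_ * _); rewrite -dscE.
by rewrite /inner mulmx1 trmx_delta -colE !mxE.
Qed.

Lemma hessian_sym f u v x : Sm f -> U x ->
  inner 1%:M (dmx u (gradient f) x) v = inner 1%:M (dmx v (gradient f) x) u.
Proof.
move=> sf Ux; have sg := smx_gradient sf.
have E a b : inner 1%:M (dmx a (gradient f) x) b = dsc a (dsc b f) x.
  have -> : dsc a (dsc b f) x = dsc a (fun y => (gradient f y *m b^T) 0 0) x.
    apply: dsc_eq => // y Uy.
    by rewrite (dsc_gradient b sf Uy) /inner mulmx1.
  have sc := smx_mul openU sg (smx_cst U b^T).
  rewrite (dsc_mxE a 0 0 sc Ux) (dmxM _ sg (smx_cst _ _) Ux) -[cst b^T]/(fun _ => b^T).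
  by rewrite dmx_cst mulmx0 addr0 /inner mulmx1.
rewrite !E !dscE.
have F a b : 'D_a (dsc b f) x = 'D_a (fun y => 'D_b f y) x.
  by apply: (derive_eq_on openU) => // y _; rewrite dscE.
by rewrite !F; exact: (schwarz openU u v sf Ux).
Qed.

End ScalarDerivative.

Section ConformalCurvature.
Variables (R : realType) (n : nat) (U : set 'rV[R]_n) (phi : 'rV[R]_n -> R).
Variable G : 'rV[R]_n -> 'M[R]_n.
Hypothesis openU : open U.
Hypothesis sphi : smooth_on U (phi : 'rV[R]_n -> R^o).
Hypothesis phi0 : forall x, U x -> phi x != 0.
Hypothesis GE : forall x, U x -> G x = (phi x ^- 2)%:M.
Notation Sm f := (smooth_on U (f : 'rV[R]_n -> R^o)).
Implicit Types (x u v w : 'rV[R]_n).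

Let gr := gradient phi.
Let dot u v := inner (1%:M : 'M[R]_n) u v.

(** The Euclidean gradient of ln |phi|. *)
Let a x : 'rV[R]_n := (phi x)^-1 *: gr x.

Lemma inner_scalar_mx (c : R) u v : inner (c%:M) u v = c * dot u v.
Proof. by rewrite -scalemx1 innerZm. Qed.

Let sgr : smx U gr := smx_gradient openU sphi.

Let dotC u v : dot u v = dot v u.
Proof. by apply: inner_sym; rewrite trmx1. Qed.

Let sphi2 : Sm (fun y => phi y ^- 2).
Proof.
have sV := smoothV openU sphi phi0.
by apply: (smooth_ext openU _ (smoothM openU sV sV)) => x _; rewrite expr2 invfM.
Qed.

Lemma smx_conformal_metric : smx U G.
Proof.
apply: (smx_ext openU _ (smxZ openU sphi2 (smx_cst U (1%:M : 'M[R]_n)))) => x Ux.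
by rewrite /cst scalemx1 GE.
Qed.

Lemma conformal_metric_sym x : U x -> (G x)^T = G x.
Proof. by move=> Ux; rewrite GE // tr_scalar_mx. Qed.

Lemma conformal_metric_unit x : U x -> G x \in unitmx.
Proof.
by move=> Ux; rewrite GE // unitmxE det_scalar unitfE !expf_neq0 // invr_eq0 expf_neq0 // phi0.
Qed.

Let dG u x : U x -> dmx u G x = (- 2 * phi x ^- 3 * dot (gr x) u)%:M.
Proof.
move=> Ux; have sV := smoothV openU sphi phi0.
have -> : dmx u G x = dmx u (fun y => phi y ^- 2 *: cst (1%:M : 'M[R]_n) y) x.
  by apply: (dmx_eq openU) => // y Uy; rewrite /cst scalemx1 GE.
rewrite (dmx_scale openU u sphi2 (smx_cst U 1%:M) Ux) -[cst 1%:M]/(fun _ => 1%:M).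
rewrite dmx_cst scaler0 addr0 scalemx1; congr (_%:M).
have -> : dsc u (fun y => phi y ^- 2) x = dsc u (fun y => (phi y)^-1 * (phi y)^-1) x.
  by apply: (dsc_eq openU) => // y _; rewrite expr2 invfM.
rewrite (dscM _ sV sV Ux) (dscV openU _ sphi phi0 Ux) (dsc_gradient openU u sphi Ux).
rewrite -/gr -/(dot (gr x) u).
by field; exact: phi0.
Qed.

(** The Christoffel symbols of phi^-2 g_E, as a function linear in b = grad ln |phi|. *)
Let cf u v b : 'rV[R]_n := dot u v *: b - dot b u *: v - dot b v *: u.

Lemma chr_conformal u v x : U x -> chr G u v x = cf u v (a x).
Proof.
move=> Ux; apply: (inner_nondegl (conformal_metric_unit Ux)) => w.
rewrite (chrP openU smx_conformal_metric conformal_metric_unit) //.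
rewrite !dG // GE // !inner_scalar_mx -!/(dot _ _) /cf /a /dot !innerE -!/(dot _ _).
rewrite (dotC v w) (dotC u w) (dotC w).
by field; exact: phi0.
Qed.

Let h u x := (phi x)^-1 *: dmx u gr x.

Let da u x : U x -> dmx u a x = h u x - dot (a x) u *: a x.
Proof.
move=> Ux; have sV := smoothV openU sphi phi0.
rewrite (dmx_scale openU u sV sgr Ux) (dscV openU _ sphi phi0 Ux).
rewrite (dsc_gradient openU u sphi Ux) -/gr -/(dot _ _) addrC; congr (_ + _).
rewrite /a /dot innerZl -/(dot _ _) scalerA scaleNr; congr (- (_ *: _)).
by field; exact: phi0.
Qed.

Let sa : smx U a.
Proof. exact: (smxZ openU (smoothV openU sphi phi0) sgr). Qed.

Let cf_linear u v : linear (cf u v).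
Proof.
move=> c b b'; rewrite /cf /dot !innerE -!/(dot _ _).
by apply/rowP => k; rewrite !mxE; ring.
Qed.

Let dmx_chr u v w x : U x -> dmx u (chr G v w) x = cf v w (dmx u a x).
Proof.
move=> Ux; rewrite (linmapE (dmx u a x) (cf_linear v w)).
set K : 'M[R]_n := \matrix_i _.
have sK := smx_cst U K.
have -> : dmx u (chr G v w) x = dmx u (fun y => a y *m K) x.
  apply: (dmx_eq openU) => // y Uy.
  by rewrite chr_conformal // (linmapE _ (cf_linear v w)).
rewrite (dmxM _ sa sK Ux) -[cst K]/(fun _ => K).
by rewrite dmx_cst mulmx0 addr0.
Qed.

(** The Schouten operator phi Hess phi - |grad phi|^2 / 2 of the metric
   phi^-2 g_E, with Euclidean gradient and Hessian. *)
Definition conformal_schouten x : 'M[R]_n :=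
  phi x *: (\matrix_i dmx (delta_mx 0 i) gr x) - (2^-1 * dot (gr x) (gr x))%:M.

Let hessE u x : U x -> u *m (\matrix_i dmx (delta_mx 0 i) gr x : 'M[R]_n) = dmx u gr x.
Proof. by move=> Ux; rewrite -(linmapE u (dmx_linear openU sgr Ux)). Qed.

(** Direct computation from the Christoffel symbols; beyond algebra it uses only
   the symmetry of the Hessian. *)
Lemma conformal_curvature u v w x : U x ->
  curvature_op G x u v w = kn_op (G x) (conformal_schouten x) u v w.
Proof.
move=> Ux; have p0 := phi0 Ux.
rewrite (curvature_opE openU smx_conformal_metric conformal_metric_sym
  conformal_metric_unit) //.
rewrite !dmx_chr // !chr_conformal // !da //.
have hs : dot (dmx v gr x) u = dot (dmx u gr x) v.
  by rewrite /dot (hessian_sym openU u v sphi Ux).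
rewrite /kn_op /conformal_schouten !mulmxBr -!scalemxAr !hessE // !mul_mx_scalar.
have hE b : phi x *: dmx b gr x = phi x ^+ 2 *: h b x.
  by rewrite /h scalerA expr2 mulfK.
have aE : dot (gr x) (gr x) = phi x ^+ 2 * dot (a x) (a x).
  by rewrite /a /dot innerZl innerZr -/(dot _ _); field.
rewrite !hE aE GE // !inner_scalar_mx -!/(dot _ _).
rewrite /cf /dot !innerE -!/(dot _ _).
rewrite ?(dotC v u) ?(dotC w u) ?(dotC w v) hs.
rewrite ?(dotC u (gr x)) ?(dotC v (gr x)).
by apply/rowP => k; rewrite !mxE; field.
Qed.

Lemma conformal_schouten_sym x : U x -> (conformal_schouten x)^T = conformal_schouten x.
Proof.
move=> Ux; rewrite /conformal_schouten linearB linearZ /= tr_scalar_mx; congr (_ *: _ - _).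
apply: inner_ext => u v; rewrite inner_trmx.
have E b c : inner (\matrix_i dmx (delta_mx 0 i) gr x) b c = dot (dmx b gr x) c.
  by rewrite -(mulmx1 (\matrix_i _)) inner_mulmxl hessE.
by rewrite !E /dot (hessian_sym openU u v sphi Ux).
Qed.

(** Schur's lemma. If the Schouten operator is the scalar s, then Hess phi = t I;
   comparing mixed third derivatives of phi gives dt = 0, and then
   s = phi t - |grad phi|^2 / 2 has derivative t dphi - t dphi = 0. *)
Lemma conformal_schur (s : 'rV[R]_n -> R) x : (1 < n)%N ->
  (forall y, U y -> conformal_schouten y = (s y)%:M) -> U x ->
  \forall y \near x, s y = s x.
Proof.
move=> n1 As Ux.
pose i0 := Ordinal (ltnW n1).
pose Hs y : 'M[R]_n := \matrix_i dmx (delta_mx 0 i) gr y.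
have sHs : smx U Hs.
  move=> i j; apply: (smooth_ext openU _ (smx_dmx openU (delta_mx 0 i) sgr 0 j)) => y _.
  by rewrite mxE.
pose t y := Hs y i0 i0.
have Ht y : U y -> Hs y = (t y)%:M.
  move=> Uy; have : phi y *: Hs y = (s y + 2^-1 * dot (gr y) (gr y))%:M.
    by rewrite raddfD /= -(As y Uy) /conformal_schouten subrK.
  move=> /(congr1 (fun A => (phi y)^-1 *: A)).
  rewrite scalerA mulVf ?phi0 // scale1r scale_scalar_mx => E.
  by rewrite /t E mxE eqxx.
have dgr v y : U y -> dmx v gr y = t y *: v.
  by move=> Uy; rewrite -hessE // -/(Hs y) Ht // mul_mx_scalar.
have st : Sm t := sHs i0 i0.
have dt0 k y : U y -> dsc (delta_mx 0 k) t y = 0.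
  move=> Uy; have [j jk] : exists j : 'I_n, j != k.
    have [->|k0] := eqVneq k i0; last by exists i0; rewrite eq_sym.
    by exists (Ordinal n1).
  have D i l : dmx (delta_mx 0 l) (dmx (delta_mx 0 i) gr) y =
      dsc (delta_mx 0 l) t y *: delta_mx 0 i.
    have e := smx_cst U (delta_mx 0 i : 'rV[R]_n).
    have -> : dmx (delta_mx 0 l) (dmx (delta_mx 0 i) gr) y =
       dmx (delta_mx 0 l) (fun z => t z *: cst (delta_mx 0 i) z) y.
      by apply: (dmx_eq openU) => // z Uz; rewrite dgr.
    rewrite (dmx_scale openU _ st e Uy) -[cst _]/(fun _ => delta_mx 0 i).
    by rewrite dmx_cst scaler0 addr0.
  have := dmx_schwarz openU (delta_mx 0 k) (delta_mx 0 j) sgr Uy.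
  rewrite !D => /rowP /(_ j).
  by rewrite !mxE !eqxx /= (negbTE jk) mulr1 mulr0.
have {}dt0 v y : U y -> dsc v t y = 0.
  move=> Uy; rewrite (dsc_gradient openU v st Uy) inner_sum_deltal.
  by rewrite big1 // => k _; rewrite mxE dt0 // mul0r.
pose S y := phi y * t y + - 2^-1 * (gr y *m (gr y)^T) 0 0.
have sS y : U y -> s y = S y.
  move=> Uy; have /matrixP/(_ i0 i0) := As y Uy.
  rewrite /conformal_schouten -/(Hs y) !mxE eqxx !mulr1n => <-.
  by rewrite /S /t /Hs mxE /dot /inner mulmx1 mulNr.
have sgg := smx_mul openU sgr (smx_trmx openU sgr).
have smS : Sm S.
  exact: (smoothD openU (smoothM openU sphi st) (smoothZ openU (- 2^-1) (sgg 0 0))).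
have dS0 v y : U y -> dsc v S y = 0.
  move=> Uy; rewrite (dscD v (smoothM openU sphi st) (smoothZ openU (- 2^-1) (sgg 0 0)) Uy).
  rewrite (dscM v sphi st Uy) (dscZ _ v (sgg 0 0) Uy) (dsc_mxE v 0 0 sgg Uy).
  rewrite (dmxM v sgr (smx_trmx openU sgr) Uy) (dmx_trmx v sgr Uy) (dgr v y Uy).
  rewrite dt0 // mulr0 addr0 (dsc_gradient openU v sphi Uy) -/gr.
  have -> : (t y *: v *m (gr y)^T + gr y *m (t y *: v)^T) 0 0 = 2 * t y * dot (gr y) v.
    rewrite dotC mxE -[X in X + _](_ : dot (t y *: v) (gr y) = _); last first.
      by rewrite /dot /inner mulmx1.
    rewrite -[X in _ + X](_ : dot (gr y) (t y *: v) = _); last by rewrite /dot /inner mulmx1.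
    rewrite {1 2}/dot innerZl innerZr -!/(dot _ _) (dotC (gr y) v); ring.
  by rewrite -/(dot _ _); field.
have /nbhs_ballP [e /= e0 Be] : \forall y \near x, U y by exact: near_open.
apply/nbhs_ballP; exists e => // y ye.
have Us (r : R) : 0 <= r <= 1 -> U (x + r *: (y - x)).
  move=> /andP[r0 r1]; apply: Be; rewrite -ball_normE /= opprD addNKr normrN normrZ.
  rewrite ger0_norm //; apply: le_lt_trans (_ : _ <= `|y - x|) _; first by rewrite ler_piMl.
  by move: ye; rewrite -ball_normE /= distrC.
have [r r01|r r01] := @mvt_dir R _ S x (y - x).
  exact: smooth_derivable smS (Us r r01).
have -> : x + (y - x) = y by rewrite addrC subrK.
rewrite -dscE dS0; last exact: Us.
move=> /eqP; rewrite subr_eq0 => /eqP SE.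
by rewrite !sS //; exact: Be.
Qed.

End ConformalCurvature.

(** * Curvature tensors that are Kulkarni-Nomizu products *)

Section KulkarniNomizuAlgebra.
Variables (R : realType) (n : nat).
Implicit Types (G H A B J : 'M[R]_n) (u v w : 'rV[R]_n).

Lemma kn_op_change G H J B u v w : J \in unitmx -> G = J *m H *m J^T ->
  kn_op G (J *m B *m invmx J) u v w *m J = kn_op H B (u *m J) (v *m J) (w *m J).
Proof.
move=> uJ GE.
have gE a b : inner G a b = inner H (a *m J) (b *m J) by rewrite GE inner_mulmx.
have cA a : a *m (J *m B *m invmx J) *m J = a *m J *m B by rewrite !mulmxA mulmxKV.
by rewrite /kn_op !gE !(mulmxBl, mulmxDl) -!scalemxAl !cA.
Qed.

(** The Ricci form as a trace, hence smooth without a choice of orthonormal frames. *)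
Definition ricci_trace (op : 'rV[R]_n -> 'rV[R]_n -> 'rV[R]_n -> 'rV[R]_n) : 'M[R]_n :=
  \matrix_(i, j) \sum_k op (delta_mx 0 k) (delta_mx 0 i) (delta_mx 0 j) 0 k.

Lemma ricci_trace_kn G A : ricci_trace (kn_op G A) = (n%:R - 2) *: (A *m G) + \tr A *: G.
Proof.
apply/matrixP => i j.
have -> : ricci_trace (kn_op G A) i j = \sum_k (G i j * A k k - A i k * G k j
    + (A *m G) i j - (k == i)%:R * (A *m G) k j).
  rewrite mxE; apply: eq_bigr => k _.
  rewrite /kn_op -!inner_mulmxl !inner_delta -!rowE !mxE !eqxx /= mulr1.
  by rewrite [X in _ - X]mulrC [G k j * _]mulrC.
rewrite !sumrB big_split /= sumrB -mulr_sumr.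
have -> : \sum_k (k == i)%:R * (A *m G) k j = (A *m G) i j.
  by rewrite (bigD1 i) //= eqxx mul1r big1 ?addr0 // => k /negbTE ->; rewrite mul0r.
rewrite sumr_const card_ord -[X in _ + X - _]mulr_natl.
have -> : \sum_k A i k * G k j = (A *m G) i j by rewrite mxE.
rewrite [RHS]mxE [X in _ = X + _]mxE [X in _ = _ + X]mxE -/(\tr A).
by ring.
Qed.

(** Inverts A |-> (n - 2) A G + (tr A) G, the Ricci form of g /\ A: the trace of
   the Ricci operator is 2 (n - 1) tr A. *)
Definition schouten_of (r G : 'M[R]_n) : 'M[R]_n :=
  let B := r *m invmx G in (n%:R - 2)^-1 *: (B - ((2 * (n%:R - 1))^-1 * \tr B)%:M).

Lemma schouten_of_kn G A : (2 < n)%N -> G \in unitmx ->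
  schouten_of (ricci_trace (kn_op G A)) G = A.
Proof.
move=> n2 uG; rewrite /schouten_of ricci_trace_kn mulmxDl -!scalemxAl mulmxK // mulmxV //.
have n2' : n%:R - 2 != 0 :> R by rewrite subr_eq0 eqr_nat gtn_eqF.
have n1 : n%:R - 1 != 0 :> R by rewrite subr_eq0 (eqr_nat R n 1) gtn_eqF // ltnW.
set t := \tr A.
have -> : \tr ((n%:R - 2) *: A + t *: 1%:M) = 2 * (n%:R - 1) * t.
  by rewrite mxtraceD !mxtraceZ mxtrace1 -/t; ring.
rewrite mulrA mulVf; last by rewrite mulf_neq0 // pnatr_eq0.
by rewrite mul1r scalemx1 addrK scalerA mulVf // scale1r.
Qed.

Section Point.
Variables (Gf : 'rV[R]_n -> 'M[R]_n) (x : 'rV[R]_n) (A : 'M[R]_n).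
Let G := Gf x.
Hypothesis symG : G^T = G.
Hypothesis symAG : (A *m G)^T = A *m G.
Hypothesis curvE : forall u v w, curvature_op Gf x u v w = kn_op G A u v w.

Let gC u v : inner G u v = inner G v u.
Proof. exact: inner_sym. Qed.

Lemma selfadjoint u v : inner G (u *m A) v = inner G u (v *m A).
Proof. by rewrite -inner_mulmxl (inner_sym _ _ symAG) inner_mulmxl gC. Qed.

Lemma curvature_kn u v w z : curvature Gf x u v w z =
  inner G v w * inner G (u *m A) z - inner G u w * inner G (v *m A) z
  + inner G (v *m A) w * inner G u z - inner G (u *m A) w * inner G v z.
Proof. by rewrite /curvature curvE /kn_op !innerE. Qed.

Lemma sectional_kn v w : sectional Gf x v w =
  inner G w w * inner G (v *m A) v + inner G (w *m A) w * inner G v v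
  - 2 * inner G v w * inner G (v *m A) w.
Proof.
rewrite /sectional curvature_kn (gC w v) (selfadjoint w v) (gC w (v *m A)); ring.
Qed.

(** The form X.A: the derivation X applied to (u, v) |-> g(uA, v). *)
Definition derive_form (X : 'rV[R]_n -> 'rV[R]_n) a b : R :=
  - inner G (X a *m A) b - inner G (a *m A) (X b).

(** By the Leibniz rule, a derivation X that annihilates g maps g /\ A to
   g /\ (X.A). *)
Lemma derivation_kn (X : 'rV[R]_n -> 'rV[R]_n) v1 v2 v3 v4 :
  (forall a b, inner G (X a) b = - inner G a (X b)) ->
  let T := derive_form X in
  derivation_curvature Gf x X v1 v2 v3 v4 =
  inner G v2 v3 * T v1 v4 - inner G v1 v3 * T v2 v4
  + T v2 v3 * inner G v1 v4 - T v1 v3 * inner G v2 v4.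
Proof.
move=> skew T; rewrite /derivation_curvature !curvature_kn /T /derive_form.
by rewrite (skew v1 v3) (skew v2 v3) (skew v1 v4) (skew v2 v4); ring.
Qed.

Lemma curvature_op_skew u v a b :
  inner G (curvature_op Gf x u v a) b = - inner G a (curvature_op Gf x u v b).
Proof.
rewrite !curvE /kn_op !innerE (gC a u) (gC a v) (gC a) (gC a (v *m A)); ring.
Qed.

Lemma wedge_op_skew u v a b :
  inner G (wedge_op Gf x u v a) b = - inner G a (wedge_op Gf x u v b).
Proof. rewrite /wedge_op !innerE (gC a u) (gC a v); ring. Qed.

(** Both R(u, v) and u /\ v annihilate g, so [derivation_kn] applies to them. The
   form that it gives is quadratic in A for R(u, v) and linear in A for u /\ v, and
   the two combine into A^2 - L A. *)
Lemma deszcz_defect L u v v1 v2 v3 v4 :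
  let B := A *m A - L *: A in
  let T a b := inner G u a * inner G (v *m B) b - inner G v a * inner G (u *m B) b
    + inner G u b * inner G (v *m B) a - inner G v b * inner G (u *m B) a in
  R_dot_R Gf x v1 v2 v3 v4 u v - L * tachibana Gf x v1 v2 v3 v4 u v =
  inner G v2 v3 * T v1 v4 - inner G v1 v3 * T v2 v4
  + T v2 v3 * inner G v1 v4 - T v1 v3 * inner G v2 v4.
Proof.
move=> B T; rewrite /R_dot_R /tachibana.
have := derivation_kn v1 v2 v3 v4 (curvature_op_skew u v).
have := derivation_kn v1 v2 v3 v4 (wedge_op_skew u v).
move=> -> ->.
have TE a b : T a b = derive_form (curvature_op Gf x u v) a b
    - L * derive_form (wedge_op Gf x u v) a b.
  apply/esym; rewrite /derive_form.
  rewrite !curvE /T /B /wedge_op /kn_op !mulmxBr !mulmxDl ?mulNmx !innerE.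
  rewrite -!scalemxAl -!scalemxAr !innerE !mulmxA.
  rewrite !(gC (a *m A)) !(selfadjoint u b) !(selfadjoint v b) !(selfadjoint u a) !(selfadjoint v a).
  rewrite !(selfadjoint _ a) !(selfadjoint _ b).
  move: (inner G) (a *m A) (b *m A) (u *m A) (v *m A) => g a' b' u' v'.
  ring.
by rewrite !TE; move: (derive_form _) (derive_form _) (inner G) => p q g; ring.
Qed.

Lemma deszcz_of_quadratic L r : A *m A - L *: A = r%:M ->
  forall v1 v2 v3 v4 u v,
  R_dot_R Gf x v1 v2 v3 v4 u v = L * tachibana Gf x v1 v2 v3 v4 u v.
Proof.
move=> E v1 v2 v3 v4 u v; apply/eqP; rewrite -subr_eq0 deszcz_defect /= E.
have mE a b : inner G (a *m r%:M) b = r * inner G a b by rewrite mul_mx_scalar innerZl.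
by rewrite !mE; apply/eqP; ring.
Qed.

End Point.
End KulkarniNomizuAlgebra.

(** * Principal Ricci curvatures *)

Section RicciMultiplicity.
Variables (R : realType) (n : nat) (Gf : 'rV[R]_n -> 'M[R]_n) (x : 'rV[R]_n) (A : 'M[R]_n).
Let G := Gf x.
Hypothesis symG : G^T = G.
Hypothesis unitG : G \in unitmx.
Hypothesis curvE : forall u v w, curvature_op Gf x u v w = kn_op G A u v w.
Variable E : n.-tuple 'rV[R]_n.
Hypothesis orthE : Defs.orthonormal G E.

Lemma ricci_mx_kn : ricci_mx Gf E x = (n%:R - 2) *: (A *m G) + \tr A *: G.
Proof.
(* The frame E enters the sums only through Em^T Em, the inverse of G. *)
pose Em : 'M[R]_n := \matrix_i tnth E i.
have gE i j : inner G (tnth E i) (tnth E j) = (i == j)%:R.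
  have := orthE (i := i) (j := j); rewrite size_tuple => /(_ (ltn_ord _) (ltn_ord _)).
  by rewrite -!tnth_nth.
have EG : Em *m G *m Em^T = 1%:M.
  apply/matrixP => i j; rewrite mxE [RHS]mxE -gE -(rowK (tnth E) i) -(rowK (tnth E) j).
  by rewrite /inner mxE -row_mul; apply: eq_bigr => k _; rewrite !mxE.
have GF : G *m (Em^T *m Em) = 1%:M.
  by rewrite mulmxA; apply: mulmx1C; rewrite mulmxA.
have FG : (Em^T *m Em) *m G = 1%:M by exact: mulmx1C.
have sumE X Y u v : \sum_i inner X u (tnth E i) * inner Y (tnth E i) v =
    inner (X *m (Em^T *m Em) *m Y) u v.
  have -> : inner (X *m (Em^T *m Em) *m Y) u v =
      ((u *m X *m Em^T) *m (Em *m Y *m v^T)) 0 0 by rewrite /inner !mulmxA.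
  rewrite [RHS]mxE; apply: eq_bigr => i _; congr (_ * _).
    by rewrite -(rowK (tnth E) i) /inner 2!mxE; apply: eq_bigr => k _; rewrite !mxE.
  rewrite -{1}(rowK (tnth E) i) -/Em /inner -!row_mul [LHS]mxE.
  by [].
have trE : \sum_i inner (A *m G) (tnth E i) (tnth E i) = \tr A.
  transitivity (\tr (Em *m (A *m G) *m Em^T)).
    apply: eq_bigr => i _; rewrite [RHS]mxE -(rowK (tnth E) i) -/Em /inner [LHS]mxE.
    by rewrite -row_mul; apply: eq_bigr => k _; rewrite !mxE.
  by rewrite -mulmxA mxtrace_mulC -!mulmxA GF mulmx1.
apply/matrixP => i j; rewrite mxE /ricci big_tuple.
set u := delta_mx 0 i; set v := delta_mx 0 j.
have cE (k : 'I_n) : curvature Gf x u (tnth E k) (tnth E k) v = inner (A *m G) u v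
   - inner G u (tnth E k) * inner (A *m G) (tnth E k) v
   + inner (A *m G) (tnth E k) (tnth E k) * inner G u v
   - inner (A *m G) u (tnth E k) * inner G (tnth E k) v.
  by rewrite (curvature_kn curvE) !inner_mulmxl gE eqxx mul1r.
rewrite (eq_bigr _ (fun k _ => cE k)) !sumrB big_split /= sumrB.
rewrite sumr_const card_ord !sumE -mulr_suml trE GF mul1mx.
rewrite -(mulmxA A G) GF mulmx1 -(inner_delta _ i j) -/u -/v innerDm !innerZm.
by rewrite -mulr_natl; ring.
Qed.

Lemma ricci_multiplicity_kn (a : R) : (2 < n)%N ->
  ricci_multiplicity Gf E x ((n%:R - 2) * a + \tr A) = (n - \rank (A - a%:M)%R)%N.
Proof.
move=> n2; rewrite /ricci_multiplicity /ricci_eigenspace mxrank_ker; congr (_ - _)%N.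
have n2' : n%:R - 2 != 0 :> R by rewrite subr_eq0 (eqr_nat R n 2) gtn_eqF.
have -> : ricci_mx Gf E x - ((n%:R - 2) * a + \tr A) *: Gf x = (n%:R - 2) *: (A - a%:M) *m G.
  rewrite ricci_mx_kn -scalemxAl mulmxBl mul_scalar_mx -/G; move: (A *m G) => AG.
  by apply/matrixP => k l; rewrite !mxE; ring.
by rewrite mxrankMfree ?row_free_unit // eqmx_scale.
Qed.

End RicciMultiplicity.

(** * Self-adjoint operators with two eigenvalues *)

Section TwoEigenvalues.
Variables (R : realType) (n : nat).
Implicit Types (A J : 'M[R]_n) (a b : R).

Section Fixed.
Variables (A : 'M[R]_n) (a b : R).
Hypothesis ab : a != b.
Hypothesis Aab : (A - a%:M) *m (A - b%:M) = 0.

Lemma two_eigen_comm : (A - b%:M) *m (A - a%:M) = 0.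
Proof.
rewrite -Aab !mulmxBl !mulmxBr !mul_scalar_mx !mul_mx_scalar; move: (A *m A) => AA.
by apply/matrixP => k l; rewrite !mxE; ring.
Qed.

(** The ranks add up to at most n because the product vanishes, and to at least n
   because the difference of the factors is the invertible scalar b - a. *)
Lemma two_eigen_rank : (\rank (A - a%:M)%R + \rank (A - b%:M)%R = n)%N.
Proof.
apply/eqP; rewrite eqn_leq mulmx0_rank_max //=.
have E : (A - a%:M) + (- 1) *: (A - b%:M) = (b - a)%:M.
  by rewrite scaleN1r opprB addrC addrA subrK raddfB.
have rk : \rank ((b - a)%:M : 'M[R]_n) = n.
  by rewrite mxrank_unit // unitmxE det_scalar unitrX // unitfE subr_eq0 eq_sym.
apply: leq_trans (_ : \rank ((b - a)%:M : 'M[R]_n) <= _)%N; first by rewrite rk.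
rewrite -E; apply: leq_trans (mxrank_add _ _) _.
by rewrite leq_add2l mxrankS // scalemx_sub.
Qed.

(** Factor P = C B through its rank: P^2 = P forces B C = 1, and
   tr (C B) = tr (B C). *)
Lemma mxtrace_idem (P : 'M[R]_n) : P *m P = P -> \tr P = (\rank P)%:R.
Proof.
move=> PP; move: (mulmx_base P) (col_base_full P) (row_base_free P).
move: (col_base P) (row_base P) => C B CB fC fB.
have BC : B *m C = 1%:M.
  apply: (row_full_inj fC); apply: (row_free_inj fB).
  by rewrite /= mulmx1 !mulmxA CB -mulmxA CB PP.
by rewrite -{1}CB mxtrace_mulC BC mxtrace1.
Qed.

Let d := a - b.
(** The projection onto the eigenspace of a along that of b. *)
Let P := d^-1 *: (A - b%:M).

Let d0 : d != 0. Proof. by rewrite subr_eq0. Qed.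

Let PP : P *m P = P.
Proof.
rewrite /P -scalemxAl -scalemxAr; congr (_ *: _).
have -> : (A - b%:M) *m (A - b%:M) = d *: (A - b%:M).
  have {2}-> : A - b%:M = (A - a%:M) + d%:M.
    by rewrite /d raddfB /= addrA subrK.
  by rewrite mulmxDr two_eigen_comm add0r mul_mx_scalar.
by rewrite scalerA mulVf // scale1r.
Qed.

Let AE : A = b%:M + d *: P.
Proof. by rewrite /P scalerA divff // scale1r addrC subrK. Qed.

Let q := \rank (A - b%:M).

Let trP : \tr P = q%:R.
Proof. by rewrite (mxtrace_idem PP) /P eqmx_scale // invr_eq0. Qed.

Definition trace_mean (B : 'M[R]_n) : R := n%:R^-1 * \tr B.
Definition centered (B : 'M[R]_n) : 'M[R]_n := B - (trace_mean B)%:M.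
Definition moment2 (B : 'M[R]_n) : R := \tr (centered B *m centered B).
Definition moment3 (B : 'M[R]_n) : R := \tr (centered B *m centered B *m centered B).

Hypotheses (q0 : (0 < q)%N) (qn : (q < n)%N).

Let n0 : n%:R != 0 :> R.
Proof. by rewrite pnatr_eq0 -lt0n (leq_trans _ qn). Qed.

Let c : R := q%:R / n%:R.

Lemma trace_mean_two : trace_mean A = b + d * c.
Proof.
rewrite /trace_mean [X in \tr X]AE mxtraceD mxtrace_scalar mxtraceZ trP /c -mulr_natr.
by field.
Qed.

Let cenE : centered A = d *: (P - c%:M).
Proof.
rewrite /centered trace_mean_two [X in X - _]AE raddfD /= opprD addrACA subrr add0r.
by rewrite scalerBr scale_scalar_mx.
Qed.

Let cen2 : (P - c%:M) *m (P - c%:M) = (1 - 2 * c) *: P + (c ^+ 2)%:M.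
Proof.
rewrite mulmxBl !mulmxBr PP mul_scalar_mx !mul_mx_scalar; clear.
by apply/matrixP => k l; rewrite !mxE; ring.
Qed.

Let cen3 : (P - c%:M) *m (P - c%:M) *m (P - c%:M) =
  (1 - 3 * c + 3 * c ^+ 2) *: P + (- c ^+ 3)%:M.
Proof.
rewrite cen2; have := PP; move: P => Q QQ.
rewrite mulmxBr !mulmxDl -!scalemxAl QQ !mul_scalar_mx !mul_mx_scalar; clear.
by apply/matrixP => k l; rewrite !mxE; ring.
Qed.

Lemma moment2_two : moment2 A = d ^+ 2 * (q%:R * (1 - c)).
Proof.
rewrite /moment2 cenE -scalemxAl -scalemxAr cen2 scalerA mxtraceZ mxtraceD mxtraceZ.
by rewrite mxtrace_scalar trP -mulr_natr /c; field.
Qed.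

Lemma moment3_two : moment3 A = d ^+ 3 * (q%:R * (1 - c) * (1 - 2 * c)).
Proof.
rewrite /moment3 cenE; have := cen3; have := trP; move: P => Q trQ cQ.
rewrite -!scalemxAl -!scalemxAr -!scalemxAl cQ !scalerA mxtraceZ.
rewrite mxtraceD mxtraceZ mxtrace_scalar trQ -mulr_natr /c; field.
exact: n0.
Qed.

End Fixed.

(** The two eigenvalues of a matrix with exactly two, of multiplicities q and
   n - q, are functions of the moments of its spectrum. Odd moments determine
   which one has multiplicity q; when n = 2 q nothing does, and the larger one
   is taken first. As the second moment is positive, these formulas show that the
   eigenvalues of a smooth family of such matrices are smooth. *)
Definition eigen_gap (q : nat) A : R :=
  if (2 * q == n)%N then Num.sqrt ((q%:R * (1 - q%:R / n%:R))^-1 * moment2 A)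
  else moment3 A * ((1 - 2 * (q%:R / n%:R)) * moment2 A)^-1.

Definition eigen1 (q : nat) A : R := trace_mean A + (1 - q%:R / n%:R) * eigen_gap q A.
Definition eigen2 (q : nat) A : R := trace_mean A - q%:R / n%:R * eigen_gap q A.

Section Recover.
Variables (A : 'M[R]_n) (a b : R) (q : nat).
Hypothesis ab : a != b.
Hypothesis Aab : (A - a%:M) *m (A - b%:M) = 0.
Hypothesis rq : \rank (A - b%:M) = q.
Hypotheses (q0 : (0 < q)%N) (qn : (q < n)%N).

Let n0 : n%:R != 0 :> R.
Proof. by rewrite pnatr_eq0 -lt0n (leq_trans _ qn). Qed.

Let w0 : 0 < q%:R * (1 - q%:R / n%:R) :> R.
Proof.
rewrite mulr_gt0 ?ltr0n // subr_gt0 ltr_pdivrMr ?ltr0n ?(leq_trans _ qn) //.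
by rewrite mul1r ltr_nat.
Qed.

Let qn' : (\rank (A - b%:M)%R < n)%N.
Proof. by rewrite rq. Qed.

Lemma moment2_gt0 : 0 < moment2 A.
Proof.
rewrite (moment2_two ab Aab qn') rq mulr_gt0 // exprn_even_gt0 //= subr_eq0 //.
Qed.

Lemma eigen_gapE : ((2 * q)%N = n -> b < a) -> eigen_gap q A = a - b.
Proof.
move=> hba; rewrite /eigen_gap; case: eqP => [/hba ba|/eqP nq].
  rewrite (moment2_two ab Aab qn') rq mulrCA mulVf ?mulr1 ?gt_eqF // sqrtr_sqr.
  by rewrite gtr0_norm // subr_gt0.
have u0 : 1 - 2 * (q%:R / n%:R) != 0 :> R.
  rewrite subr_eq0 mulrA -natrM eq_sym -(inj_eq (mulIf n0)) mulfVK // mul1r eqr_nat //.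
rewrite (moment2_two ab Aab qn') (moment3_two ab Aab qn') rq.
have ab0 : a - b != 0 by rewrite subr_eq0.
have w0' := lt0r_neq0 w0; move: u0 ab0 w0'.
set w := q%:R * (1 - _); set u := 1 - _; move: w u (a - b) => w u d u0 d0 w0'.
by field; rewrite u0 d0 w0'.
Qed.

Lemma eigen1E : ((2 * q)%N = n -> b < a) -> eigen1 q A = a.
Proof.
move=> hba; rewrite /eigen1 eigen_gapE // (trace_mean_two ab Aab qn') rq; ring.
Qed.

Lemma eigen2E : ((2 * q)%N = n -> b < a) -> eigen2 q A = b.
Proof.
move=> hba; rewrite /eigen2 eigen_gapE // (trace_mean_two ab Aab qn') rq; ring.
Qed.

End Recover.
End TwoEigenvalues.

Section Quadratic.
Variables (R : realType) (n : nat).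
Implicit Types (A J : 'M[R]_n) (a b L r : R).

(** In a chart where g is a multiple of the identity, evaluating R.R = L Q(g, R)
   on basis vectors isolates the entries of A^2 - L A; a third index, distinct
   from two given ones, makes all other terms of [deszcz_defect] vanish. *)
Lemma quadratic_of_deszcz (Gf : 'rV[R]_n -> 'M[R]_n) x A lam L : (2 < n)%N ->
  Gf x = lam%:M -> lam != 0 -> A^T = A ->
  (forall u v w, curvature_op Gf x u v w = kn_op (Gf x) A u v w) ->
  (forall v1 v2 v3 v4 u v,
    R_dot_R Gf x v1 v2 v3 v4 u v = L * tachibana Gf x v1 v2 v3 v4 u v) ->
  exists r, A *m A - L *: A = r%:M.
Proof.
move=> n2 GE l0 sA curvE dz; set B := A *m A - L *: A.
have symG : (Gf x)^T = Gf x by rewrite GE tr_scalar_mx.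
have symAG : (A *m Gf x)^T = A *m Gf x.
  by rewrite GE mul_mx_scalar linearZ /= sA.
pose e (i : 'I_n) : 'rV[R]_n := delta_mx 0 i.
have ge i j : inner (Gf x) (e i) (e j) = lam * (i == j)%:R.
  by rewrite inner_delta GE mxE mulr_natr.
have Be i j : inner (Gf x) (e i *m B) (e j) = lam * B i j.
  by rewrite -inner_mulmxl inner_delta GE mul_mx_scalar mxE.
have third (i j : 'I_n) : exists k : 'I_n, (k != i) && (k != j).
  have : (0 < #|predC (pred2 i j)|)%N.
    rewrite -(ltn_add2l #|pred2 i j|) addn0 cardC card_ord card2.
    by apply: leq_ltn_trans n2; case: (_ != _).
  by case/card_gt0P => k; rewrite !inE negb_or; exists k.
pose T (u v a b : 'rV[R]_n) := inner (Gf x) u a * inner (Gf x) (v *m B) b - inner (Gf x) v a * inner (Gf x) (u *m B) b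
    + inner (Gf x) u b * inner (Gf x) (v *m B) a - inner (Gf x) v b * inner (Gf x) (u *m B) a.
have T0 i j u v : i != j -> T u v (e i) (e j) = 0.
  move=> ij; have [k /andP[ki kj]] := third i j.
  have D : R_dot_R Gf x (e i) (e k) (e k) (e j) u v
      - L * tachibana Gf x (e i) (e k) (e k) (e j) u v =
    inner (Gf x) (e k) (e k) * T u v (e i) (e j) - inner (Gf x) (e i) (e k) * T u v (e k) (e j)
    + T u v (e k) (e k) * inner (Gf x) (e i) (e j)
    - T u v (e i) (e k) * inner (Gf x) (e k) (e j).
    exact: deszcz_defect symG symAG curvE L u v (e i) (e k) (e k) (e j).
  move: D; rewrite dz subrr !ge eqxx (negbTE ij) (negbTE kj).
  rewrite eq_sym in ki; rewrite (negbTE ki) !mulr0 !mul0r !subr0 addr0 mulr1.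
  by move/esym/eqP; rewrite mulf_eq0 (negbTE l0) => /eqP.
have B0 k j : k != j -> B k j = 0.
  move=> kj; have [i /andP[ik ij]] := third k j.
  have := T0 i j (e i) (e k) ij; rewrite /T !ge !Be eqxx (negbTE ij) (negbTE kj).
  rewrite [k == i]eq_sym (negbTE ik) !mulr0 !mul0r !subr0 addr0 mulr1.
  by move/eqP; rewrite !mulf_eq0 (negbTE l0) => /eqP.
have n0 : (0 < n)%N by case: (n) n2.
exists (B (Ordinal n0) (Ordinal n0)); apply/matrixP => i j; rewrite [RHS]mxE.
have [<-|ij] := eqVneq i j; last by rewrite B0.
rewrite mulr1n; have [->//|ij] := eqVneq i (Ordinal n0).
have := T0 _ _ (e i) (e (Ordinal n0)) ij; rewrite /T !ge !Be !eqxx (negbTE ij).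
rewrite eq_sym in ij; rewrite (negbTE ij) !mulr0 !mul0r !mulr1 subr0 addr0.
by move/eqP; rewrite subr_eq0 => /eqP /(mulfI l0) /(mulfI l0).
Qed.

Lemma eigenvector_exists A a : (\rank (A - a%:M)%R < n)%N ->
  exists2 v : 'rV[R]_n, v != 0 & v *m A = a *: v.
Proof.
move=> rA; have : kermx (A - a%:M) != 0.
  by rewrite kermx_eq0 /row_free; apply: contraTN rA => /eqP ->; rewrite ltnn.
case/rowV0Pn => v /sub_kermxP vA v0; exists v => //.
by apply/eqP; rewrite -subr_eq0 -mul_mx_scalar -mulmxBr vA.
Qed.

Lemma root_of_eigenvalue A L r a : A *m A - L *: A = r%:M ->
  (\rank (A - a%:M)%R < n)%N -> a ^+ 2 - L * a = r.
Proof.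
move=> E /eigenvector_exists [v v0 vA]; apply/eqP; rewrite -subr_eq0.
have /eqP : (a ^+ 2 - L * a - r) *: v = 0.
  rewrite !scalerBl -(mul_mx_scalar r v) -E mulmxBr mulmxA -scalemxAr !vA -scalemxAl vA.
  by rewrite !scalerA expr2 subrr.
by rewrite scaler_eq0 (negbTE v0) orbF.
Qed.

Lemma two_eigen_of_quadratic A L r a b : A *m A - L *: A = r%:M -> a != b ->
  (\rank (A - a%:M)%R < n)%N -> (\rank (A - b%:M)%R < n)%N ->
  (A - a%:M) *m (A - b%:M) = 0.
Proof.
move=> E ab ra rb; have Ea := root_of_eigenvalue E ra; have Eb := root_of_eigenvalue E rb.
have LE : L = a + b.
  have ab0 : a - b != 0 by rewrite subr_eq0.
  by apply: (mulIf ab0); move: Ea; rewrite -Eb => H; lra.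
have rE : r = - (a * b) by rewrite -Ea LE; ring.
move: E; rewrite LE rE => /eqP; rewrite subr_eq => /eqP E.
rewrite mulmxBl !mulmxBr E mul_scalar_mx mul_mx_scalar mul_scalar_mx.
by apply/matrixP => i j; rewrite !mxE; ring.
Qed.

Lemma quadratic_of_two_eigen A a b : (A - a%:M) *m (A - b%:M) = 0 ->
  A *m A - (a + b) *: A = (- (a * b))%:M.
Proof.
rewrite mulmxBl !mulmxBr mul_scalar_mx mul_mx_scalar mul_scalar_mx.
move: (A *m A) => AA /eqP; rewrite subr_eq0 subr_eq => /eqP ->.
by apply/matrixP => i j; rewrite !mxE; ring.
Qed.

Lemma symmetric_square A rho : (0 < n)%N -> A^T = A -> A *m A = rho%:M ->
  0 <= rho /\ (rho = 0 -> A = 0).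
Proof.
move=> n0 sA AA.
have As i : \sum_j A i j ^+ 2 = rho.
  have /matrixP/(_ i i) := AA; rewrite mxE [RHS]mxE eqxx mulr1n => <-.
  by apply: eq_bigr => j _; rewrite expr2 -{4}sA mxE.
split; first by rewrite -(As (Ordinal n0)); apply: sumr_ge0 => j _; exact: sqr_ge0.
move=> r0; apply/matrixP => i j; rewrite [RHS]mxE; have /eqP := As i.
rewrite r0 psumr_eq0 => [|k _]; last exact: sqr_ge0.
by move/allP/(_ j); rewrite mem_index_enum sqrf_eq0 => /(_ isT)/eqP ->.
Qed.

(** Completing the square gives (A - L / 2)^2 = rho, where rho >= 0 because the
   left-hand side is the square of a symmetric matrix. *)
Lemma symmetric_quadratic A L r : (0 < n)%N -> A^T = A ->
  A *m A - L *: A = r%:M ->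
  (exists s, A = s%:M) \/
  exists a b, a != b /\ (A - a%:M) *m (A - b%:M) = 0.
Proof.
move=> n0 sA E; pose C := A - (L / 2)%:M.
have CC : C *m C = (r + (L / 2) ^+ 2)%:M.
  move/eqP: E; rewrite subr_eq => /eqP E.
  rewrite /C mulmxBl !mulmxBr E mul_scalar_mx mul_mx_scalar mul_scalar_mx.
  by apply/matrixP => i j; rewrite !mxE; field.
have sC : C^T = C by rewrite /C linearB /= sA tr_scalar_mx.
set rho := r + _ in CC.
have [rho0 C0] := symmetric_square n0 sC CC.
case: (ltgtP 0 rho) rho0 => // [rp|r0] _; last first.
  by left; exists (L / 2); apply/eqP; rewrite -subr_eq0 -/C C0.
right; exists (L / 2 + Num.sqrt rho), (L / 2 - Num.sqrt rho).
have s0 : 0 < Num.sqrt rho by rewrite sqrtr_gt0.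
split; first by rewrite gt_eqF //; lra.
have -> : A - (L / 2 + Num.sqrt rho)%:M = C - (Num.sqrt rho)%:M.
  by rewrite /C raddfD /= opprD addrA.
have -> : A - (L / 2 - Num.sqrt rho)%:M = C + (Num.sqrt rho)%:M.
  by rewrite /C raddfB /= opprB addrA [_ + _ - (L / 2)%:M]addrAC.
move: CC; move: C {C0 sC} => C CC.
rewrite mulmxBl !mulmxDr CC !mul_scalar_mx mul_mx_scalar scale_scalar_mx.
by rewrite -expr2 sqr_sqrtr ?ltW // opprD addrA addrK subrr.
Qed.

Section Conjugation.
Variable J : 'M[R]_n.
Hypothesis uJ : J \in unitmx.
(** Changes of charts conjugate the Schouten operator by a Jacobian matrix. *)
Let conj A := J *m A *m invmx J.

Lemma conj_mul A B : conj A *m conj B = conj (A *m B).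
Proof. by rewrite /conj !mulmxA mulmxKV. Qed.

Lemma conj_scalar a : conj a%:M = a%:M.
Proof. by rewrite /conj mul_mx_scalar -scalemxAl mulmxV // scalemx1. Qed.

Lemma conjB A B : conj (A - B) = conj A - conj B.
Proof. by rewrite /conj mulmxBr mulmxBl. Qed.

Lemma conj_tr A : \tr (conj A) = \tr A.
Proof. by rewrite /conj mxtrace_mulC mulmxA mulVmx // mul1mx. Qed.

Lemma conj_rank A : \rank (conj A) = \rank A.
Proof.
rewrite /conj mxrankMfree ?row_free_unit ?unitmx_inv //.
by apply/eqmx_rank/andP; split; rewrite ?submxMl // -{1}[A](mulKmx uJ) submxMl.
Qed.

Lemma conj_centered A : centered (conj A) = conj (centered A).
Proof. by rewrite /centered /trace_mean conj_tr conjB conj_scalar. Qed.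

Lemma conj_eigen_gap q A : eigen_gap q (conj A) = eigen_gap q A.
Proof.
by rewrite /eigen_gap /moment2 /moment3 conj_centered !conj_mul !conj_tr.
Qed.

Lemma conj_eigen1 q A : eigen1 q (conj A) = eigen1 q A.
Proof. by rewrite /eigen1 conj_eigen_gap /trace_mean conj_tr. Qed.

Lemma conj_eigen2 q A : eigen2 q (conj A) = eigen2 q A.
Proof. by rewrite /eigen2 conj_eigen_gap /trace_mean conj_tr. Qed.

End Conjugation.

Section SmoothEigenvalues.
Variables (m : nat) (U : set 'rV[R]_m) (A : 'rV[R]_m -> 'M[R]_n).
Hypotheses (openU : open U) (sA : smx U A).
Hypothesis m2 : forall x, U x -> 0 < moment2 (A x).
Variable q : nat.
Hypotheses (q0 : (0 < q)%N) (qn : (q < n)%N).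
Notation Sm f := (smooth_on U (f : 'rV[R]_m -> R^o)).

Let sc : smx U (fun x => centered (A x)).
Proof.
have st := smxZ openU (smoothZ openU n%:R^-1 (smx_tr openU sA)) (smx_cst U (1%:M : 'M[R]_n)).
apply: (smx_ext openU _ (smxB openU sA st)) => x _.
by rewrite /centered /trace_mean /cst scalemx1.
Qed.

Let s2 : Sm (fun x => moment2 (A x)).
Proof. exact: (smx_tr openU (smx_mul openU sc sc)). Qed.

Let s3 : Sm (fun x => moment3 (A x)).
Proof. exact: (smx_tr openU (smx_mul openU (smx_mul openU sc sc) sc)). Qed.

Let n0 : (0 : R) < n%:R.
Proof. by rewrite ltr0n (leq_trans _ qn). Qed.

Lemma smooth_eigen_gap : Sm (fun x => eigen_gap q (A x)).
Proof.
rewrite /eigen_gap; case: eqP => [_|/eqP nq].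
  apply: (smooth_sqrt openU (smoothZ openU _ s2)) => x Ux.
  rewrite mulr_gt0 ?m2 // invr_gt0 mulr_gt0 ?ltr0n //.
  by rewrite subr_gt0 ltr_pdivrMr // mul1r ltr_nat.
apply: (smoothM openU s3); apply: (smoothV openU (smoothZ openU _ s2)) => x Ux.
apply: mulf_neq0; last by rewrite gt_eqF ?m2.
rewrite subr_eq0 mulrA -natrM eq_sym.
by rewrite -(inj_eq (mulIf (lt0r_neq0 n0))) mulfVK ?lt0r_neq0 // mul1r eqr_nat.
Qed.

Lemma smooth_eigen1 : Sm (fun x => eigen1 q (A x)).
Proof.
exact: (smoothD openU (smoothZ openU _ (smx_tr openU sA)) (smoothZ openU _ smooth_eigen_gap)).
Qed.

Lemma smooth_eigen2 : Sm (fun x => eigen2 q (A x)).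
Proof.
exact: (smoothB openU (smoothZ openU _ (smx_tr openU sA)) (smoothZ openU _ smooth_eigen_gap)).
Qed.

End SmoothEigenvalues.
End Quadratic.

(** * Subspaces, frames and unit vectors *)

Section RowSpan.
Variables (R : realType) (n : nat).
Implicit Types (v : 'rV[R]_n).

(** The rows of a matrix, as a frame in the form used for distributions. *)
Definition rowspan m (B : 'M[R]_(m, n)) : {vspace 'rV[R]_n} :=
  <<[seq row i B | i <- enum 'I_m]>>%VS.

Lemma mem_rowspan m (B : 'M[R]_(m, n)) v : (v \in rowspan B) = (v <= B)%MS.
Proof.
apply/idP/idP => [/coord_span ->|/submxP [w ->]].
  apply: summx_sub => i _; apply: scalemx_sub.
  have sz : (i < size [seq row k B | k <- enum 'I_m])%N by rewrite size_map -cardE.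
  by case/mapP: (mem_nth (0 : 'rV[R]_n) sz) => j _ ->; exact: row_sub.
rewrite mulmx_sum_row; apply: memv_suml => i _; apply: memvZ.
by apply: memv_span; apply: map_f; rewrite mem_enum.
Qed.

Lemma eq_rowspan m1 m2 (B : 'M[R]_(m1, n)) (C : 'M[R]_(m2, n)) :
  (B :=: C)%MS -> rowspan B = rowspan C.
Proof. by move=> BC; apply/vspaceP => v; rewrite !mem_rowspan BC. Qed.

Lemma dim_rowspan m (B : 'M[R]_(m, n)) : \dim (rowspan B) = \rank B.
Proof.
rewrite (eq_rowspan (eqmx_sym (eq_row_base B))).
set C := row_base B; have fC : row_free C := row_base_free B.
have sz : size [seq row i C | i <- enum 'I_(\rank B)] == \rank B.
  by rewrite size_map size_enum_ord.
have fr : free (Tuple sz).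
  apply/freeP => k E i; have : (\row_i k i) *m C = 0.
    rewrite mulmx_sum_row -[RHS]E; apply: eq_bigr => j _; rewrite mxE /=.
    by rewrite (nth_map j) ?size_enum_ord // nth_ord_enum.
  by rewrite -(mul0mx _ C) => /(row_free_inj fC) /rowP /(_ i); rewrite !mxE.
by have /eqP := fr; rewrite size_tuple.
Qed.

End RowSpan.

Section UnitVectors.
Variables (R : realType) (n : nat) (G : 'M[R]_n).
Hypothesis pG : posdef G.
Hypothesis sG : G^T = G.
Implicit Types (u v w : 'rV[R]_n) (W : {vspace 'rV[R]_n}).

Lemma normalize v : v != 0 -> exists2 c : R, 0 < c & inner G (c *: v) (c *: v) = 1.
Proof.
move=> v0; have gv := pG v0; exists (Num.sqrt (inner G v v))^-1.
  by rewrite invr_gt0 sqrtr_gt0.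
rewrite innerZl innerZr mulrA -invfM -expr2 sqr_sqrtr ?ltW // mulVf // gt_eqF //.
Qed.

(** Orthogonality to s imposes at most size s linear conditions on W. *)
Lemma unit_orthogonal W (s : seq 'rV[R]_n) : (size s < \dim W)%N ->
  exists w, [/\ w \in W, inner G w w = 1 & forall u, u \in s -> inner G u w = 0].
Proof.
move=> sW; pose B : 'M[R]_(\dim W, n) := \matrix_i (vbasis W)`_i.
pose S : 'M[R]_(size s, n) := \matrix_i s`_i.
have : kermx (B *m G *m S^T) != 0.
  rewrite kermx_eq0 /row_free; apply: contraTN sW => /eqP rE; rewrite -leqNgt -rE.
  exact: rank_leq_col.
case/rowV0Pn => z /sub_kermxP zB z0.
have wE : z *m B = \sum_i z 0 i *: (vbasis W)`_i.
  by rewrite mulmx_sum_row; apply: eq_bigr => i _; rewrite rowK.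
have w0 : z *m B != 0.
  apply: contra z0; rewrite wE => /eqP E; apply/eqP/rowP => i; rewrite mxE.
  have /freeP := basis_free (vbasisP W); apply; exact: E.
have wW : z *m B \in W.
  rewrite wE; apply: memv_suml => i _; apply: memvZ; apply: vbasis_mem.
  by rewrite mem_nth // size_tuple.
have [c c0 wc] := normalize w0; exists (c *: (z *m B)); split => //; first exact: memvZ.
move=> u /(nthP 0) [i isz <-]; rewrite innerZr (inner_sym _ _ sG).
suff -> : inner G (z *m B) s`_i = 0 by rewrite mulr0.
have /rowP /(_ (Ordinal isz)) := zB; rewrite [RHS]mxE => <-.
rewrite /inner !mulmxA mxE [RHS]mxE; apply: eq_bigr => k _.
by rewrite !mxE.
Qed.

(** By homogeneity the quadratic forms of P and a G agree on W, and by
   polarization the bilinear ones do. *)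
Lemma form_on_units W (P : 'M[R]_n) a : P^T = P ->
  (forall v, v \in W -> inner G v v = 1 -> inner P v v = a) ->
  forall v w, v \in W -> w \in W -> inner P v w = a * inner G v w.
Proof.
move=> sP H; have H1 v : v \in W -> inner P v v = a * inner G v v.
  move=> vW; have [->|v0] := eqVneq v 0; first by rewrite !inner0l mulr0.
  have [c c0 E] := normalize v0; have := H _ (memvZ c vW) E; move: E.
  rewrite !innerZl !innerZr => E.
  have c2 : c * c != 0 by rewrite mulf_neq0 // gt_eqF.
  move=> F; apply: (mulfI c2); rewrite -mulrA F mulrCA -mulrA [c * (c * _)]E.
  by rewrite mulr1.
move=> v w vW wW; have := H1 _ (memvD vW wW).
rewrite !innerE (H1 v) // (H1 w) // (inner_sym w v sP) (inner_sym w v sG).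
by move=> E; lra.
Qed.

End UnitVectors.

Section OrthonormalLists.
Variables (R : realType) (n : nat) (G : 'M[R]_n).
Hypothesis sG : G^T = G.

Lemma orthonormal_pairwise (s : seq 'rV[R]_n) :
  (forall i, (i < size s)%N -> inner G s`_i s`_i = 1) ->
  (forall i j, (i < j)%N -> (j < size s)%N -> inner G s`_i s`_j = 0) ->
  Defs.orthonormal G s.
Proof.
move=> s1 s0 i j il jl; case: (ltngtP i j) => [ij|ij|<-]; last by rewrite s1.
- by rewrite s0.
by rewrite (inner_sym _ _ sG) s0.
Qed.

End OrthonormalLists.

(** W forms q combinations of the rows that are independent at x0. They stay
   independent where the determinant f below does not vanish, and by constancy of
   the rank they then span the whole row space. *)
Lemma smooth_rowspan_frame (R : realType) (n m q : nat) (U : set 'rV[R]_n)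
    (B : 'rV[R]_n -> 'M[R]_m) x0 :
  open U -> smx U B -> (forall x, U x -> \rank (B x) = q) -> U x0 ->
  exists V : set 'rV[R]_n, exists W : 'M[R]_(q, m),
    [/\ open V, V x0, V `<=` U & forall x, V x -> rowspan (B x) = rowspan (W *m B x)].
Proof.
move=> oU sB rB Ux0.
have qm : (q <= m)%N by rewrite -(rB x0 Ux0) rank_leq_row.
pose W : 'M[R]_(q, m) := pid_mx q *m invmx (col_ebase (B x0)).
have WB : W *m B x0 = pid_mx q *m row_ebase (B x0).
  rewrite -[in LHS](mulmx_ebase (B x0)) /W rB // !mulmxA mulmxKV ?col_ebase_unit //.
  by rewrite pid_mx_id.
have /row_freeP [C WBC] : row_free (W *m B x0).
  by rewrite WB /row_free mxrankMfree ?row_free_unit ?row_ebase_unit // rank_pid_mx.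
pose f x : R := \det (W *m B x *m C).
have sf : smooth_on U (f : _ -> R^o).
  exact: (smx_det oU (smx_mul oU (smx_mul oU (smx_cst U W) sB) (smx_cst U C))).
exists [set x | U x /\ f x != 0], W; split.
- rewrite openE => x [Ux fx]; apply: filterI; first exact: near_open.
  have cf := smooth_continuous sf Ux.
  have := @cvgr_neq0 _ _ _ (nbhs x) _ f (f x) cf fx.
  by apply.
- by split => //; rewrite /f WBC det1 oner_neq0.
- by move=> x [].
move=> x [Ux fx]; apply: eq_rowspan; apply: eqmx_sym; apply/eqmxP.
have rW : \rank (W *m B x) = q.
  apply/eqP; rewrite eqn_leq rank_leq_row /=.
  have rC : \rank (W *m B x *m C) = q by rewrite mxrank_unit // unitmxE unitfE.
  by rewrite (leq_trans _ (mxrankM_maxl _ C)) // rC.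
by have [_ <-] := mxrank_leqif_eq (submxMl W (B x)); rewrite rW rB.
Qed.

Lemma locally_constant_connected (T : topologicalType) (Y : Type) (f : T -> Y) :
  connected [set: T] -> (forall p, \forall q \near p, f q = f p) ->
  forall p q, f p = f q.
Proof.
move=> cT lf p q; pose B := [set r | f r = f p].
have oB (b : Prop -> Prop) : b = id \/ b = not -> open [set r | b (f r = f p)].
  by move=> hb; rewrite openE => r /= br; apply: filterS (lf r) => s /= ->.
have : B = [set: T].
  apply: cT; first by exists p.
  - by exists B; [exact: (oB id (or_introl erefl))|rewrite setTI].
  exists B; last by rewrite setTI.
  have -> : B = ~` [set r | ~ (f r = f p)].
    by rewrite eqEsubset; split => r /=; [move=> ? ?|exact: contrapT].
  by apply: open_closedC; exact: (oB not (or_intror erefl)).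
by move=> E; have : B q by rewrite E.
Qed.

Lemma smooth_on_sub (R : realType) (n : nat) (W : normedModType R)
    (U V : set 'rV[R]_n) (f : 'rV[R]_n -> W) :
  V `<=` U -> smooth_on U f -> smooth_on V f.
Proof.
move=> VU sf k; elim: k f {sf}(sf k) => [|k IH] f /=.
  by move=> cf x /VU; exact: cf.
by move=> [df kf]; split=> [x v /VU|v]; [exact: df|apply: IH; exact: kf].
Qed.

(** * The Schouten operator of a conformally Euclidean manifold *)

Section Tensors.
Variables (R : realType) (n : nat) (M : smoothManifold R n) (g : riemannianMetric M).
Implicit Types c d : chart R n M.
Implicit Types x u v w : 'rV[R]_n.

Lemma metric_smx c : atlas c -> smx (cimg c) (g c).
Proof. by move=> ac; apply: smooth_on_smx; [exact: cimg_open|exact: metric_smooth]. Qed.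

Lemma metric_posdef c x : atlas c -> cimg c x -> posdef (g c x).
Proof. by move=> ac cx v; exact: metric_pos. Qed.

Lemma metric_unit c x : atlas c -> cimg c x -> g c x \in unitmx.
Proof. by move=> ac cx; apply/posdef_unit/metric_posdef. Qed.

Lemma overlap_open c d : open (overlap c d).
Proof.
rewrite openE => x [cx dx].
have h1 : nbhs x (cimg c) by apply: open_nbhs_nbhs; split; [exact: cimg_open|].
have h2 : nbhs (cinv c x) (cdom d) by apply: open_nbhs_nbhs; split; [exact: cdom_open|].
exact: (filterI h1 (cinv_continuous cx h2)).
Qed.

Lemma transition_cimg c d x : overlap c d x -> cimg d (transition c d x).
Proof. by move=> [cx dx]; exact: cmap_cimg. Qed.

Lemma transition_smx c d : atlas c -> atlas d -> smx (overlap c d) (transition c d).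
Proof.
move=> ac ad; apply: smooth_on_smx; first exact: overlap_open.
by have [] := atlas_compatible ac ad.
Qed.

Definition jac c d x : 'M[R]_n := jacobian_mx (transition c d) x.

Section Overlap.
Variables c d : chart R n M.
Hypotheses (ac : atlas c) (ad : atlas d).

Let GH x u v : overlap c d x -> inner (g c x) u v =
  inner (g d (transition c d x)) (dmx u (transition c d) x) (dmx v (transition c d) x).
Proof. by move=> o; rewrite !dmxE; exact: metric_change. Qed.

Let smG : smx (overlap c d) (g c).
Proof.
move=> i j; apply: smooth_on_sub (metric_smx ac i j).
by move=> x [].
Qed.

Let symG x : overlap c d x -> (g c x)^T = g c x.
Proof. by move=> [cx _]; exact: Defs.metric_sym. Qed.

Let unitG x : overlap c d x -> g c x \in unitmx.
Proof. by move=> [cx _]; exact: metric_unit. Qed.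

Lemma jacE x v : overlap c d x -> 'D_v (transition c d) x = v *m jac c d x.
Proof.
move=> o; rewrite -dmxE.
exact: (jacobian_mxE (@overlap_open c d) (transition_smx ac ad) v o).
Qed.

Lemma metric_jac x : overlap c d x ->
  g c x = jac c d x *m g d (transition c d x) *m (jac c d x)^T.
Proof.
move=> o; exact: (metric_mx_change (@overlap_open c d) (transition_smx ac ad) GH o).
Qed.

Lemma jac_unit x : overlap c d x -> jac c d x \in unitmx.
Proof.
move=> o; exact: (jacobian_mx_unit (@overlap_open c d) (transition_smx ac ad) unitG GH o).
Qed.

Lemma curvature_op_jac x u v w : overlap c d x ->
  curvature_op (g c) x u v w *m jac c d x =
  curvature_op (g d) (transition c d x) (u *m jac c d x) (v *m jac c d x) (w *m jac c d x).
Proof.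
move=> o; exact: (curvature_op_change (@overlap_open c d) (@cimg_open _ _ _ d) smG
  (metric_smx ad) (transition_smx ac ad) (@transition_cimg c d) symG
  (fun y dy => Defs.metric_sym g ad dy) unitG (fun y dy => metric_unit ad dy) GH u v w o).
Qed.

End Overlap.

(** The Schouten operator, defined in every chart from the Ricci trace rather
   than from a conformal factor, so that it is smooth and free of choices. *)
Definition schouten c x : 'M[R]_n :=
  schouten_of (ricci_trace (curvature_op (g c) x)) (g c x).

(** The form (u, v) |-> g(uA, v) has matrix A *m g c x, whose symmetry says that A
   is self-adjoint. *)
Definition kn_at c x (A : 'M[R]_n) : Prop :=
  (A *m g c x)^T = A *m g c x /\
  forall u v w, curvature_op (g c) x u v w = kn_op (g c x) A u v w.

Hypothesis n2 : (2 < n)%N.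

Lemma kn_at_schouten c x A : atlas c -> cimg c x -> kn_at c x A -> A = schouten c x.
Proof.
move=> ac cx [_ E]; rewrite /schouten.
have -> : curvature_op (g c) x = kn_op (g c x) A.
  by apply/funext => u; apply/funext => v; apply/funext => w; rewrite E.
by rewrite schouten_of_kn //; exact: metric_unit.
Qed.

Lemma kn_at_change c d x A : atlas c -> atlas d -> overlap c d x ->
  kn_at d (transition c d x) A ->
  kn_at c x (jac c d x *m A *m invmx (jac c d x)).
Proof.
move=> ac ad o [sA E]; have uJ := jac_unit ac ad o; have GE := metric_jac ac ad o.
split.
  rewrite {1 2}GE !mulmxA mulmxKV // -[_ *m A *m _]mulmxA.
  by rewrite !trmx_mul trmxK -trmx_mul sA !mulmxA.
move=> u v w; apply: (can_inj (mulmxK uJ)).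
by rewrite (curvature_op_jac ac ad) // E (kn_op_change _ _ _ _ uJ GE).
Qed.

(** The conformal factor is written phi^-2, for which the Schouten operator is
   polynomial in phi and its derivatives. *)
Definition conformal_chart d (phi : 'rV[R]_n -> R) : Prop :=
  [/\ atlas d, smooth_on (cimg d) (phi : _ -> R^o), forall x, cimg d x -> 0 < phi x &
      forall x, cimg d x -> g d x = (phi x ^- 2)%:M].

Hypothesis conf : conformally_euclidean g.

Lemma exists_conformal_chart p : exists d phi, conformal_chart d phi /\ cdom d p.
Proof.
have [d [ad dp [lam [sl l0 lE]]]] := conf p.
exists d, (fun x => (Num.sqrt (lam x))^-1); split => //; split => //.
- apply: smoothV; first exact: cimg_open.
    by apply: smooth_sqrt => //; exact: cimg_open.
  by move=> x dx; rewrite gt_eqF // sqrtr_gt0 l0.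
- by move=> x dx; rewrite invr_gt0 sqrtr_gt0 l0.
move=> x dx; rewrite lE //; congr (_%:M).
by rewrite exprVn invrK sqr_sqrtr // ltW // l0.
Qed.

Section Conformal.
Variables (d : chart R n M) (phi : 'rV[R]_n -> R).
Hypothesis cd : conformal_chart d phi.

Let ad : atlas d. Proof. by case: cd. Qed.
Let phi0 x : cimg d x -> phi x != 0.
Proof. by case: cd => _ _ p _ dx; rewrite gt_eqF ?p. Qed.
Let sphi : smooth_on (cimg d) (phi : _ -> R^o). Proof. by case: cd. Qed.
Let GE x : cimg d x -> g d x = (phi x ^- 2)%:M. Proof. by case: cd => _ _ _; apply. Qed.
Let od : open (cimg d) := @cimg_open _ _ _ d.

Lemma conformal_kn_at x : cimg d x -> kn_at d x (conformal_schouten phi x).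
Proof.
move=> dx; split.
  rewrite GE // mul_mx_scalar linearZ /=.
  by rewrite (conformal_schouten_sym od sphi).
by move=> u v w; exact: (conformal_curvature od sphi phi0 GE).
Qed.

Lemma schouten_conformal x : cimg d x -> schouten d x = conformal_schouten phi x.
Proof. by move=> dx; rewrite -(kn_at_schouten ad dx (conformal_kn_at dx)). Qed.

Lemma schouten_conformal_sym x : cimg d x -> (schouten d x)^T = schouten d x.
Proof. by move=> dx; rewrite schouten_conformal // (conformal_schouten_sym od sphi). Qed.

Lemma schouten_conformal_schur (s : 'rV[R]_n -> R) x :
  (forall y, cimg d y -> schouten d y = (s y)%:M) -> cimg d x ->
  \forall y \near x, s y = s x.
Proof.
move=> E dx; apply: (conformal_schur od sphi phi0 (ltnW n2) _ dx) => y dy.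
by rewrite -schouten_conformal // E.
Qed.

Lemma conformal_frame x : cimg d x ->
  exists E : n.-tuple 'rV[R]_n, Defs.orthonormal (g d x) E.
Proof.
move=> dx; exists [tuple phi x *: delta_mx 0 i | i < n] => i j il jl.
rewrite size_tuple in il jl.
have E k (kl : (k < n)%N) : [tuple phi x *: (delta_mx 0 i : 'rV[R]_n) | i < n]`_k =
    phi x *: delta_mx 0 (Ordinal kl).
  by rewrite -[k]/(nat_of_ord (Ordinal kl)) -tnth_nth tnth_mktuple.
rewrite !E innerZl innerZr inner_delta GE // mxE -val_eqE /=.
case: (i == j); last by rewrite !mulr0.
by rewrite mulr1n mulrA -expr2 mulfV // expf_neq0 // phi0.
Qed.

End Conformal.

(** The computation in a conformal chart around the point, carried over to the
   chart c by tensoriality. *)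
Lemma schouten_kn_at c x : atlas c -> cimg c x -> kn_at c x (schouten c x).
Proof.
move=> ac cx; have [d [phi [cd dp]]] := exists_conformal_chart (cinv c x).
have ad : atlas d by case: cd.
have o : overlap c d x by [].
have k := kn_at_change ac ad o (conformal_kn_at cd (transition_cimg o)).
by rewrite -(kn_at_schouten ac cx k).
Qed.

Lemma schouten_change c d x : atlas c -> atlas d -> overlap c d x ->
  schouten c x = jac c d x *m schouten d (transition c d x) *m invmx (jac c d x).
Proof.
move=> ac ad o; have cx : cimg c x by case: o.
by rewrite (kn_at_schouten ac cx (kn_at_change ac ad o (schouten_kn_at ad (transition_cimg o)))).
Qed.

Lemma smx_schouten c : atlas c -> smx (cimg c) (schouten c).
Proof.
move=> ac; have oc : open (cimg c) := @cimg_open _ _ _ c.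
have sG := metric_smx ac.
have uG x (cx : cimg c x) := metric_unit ac cx.
have sr : smx (cimg c) (fun x => ricci_trace (curvature_op (g c) x)).
  move=> i j.
  have := smooth_sum oc (index_enum 'I_n) xpredT
   (fun k => smx_curvature_op oc sG (fun x cx => Defs.metric_sym g ac cx) uG
     (delta_mx 0 k) (delta_mx 0 i) (delta_mx 0 j) 0 k).
  by apply: smooth_ext => // x _; rewrite mxE.
have sB := smx_mul oc sr (smx_invmx oc sG uG).
have st := smxZ oc (smoothZ oc (2 * (n%:R - 1))^-1 (smx_tr oc sB))
  (smx_cst (cimg c) (1%:M : 'M[R]_n)).
have sc := smooth_cst (cimg c) ((n%:R - 2)^-1 : R^o).
apply: (smx_ext oc _ (smxZ oc sc (smxB oc sB st))) => x _.
by rewrite /schouten /schouten_of /cst scalemx1.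
Qed.

(** In conformal charts, where g is a multiple of the identity, the matrix of the
   Schouten operator is symmetric. Consequences of this that are invariant under
   conjugation are proved there and carried over to the other charts. *)
Lemma descend_conformal (P : 'M[R]_n -> Prop) :
  (forall J A, J \in unitmx -> P A -> P (J *m A *m invmx J)) ->
  (forall d phi y, conformal_chart d phi -> cimg d y -> P (schouten d y)) ->
  forall c x, atlas c -> cimg c x -> P (schouten c x).
Proof.
move=> Pconj Pconf c x ac cx; have [d [phi [cd dp]]] := exists_conformal_chart (cinv c x).
have ad : atlas d by case: cd.
have o : overlap c d x by [].
rewrite (schouten_change ac ad o); apply: Pconj; first exact: jac_unit.
exact: Pconf cd (transition_cimg o).
Qed.

(** The value at a point may be computed in any chart around it, since a change
   of charts only conjugates the Schouten operator. *)
Lemma descend_function (f : 'M[R]_n -> R) :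
  (forall J A, J \in unitmx -> f (J *m A *m invmx J) = f A) ->
  exists F : M -> R, forall c x, atlas c -> cimg c x -> f (schouten c x) = F (cinv c x).
Proof.
move=> fconj; pose C (p : M) := cid2 (atlas_cover p).
exists (fun p => f (schouten (sval (C p)) (cmap (sval (C p)) p))) => c x ac cx.
case: (C (cinv c x)) => d ad dp /=.
have o : overlap c d x by [].
by rewrite (schouten_change ac ad o) fconj //; exact: jac_unit.
Qed.

End Tensors.

(** * Sectional curvature *)

Section SectionalAlgebra.
Variables (R : realType) (n : nat) (G A : 'M[R]_n).
Hypothesis pG : posdef G.
Hypothesis sG : G^T = G.
Hypothesis sAG : (A *m G)^T = A *m G.
Implicit Types (u v w X Y : 'rV[R]_n).

(** The sectional curvature of the plane of orthonormal v and w, when the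
   curvature tensor is g /\ A. *)
Definition kn_sectional v w : R :=
  inner G w w * inner G (v *m A) v + inner G (w *m A) w * inner G v v
  - 2 * inner G v w * inner G (v *m A) w.

Let P := A *m G.
Let PE u v : inner G (u *m A) v = inner P u v.
Proof. by rewrite inner_mulmxl. Qed.
Let gC u v : inner G u v = inner G v u.
Proof. exact: inner_sym. Qed.
Let PC u v : inner P u v = inner P v u.
Proof. exact: inner_sym. Qed.

(** For orthonormal v, w, z and P(u, u) = G(uA, u), the sums P(v, v) + P(w, w),
   P(v, v) + P(z, z) and P(w, w) + P(z, z) are all a, whence P(v, v) = a / 2. *)
Lemma scalar_of_constant_sectional a : (2 < n)%N ->
  (forall v w, Defs.orthonormal G [:: v; w] -> kn_sectional v w = a) ->
  A = (a / 2)%:M.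
Proof.
move=> n2 H; have dimf : \dim (fullv : {vspace 'rV[R]_n}) = n by rewrite dimvf /dim /= mul1n.
have H2 v w : inner G v v = 1 -> inner G w w = 1 -> inner G v w = 0 ->
    inner P v v + inner P w w = a.
  move=> v1 w1 vw; rewrite -(H v w).
    by rewrite /kn_sectional !PE v1 w1 vw; ring.
  by apply: orthonormal_pairwise => // [[|[|i]]|[|[|i]] [|[|j]]].
have Pv v : v \in fullv -> inner G v v = 1 -> inner P v v = a / 2.
  move=> _ v1.
  have [|w [_ w1 vw]] := @unit_orthogonal _ _ G pG sG fullv [:: v].
    by rewrite dimf; exact: ltnW.
  have [|z [_ z1 vz]] := @unit_orthogonal _ _ G pG sG fullv [:: v; w].
    by rewrite dimf.
  have := H2 v w v1 w1 (vw v (mem_head _ _)).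
  have := H2 v z v1 z1 (vz v (mem_head _ _)).
  have := H2 w z w1 z1 (vz w ltac:(by rewrite !inE eqxx orbT)).
  by move=> *; lra.
have uG := posdef_unit pG.
apply: (can_inj (mulmxK uG)); rewrite mul_scalar_mx; apply: inner_ext => u v.
by rewrite innerZm (form_on_units pG sG sAG Pv) // memvf.
Qed.

Section TwoDistributions.
Variables (D D' : {vspace 'rV[R]_n}).
Hypothesis orthD : forall u v, u \in D -> v \in D' -> inner G u v = 0.

(** For unit vectors and (c, s), (c', s') on the unit circle, this is the formula
   of a quasi space form, with K = 2 a, K' = 2 b and Kbar = a + b. Leaving the
   lengths arbitrary allows Y = 0 when D is a line. *)
Lemma kn_sectional_two a b X Y X' Y' (c s c' s' : R) :
  (forall v, v \in D -> v *m A = a *: v) -> (forall v, v \in D' -> v *m A = b *: v) ->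
  X \in D -> Y \in D -> X' \in D' -> Y' \in D' ->
  inner G X Y = 0 -> inner G X' Y' = 0 ->
  kn_sectional (c *: X + s *: X') (c' *: Y + s' *: Y') =
  (c' ^+ 2 * inner G Y Y + s' ^+ 2 * inner G Y' Y')
    * (a * c ^+ 2 * inner G X X + b * s ^+ 2 * inner G X' X')
  + (a * c' ^+ 2 * inner G Y Y + b * s' ^+ 2 * inner G Y' Y')
    * (c ^+ 2 * inner G X X + s ^+ 2 * inner G X' X').
Proof.
move=> aD bD' XD YD X'D Y'D XY X'Y'; rewrite /kn_sectional.
rewrite !mulmxDl -!scalemxAl !(aD X XD, aD Y YD, bD' X' X'D, bD' Y' Y'D) !innerE.
rewrite ?(gC X' X) ?(gC X' Y) ?(gC Y' Y) ?(gC Y' X).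
rewrite !(orthD XD X'D, orthD XD Y'D, orthD YD X'D, orthD YD Y'D) XY X'Y'; ring.
Qed.

Hypothesis fullD : (D + D')%VS = fullv.
Hypothesis dD : (0 < \dim D)%N.
Hypothesis dD' : (1 < \dim D')%N.

(** With P(u, v) = G(uA, v), the angles 0, pi / 2 and pi / 4 give in turn
   P(X, X) + P(Y', Y') = Kb, P(X', X') + P(Y', Y') = K' and P(X, X') = 0. By the
   last one D and D' are orthogonal for P too, and by the first one P is constant
   on the unit vectors of D and of D', hence a multiple of G there. *)
Lemma two_eigen_of_quasi Kb K' :
  (forall X X' Y' (theta : R), X \in D -> X' \in D' -> Y' \in D' ->
    Defs.orthonormal G [:: X; X'; Y'] -> 0 <= theta <= pi / 2 ->
    kn_sectional (cos theta *: X + sin theta *: X') Y' =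
    Kb * cos theta ^+ 2 + K' * sin theta ^+ 2) ->
  exists a b, a + b = Kb /\ (A - a%:M) *m (A - b%:M) = 0.
Proof.
move=> H.
have H1 X X' Y' (theta : R) : X \in D -> X' \in D' -> Y' \in D' -> inner G X X = 1 ->
   inner G X' X' = 1 -> inner G Y' Y' = 1 -> inner G X' Y' = 0 -> 0 <= theta <= pi / 2 ->
   cos theta ^+ 2 * inner P X X + sin theta ^+ 2 * inner P X' X'
   + 2 * (cos theta * sin theta) * inner P X X' + inner P Y' Y' =
   Kb * cos theta ^+ 2 + K' * sin theta ^+ 2.
  move=> XD X'D Y'D X1 X'1 Y'1 X'Y' th; rewrite -(H X X' Y' theta) //; last first.
    apply: orthonormal_pairwise => // [[|[|[|i]]]|[|[|[|i]]] [|[|[|j]]]] //= _ _; exact: orthD.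
  have cs := cos2Dsin2 theta.
  rewrite /kn_sectional !mulmxDl -!scalemxAl !innerE !PE ?(gC X' X) ?(PC X' X).
  rewrite X1 X'1 Y'1 (orthD XD X'D) (orthD XD Y'D) X'Y'.
  have -> : cos theta * (cos theta * 1 + sin theta * 0) + sin theta * (cos theta * 0 + sin theta * 1) = 1 :> R.
    by rewrite -[RHS]cs; ring.
  ring.
have pi2 : 0 < pi / 2 :> R by rewrite divr_gt0 // pi_gt0.
have P1 X X' Y' : X \in D -> X' \in D' -> Y' \in D' -> inner G X X = 1 ->
   inner G X' X' = 1 -> inner G Y' Y' = 1 -> inner G X' Y' = 0 ->
   inner P X X + inner P Y' Y' = Kb.
  move=> XD X'D Y'D X1 X'1 Y'1 X'Y'; have := H1 X X' Y' 0 XD X'D Y'D X1 X'1 Y'1 X'Y'.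
  by rewrite lexx ltW // cos0 sin0 => /(_ isT) E; move: E => /=; lra.
have P2 X X' Y' : X \in D -> X' \in D' -> Y' \in D' -> inner G X X = 1 ->
   inner G X' X' = 1 -> inner G Y' Y' = 1 -> inner G X' Y' = 0 ->
   inner P X' X' + inner P Y' Y' = K'.
  move=> XD X'D Y'D X1 X'1 Y'1 X'Y'; have := H1 X X' Y' (pi / 2) XD X'D Y'D X1 X'1 Y'1 X'Y'.
  by rewrite lexx ltW // cos_pihalf sin_pihalf => /(_ isT) E; move: E => /=; lra.
have P3 X X' Y' : X \in D -> X' \in D' -> Y' \in D' -> inner G X X = 1 ->
   inner G X' X' = 1 -> inner G Y' Y' = 1 -> inner G X' Y' = 0 -> inner P X X' = 0.
  move=> XD X'D Y'D X1 X'1 Y'1 X'Y'.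
  have := H1 X X' Y' (pi / 4) XD X'D Y'D X1 X'1 Y'1 X'Y'.
  rewrite -(P1 X X' Y') // -(P2 X X' Y') //.
  have th0 : (0 : R) < pi / 4 by have := pi_gt0 R; lra.
  have th1 : (pi / 4 : R) < pi / 2 by have := pi_gt0 R; lra.
  have c0 : 0 < cos (pi / 4) :> R by apply: cos_gt0_pihalf; rewrite th1 andbT (lt_trans _ th0) // oppr_lt0.
  have s0 : 0 < sin (pi / 4) :> R by apply: sin_gt0_pi; have := pi_gt0 R; rewrite th0 /= => ?; lra.
  rewrite !ltW // => /(_ isT).
  have cs := cos2Dsin2 (pi / 4 : R); move: cs c0 s0; move: (cos _) (sin _) => c s cs c0 s0 E.
  have {}E : 2 * (c * s) * inner P X X' = (c ^+ 2 + s ^+ 2 - 1) * inner P Y' Y'.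
    by move: E; lra.
  move: E; rewrite cs subrr mul0r.
  by move/eqP; rewrite !mulf_eq0 pnatr_eq0 (gt_eqF c0) (gt_eqF s0) => /eqP.
have PX u v : u \in D -> v \in D' -> inner P u v = 0.
  move=> uD vD'; have [->|u0] := eqVneq u 0; first by rewrite inner0l.
  have [->|v0] := eqVneq v 0; first by rewrite inner0r.
  have [c c0 cu] := normalize pG u0; have [s s0 sv] := normalize pG v0.
  have [|w [wD' w1 vw]] := @unit_orthogonal _ _ G pG sG D' [:: s *: v]; first exact: dD'.
  have := P3 _ _ _ (memvZ c uD) (memvZ s vD') wD' cu sv w1 (vw _ (mem_head _ _)).
  by rewrite innerZl innerZr => /eqP; rewrite !mulf_eq0 (gt_eqF c0) (gt_eqF s0) => /eqP.
have [|X0 [X0D X01 _]] := @unit_orthogonal _ _ G pG sG D [::]; first exact: dD.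
pose a := inner P X0 X0; pose b := Kb - a.
have bD' v : v \in D' -> inner G v v = 1 -> inner P v v = b.
  move=> vD' v1.
  have [|w [wD' w1 vw]] := @unit_orthogonal _ _ G pG sG D' [:: v]; first exact: dD'.
  have := P1 X0 w v X0D wD' vD' X01 w1 v1; rewrite gC vw ?mem_head // => /(_ erefl).
  by rewrite /b /a; lra.
have aD v : v \in D -> inner G v v = 1 -> inner P v v = a.
  move=> vD v1.
  have [|w [wD' w1 _]] := @unit_orthogonal _ _ G pG sG D' [::]; first exact: ltnW.
  have [|z [zD' z1 wz]] := @unit_orthogonal _ _ G pG sG D' [:: w]; first exact: dD'.
  have := P1 v z w vD zD' wD' v1 z1 w1; rewrite gC wz ?mem_head // => /(_ erefl).
  by rewrite (bD' w) // /b; lra.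
have uG := posdef_unit pG.
have split v : exists v1 v2, [/\ v1 \in D, v2 \in D' & v = v1 + v2].
  have : v \in (D + D')%VS by rewrite fullD memvf.
  by case/memv_addP => v1 v1D [v2 v2D ->]; exists v1, v2.
have AD v : v \in D -> v *m A = a *: v.
  move=> vD; apply: (inner_nondegl uG) => w; have [w1 [w2 [w1D w2D' ->]]] := split w.
  rewrite innerZl PE !innerDr (PX v w2 vD w2D') (orthD vD w2D') !addr0.
  exact: (form_on_units pG sG sAG aD).
have AD' v : v \in D' -> v *m A = b *: v.
  move=> vD'; apply: (inner_nondegl uG) => w; have [w1 [w2 [w1D w2D' ->]]] := split w.
  rewrite innerZl PE !innerDr (PC v w1) (PX w1 v w1D vD') (gC v w1) (orthD w1D vD') !add0r.
  exact: (form_on_units pG sG sAG bD').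
exists a, b; split; first by rewrite /b addrC subrK.
apply/row_matrixP => i; rewrite row0 rowE; have [v1 [v2 [v1D v2D' ->]]] := split (delta_mx 0 i).
have E1 : v1 *m (A - a%:M) = 0 by rewrite mulmxBr AD // mul_mx_scalar subrr.
have E2 : v2 *m (A - a%:M) = (b - a) *: v2.
  by rewrite mulmxBr AD' // mul_mx_scalar -scalerBl.
rewrite mulmxA mulmxDl E1 E2 add0r -scalemxAl mulmxBr AD' // mul_mx_scalar subrr.
by rewrite scaler0.
Qed.

End TwoDistributions.
End SectionalAlgebra.

(** * Deszcz symmetry *)

Section Classification.
Variables (R : realType) (n : nat) (M : smoothManifold R n) (g : riemannianMetric M).
Hypothesis n4 : (4 <= n)%N.
Hypothesis conf : conformally_euclidean g.
Implicit Types c d : chart R n M.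
Implicit Types x u v w : 'rV[R]_n.

Let n2 : (2 < n)%N. Proof. exact: ltn_trans n4. Qed.
Let n0 : (0 < n)%N. Proof. exact: ltn_trans n2. Qed.
Notation S c x := (schouten g c x).

Let symG c x : atlas c -> cimg c x -> (g c x)^T = g c x.
Proof. by move=> ac cx; exact: Defs.metric_sym. Qed.

Lemma sectional_schouten c x v w : atlas c -> cimg c x ->
  sectional (g c) x v w = kn_sectional (g c x) (S c x) v w.
Proof.
move=> ac cx; have [sAG E] := schouten_kn_at n2 conf ac cx.
by rewrite (sectional_kn (symG ac cx) sAG E).
Qed.

Lemma deszcz_symmetric_of_quadratic (L : M -> R) :
  (forall c x, atlas c -> cimg c x ->
    exists r, S c x *m S c x - L (cinv c x) *: S c x = r%:M) ->
  deszcz_symmetric g.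
Proof.
move=> H; exists L => c x ac cx v1 v2 v3 v4 u v.
have [sAG E] := schouten_kn_at n2 conf ac cx; have [r Er] := H c x ac cx.
exact: (deszcz_of_quadratic (symG ac cx) sAG E Er).
Qed.

Lemma quadratic_of_deszcz_symmetric : deszcz_symmetric g ->
  forall d phi y, conformal_chart g d phi -> cimg d y ->
  exists L r, S d y *m S d y - L *: S d y = r%:M.
Proof.
move=> [L H] d phi y cd dy; have [ad _ p0 GE] := cd.
have [_ E] := schouten_kn_at n2 conf ad dy; exists (L (cinv d y)).
apply: (quadratic_of_deszcz n2 (GE y dy) _ (schouten_conformal_sym n2 cd dy) E (H d y ad dy)).
by rewrite invr_eq0 expf_neq0 // gt_eqF // p0.
Qed.

(** ** Space forms and quasi space forms are Deszcz symmetric *)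

Lemma deszcz_of_real_space_form : real_space_form g -> deszcz_symmetric g.
Proof.
move=> [a H]; apply: (@deszcz_symmetric_of_quadratic (fun=> 0)) => c x ac cx.
have [sAG _] := schouten_kn_at n2 conf ac cx.
have -> : S c x = (a / 2)%:M.
  apply: (scalar_of_constant_sectional (metric_posdef g ac cx) (symG ac cx) sAG n2) => v w vw.
  by rewrite -sectional_schouten //; exact: H.
by exists (a / 2 * (a / 2)); rewrite scale0r subr0 mul_scalar_mx scale_scalar_mx.
Qed.

Lemma deszcz_of_quasi_space_form : quasi_space_form g -> deszcz_symmetric g.
Proof.
move=> [q [q0 [qn [D [D' [[dimD _ _] [dimD' _ _] orth qsf]]]]]].
suff [L HL] : exists L : M -> R, forall c x, atlas c -> cimg c x ->
    exists a b, a + b = L (cinv c x) /\ (S c x - a%:M) *m (S c x - b%:M) = 0.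
  apply: (@deszcz_symmetric_of_quadratic L) => c x ac cx.
  have [a [b [<- ab]]] := HL c x ac cx; exists (- (a * b)).
  exact: quadratic_of_two_eigen.
have dD c x : atlas c -> cimg c x -> (0 < \dim (D c x))%N by move=> ac cx; rewrite dimD.
have dD' c x : atlas c -> cimg c x -> (1 < \dim (D' c x))%N.
  by move=> ac cx; rewrite dimD' //; lia.
case: ifP qsf => [_|/negbT q1] [K [K' [_ H]]].
  exists K => c x ac cx; have [oD fD] := orth c x ac cx.
  have [sAG _] := schouten_kn_at n2 conf ac cx.
  apply: (two_eigen_of_quasi (metric_posdef g ac cx) (symG ac cx) sAG oD fD
    (dD c x ac cx) (dD' c x ac cx) (K' := K' (cinv c x))) => X X' Y' th XD X'D Y'D o t.
  by rewrite -sectional_schouten //; exact: H.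
exists (fun p => (K p + K' p) / 2) => c x ac cx; have [oD fD] := orth c x ac cx.
have [sAG _] := schouten_kn_at n2 conf ac cx.
apply: (two_eigen_of_quasi (metric_posdef g ac cx) (symG ac cx) sAG oD fD
    (dD c x ac cx) (dD' c x ac cx) (K' := K' (cinv c x))) => X X' Y' th XD X'D Y'D o t.
(* The angle pi / 2 in the second factor reduces the condition for q > 1 to the
   one for q = 1, once a unit vector Y of D orthogonal to X is supplied. *)
have [|Y [YD Y1 XY]] := @unit_orthogonal _ _ _ (metric_posdef g ac cx) (symG ac cx) (D c x) [:: X].
  by rewrite dimD //= ltn_neqAle eq_sym q1.
have {}XY := XY X (mem_head _ _).
have pi2 : (0 : R) <= (pi / 2 : R) <= (pi / 2 : R).
  by rewrite lexx andbT divr_ge0 ?pi_ge0.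
have := H c x X Y X' Y' th (pi / 2) ac cx XD YD X'D Y'D _ t pi2.
rewrite cos_pihalf sin_pihalf scale0r add0r scale1r sectional_schouten // => ->.
  by field.
have X1 : inner (g c x) X X = 1 := o 0%N 0%N isT isT.
have X'1 : inner (g c x) X' X' = 1 := o 1%N 1%N isT isT.
have Y'1 : inner (g c x) Y' Y' = 1 := o 2%N 2%N isT isT.
have X'Y' : inner (g c x) X' Y' = 0 := o 1%N 2%N isT isT.
by apply: (orthonormal_pairwise (symG ac cx)) => [[|[|[|[|i]]]]|[|[|[|[|i]]]] [|[|[|[|j]]]]] //= _ _;
  exact: oD.
Qed.

(** ** Deszcz symmetric manifolds with constant Ricci multiplicities *)

(** The rank of A - b is the multiplicity of a. When both multiplicities are
   equal, the order of the eigenvalues makes a and b functions of A. *)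
Definition has_two_eigen (q : nat) (A : 'M[R]_n) : Prop :=
  exists a b, [/\ a != b, (A - a%:M) *m (A - b%:M) = 0, \rank (A - b%:M) = q &
    ((2 * q)%N = n -> b < a)].

Lemma has_two_eigen_conj q J A : J \in unitmx ->
  has_two_eigen q A -> has_two_eigen q (J *m A *m invmx J).
Proof.
move=> uJ [a [b [ab E rq hb]]]; exists a, b; split=> //.
  by rewrite -[a%:M](conj_scalar uJ) -[b%:M](conj_scalar uJ) -!conjB (conj_mul uJ) E
    mulmx0 mul0mx.
by rewrite -[b%:M](conj_scalar uJ) -conjB (conj_rank uJ).
Qed.

Section Multiplicities.
Variables (k : nat) (m : 'I_k -> nat).
Hypothesis mult : forall c x (E : n.-tuple 'rV[R]_n), atlas c -> cimg c x ->
    Defs.orthonormal (g c x) E ->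
    exists lambda : 'I_k -> R,
      [/\ injective lambda,
          forall i, ricci_multiplicity (g c) E x (lambda i) = m i &
          forall a, (0 < ricci_multiplicity (g c) E x a)%N <->
                    exists i, lambda i = a].

(** The Ricci operator is (n - 2) A + tr A, so that it has the same eigenspaces as
   the Schouten operator A. *)
Lemma schouten_multiplicities d phi y : conformal_chart g d phi -> cimg d y ->
  exists mu : 'I_k -> R, [/\ injective mu,
    forall i, (n - \rank (S d y - (mu i)%:M)%R)%N = m i &
    forall a, (\rank (S d y - a%:M)%R < n)%N <-> exists i, mu i = a].
Proof.
move=> cd dy; have ad : atlas d by case: cd.
have [E oE] := conformal_frame cd dy.
have [lam [inj ml al]] := mult ad dy oE.
have [_ kn] := schouten_kn_at n2 conf ad dy.
have rm a := ricci_multiplicity_kn (metric_unit g ad dy) kn oE a n2.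
have c0 : n%:R - 2 != 0 :> R by rewrite subr_eq0 (eqr_nat R n 2) gtn_eqF.
pose t := \tr (S d y).
have lamE i : (n%:R - 2) * ((lam i - t) / (n%:R - 2)) + t = lam i.
  by rewrite mulrC divfK // subrK.
exists (fun i => (lam i - t) / (n%:R - 2)); split.
- by move=> i j E1; apply: inj; rewrite -(lamE i) E1 lamE.
- by move=> i; rewrite -rm -/t lamE ml.
move=> a; rewrite -subn_gt0 -rm -/t al; split=> -[i Ei]; exists i.
  by rewrite Ei addrK mulrC mulKf.
by rewrite -Ei lamE.
Qed.

Hypothesis dz : deszcz_symmetric g.

(** By Deszcz symmetry a Schouten operator that is not scalar has exactly two
   eigenvalues, and then there are exactly two principal Ricci curvatures. *)
Lemma schouten_scalar : k != 2 -> forall c x, atlas c -> cimg c x -> exists s, S c x = s%:M.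
Proof.
move=> k2; apply: (descend_conformal n2 conf (P := fun A => exists s, A = s%:M)).
  by move=> J A uJ [s ->]; exists s; exact: conj_scalar.
move=> d phi y cd dy; have [L [r Er]] := quadratic_of_deszcz_symmetric dz cd dy.
have [//|[a [b [ab E]]]] := symmetric_quadratic n0 (schouten_conformal_sym n2 cd dy) Er.
have [mu [inj _ al]] := schouten_multiplicities cd dy.
have rab := two_eigen_rank ab E.
have [ra|ra] := posnP (\rank (S d y - a%:M)).
  by exists a; apply/eqP; rewrite -subr_eq0 -mxrank_eq0 ra.
have [rb|rb] := posnP (\rank (S d y - b%:M)).
  by exists b; apply/eqP; rewrite -subr_eq0 -mxrank_eq0 rb.
have [i Ei] : exists i, mu i = a.
  apply/al; move: rab ra rb; set r1 := \rank _; set r2 := \rank _; lia.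
have [j Ej] : exists j, mu j = b.
  apply/al; move: rab ra rb; set r1 := \rank _; set r2 := \rank _; lia.
case/negP: k2; have ij : i != j by apply: contra ab => /eqP e; rewrite -Ei e Ej.
have all l : l \in pred2 i j.
  have /eigenvector_exists [v v0 vl] : (\rank (S d y - (mu l)%:M)%R < n)%N by apply/al; exists l.
  have /eqP : v *m ((S d y - a%:M) *m (S d y - b%:M)) = 0 by rewrite E mulmx0.
  have vS e : v *m (S d y - e%:M) = (mu l - e) *: v.
    by rewrite mulmxBr vl mul_mx_scalar scalerBl.
  rewrite mulmxA vS -scalemxAl vS scalerA scaler_eq0 (negbTE v0) orbF mulf_eq0 !subr_eq0.
  by rewrite -Ei -Ej !(inj_eq inj).
by rewrite -(card_ord k) (eq_card (B := pred2 i j)) ?card2 ?ij // => l; rewrite all.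
Qed.

(** The two principal Ricci curvatures keep their indices i0 and i1, hence their
   multiplicities, from point to point; q is the smaller multiplicity. *)
Lemma schouten_two_eigen (p : M) : k = 2 -> exists q, [/\ (0 < q)%N, (2 * q <= n)%N &
  forall c x, atlas c -> cimg c x -> has_two_eigen q (S c x)].
Proof.
move=> k2; have [i0 [i1 [i01 mle]]] : exists i0 i1 : 'I_k, i0 != i1 /\ (m i0 <= m i1)%N.
  have l0 : (0 < k)%N by rewrite k2. have l1 : (1 < k)%N by rewrite k2.
  have [le|le] := leqP (m (Ordinal l0)) (m (Ordinal l1)).
    by exists (Ordinal l0), (Ordinal l1).
  by exists (Ordinal l1), (Ordinal l0); split => //; exact: ltnW.
have pt d phi y : conformal_chart g d phi -> cimg d y ->
    [/\ (0 < m i0)%N, (m i0 + m i1)%N = n & has_two_eigen (m i0) (S d y)].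
  move=> cd dy; have [L [r Er]] := quadratic_of_deszcz_symmetric dz cd dy.
  have [mu [inj mE al]] := schouten_multiplicities cd dy.
  have rl i : (\rank (S d y - (mu i)%:M)%R < n)%N by apply/al; exists i.
  have mu01 : mu i0 != mu i1 by rewrite (inj_eq inj).
  have E := two_eigen_of_quadratic Er mu01 (rl i0) (rl i1).
  have := two_eigen_rank mu01 E; have := mE i0; have := mE i1; have := rl i0; have := rl i1.
  set r1 := \rank _; set r0 := \rank _ => h1 h0 e1 e0 rs.
  have q0 : (0 < m i0)%N by lia.
  have qn : (m i0 + m i1)%N = n by lia.
  split => //; have [eqn|neq] := eqVneq (2 * m i0)%N n; last first.
    exists (mu i0), (mu i1); split => //; first by rewrite -/r1; lia.
    by move=> e; rewrite e eqxx in neq.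
  have [lt01|ge01] := ltP (mu i1) (mu i0).
    by exists (mu i0), (mu i1); split => //; rewrite -/r1; lia.
  exists (mu i1), (mu i0); split; first by rewrite eq_sym.
  - exact: two_eigen_comm.
  - by rewrite -/r0; lia.
  by move=> _; rewrite lt_neqAle mu01.
have [d [phi [cd dp]]] := exists_conformal_chart conf p.
have [q0 qn _] := pt d phi _ cd (cmap_cimg dp).
exists (m i0); split => //; first by lia.
apply: (descend_conformal n2 conf).
  by move=> J A; exact: has_two_eigen_conj.
by move=> d' phi' y cd' dy'; have [_ _] := pt d' phi' y cd' dy'.
Qed.

End Multiplicities.

(** The scalar is a function on M, locally constant by [conformal_schur]; all
   planes have twice its value as curvature. *)
Lemma real_space_form_of_scalar : connected [set: M] ->
  (forall c x, atlas c -> cimg c x -> exists s, S c x = s%:M) -> real_space_form g.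
Proof.
move=> cM scal; have [F FE] : exists F : M -> R, forall c x, atlas c -> cimg c x ->
    trace_mean (S c x) = F (cinv c x).
  by apply: (descend_function n2 conf) => J A uJ; rewrite /trace_mean conj_tr.
have SF c x : atlas c -> cimg c x -> S c x = (F (cinv c x))%:M.
  move=> ac cx; rewrite -FE //; have [s ->] := scal c x ac cx.
  by rewrite /trace_mean mxtrace_scalar -[s *+ n]mulr_natl mulKf // pnatr_eq0 -lt0n.
have Fc : forall p q, F p = F q.
  apply: locally_constant_connected => // p.
  have [d [phi [cd dp]]] := exists_conformal_chart conf p.
  have ad : atlas d by case: cd.
  have near_y := schouten_conformal_schur n2 cd (fun y dy => SF d y ad dy) (cmap_cimg dp).
  have near_p := cmap_continuous dp near_y.
  have near_d : \forall q \near p, cdom d q.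
    by apply: open_nbhs_nbhs; split; [exact: cdom_open|].
  apply: (@filterS2 _ (nbhs p) _ _ _ _ _ near_p near_d) => q /= Eq dq.
  by move: Eq; rewrite !cmapK.
(* M may be empty. *)
have [p0|none] := pselect (exists p : M, True); last first.
  by exists 0 => c x v w ac cx; case: none; exists (cinv c x).
case: p0 => p0 _; exists (2 * F p0) => c x v w ac cx o.
have v1 : inner (g c x) v v = 1 := o 0%N 0%N isT isT.
have w1 : inner (g c x) w w = 1 := o 1%N 1%N isT isT.
have vw : inner (g c x) v w = 0 := o 0%N 1%N isT isT.
rewrite sectional_schouten // /kn_sectional SF // (Fc _ p0) !mul_mx_scalar !innerZl v1 w1 vw.
by ring.
Qed.

Section TwoEigenspaces.
Variable q : nat.
Hypotheses (q0 : (0 < q)%N) (qn : (2 * q <= n)%N).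
Hypothesis two : forall c x, atlas c -> cimg c x -> has_two_eigen q (S c x).

Let qn' : (q < n)%N. Proof. lia. Qed.
Notation al c x := (eigen1 q (S c x)).
Notation be c x := (eigen2 q (S c x)).

Let twoE c x : atlas c -> cimg c x -> [/\ al c x != be c x,
  (S c x - (al c x)%:M) *m (S c x - (be c x)%:M) = 0,
  \rank (S c x - (be c x)%:M) = q, \rank (S c x - (al c x)%:M) = (n - q)%N &
  0 < moment2 (S c x)].
Proof.
move=> ac cx; have [a [b [ab E rq hb]]] := two ac cx.
rewrite (eigen1E ab E rq q0 qn' hb) (eigen2E ab E rq q0 qn' hb).
split => //; last exact: (moment2_gt0 ab E rq q0 qn').
by have := two_eigen_rank ab E; rewrite rq; lia.
Qed.

(** As (A - al) (A - be) = 0, the image of A - be is the eigenspace of al. Images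
   are used rather than kernels because their frames are made of matrix rows. *)
Let image_space c x (a : R) : {vspace 'rV[R]_n} := rowspan (S c x - a%:M).
Let D c x := image_space c x (be c x).
Let D' c x := image_space c x (al c x).

Let eigen_rowspan (A : 'M[R]_n) a b v : a != b -> (A - a%:M) *m (A - b%:M) = 0 ->
  (v \in rowspan (A - b%:M)) = (v *m A == a *: v).
Proof.
move=> ab E; rewrite mem_rowspan; apply/idP/eqP => [/submxP [w ->]|vA].
  apply/eqP; rewrite -subr_eq0 -mul_mx_scalar -mulmxBr -mulmxA two_eigen_comm //.
  by rewrite mulmx0.
apply/submxP; exists ((a - b)^-1 *: v).
rewrite -scalemxAl mulmxBr vA mul_mx_scalar -scalerBl scalerA mulVf ?scale1r //.
by rewrite subr_eq0.
Qed.

Let memD c x v : atlas c -> cimg c x -> (v \in D c x) = (v *m S c x == al c x *: v).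
Proof. by move=> ac cx; have [ab E _ _ _] := twoE ac cx; exact: eigen_rowspan. Qed.

Let memD' c x v : atlas c -> cimg c x -> (v \in D' c x) = (v *m S c x == be c x *: v).
Proof.
move=> ac cx; have [ab E _ _ _] := twoE ac cx; apply: eigen_rowspan.
  by rewrite eq_sym.
exact: two_eigen_comm.
Qed.

Let sm_al c : atlas c -> smooth_on (cimg c) ((fun x => al c x) : _ -> R^o).
Proof.
move=> ac; apply: smooth_eigen1 => //; first exact: cimg_open.
  exact: smx_schouten.
by move=> x cx; have [] := twoE ac cx.
Qed.

Let sm_be c : atlas c -> smooth_on (cimg c) ((fun x => be c x) : _ -> R^o).
Proof.
move=> ac; apply: smooth_eigen2 => //; first exact: cimg_open.
  exact: smx_schouten.
by move=> x cx; have [] := twoE ac cx.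
Qed.

Let eigen_distribution r (f : chart R n M -> 'rV[R]_n -> R)
    (h : chart R n M -> 'rV[R]_n -> R) :
  (forall c x, atlas c -> cimg c x -> \rank (S c x - (f c x)%:M) = r) ->
  (forall c, atlas c -> smooth_on (cimg c) (f c : _ -> R^o)) ->
  (forall c x v, atlas c -> cimg c x ->
    (v \in image_space c x (f c x)) = (v *m S c x == h c x *: v)) ->
  (forall c d x, atlas c -> atlas d -> overlap c d x -> h c x = h d (transition c d x)) ->
  distribution r (fun c x => image_space c x (f c x)).
Proof.
move=> rf sf mf hch; split.
- by move=> c x ac cx; rewrite dim_rowspan rf.
- move=> c d x v ac ad o; have cx : cimg c x by case: o.
  have uJ := jac_unit g ac ad o; have E := schouten_change n2 conf ac ad o.
  rewrite (jacE ac ad v o); apply: etrans (mf c x v ac cx) _.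
  apply/esym; apply: etrans (mf d _ _ ad (transition_cimg o)) _.
  rewrite E (hch c d x ac ad o); move: (jac c d x) uJ (S d _) (h d _) => J uJ A a.
  by rewrite -[RHS](inj_eq (can_inj (mulmxK uJ))) !mulmxA mulmxKV // -scalemxAl.
move=> c x ac cx; have oc : open (cimg c) := @cimg_open _ _ _ c.
have sB : smx (cimg c) (fun y => S c y - (f c y)%:M).
  have sI := smxZ oc (sf c ac) (smx_cst (cimg c) (1%:M : 'M[R]_n)).
  have sS := smxB oc (smx_schouten g ac) sI.
  apply: (smx_ext oc _ sS) => y _.
  by rewrite /cst scalemx1.
have [V [W [oV Vx Vc VE]]] := smooth_rowspan_frame oc sB (fun y => rf c y ac) cx.
exists V, (fun i y => row i (W *m (S c y - (f c y)%:M))); split => //.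
move=> i; apply: (smx_smooth_on oV); apply: (smx_ext oV (M := fun y => row i W *m (S c y - (f c y)%:M))).
  by move=> y _; rewrite row_mul.
apply: (smx_mul oV (smx_cst V (row i W))) => j l.
exact: smooth_on_sub Vc (sB j l).
Qed.

Let distrD : distribution q D.
Proof.
apply: (eigen_distribution (h := fun c x => al c x)).
- by move=> c x ac cx; have [] := twoE ac cx.
- exact: sm_be.
- exact: memD.
by move=> c d x ac ad o; rewrite (schouten_change n2 conf ac ad o) conj_eigen1 //; exact: jac_unit.
Qed.

Let distrD' : distribution (n - q) D'.
Proof.
apply: (eigen_distribution (h := fun c x => be c x)).
- by move=> c x ac cx; have [] := twoE ac cx.
- exact: sm_al.
- exact: memD'.
by move=> c d x ac ad o; rewrite (schouten_change n2 conf ac ad o) conj_eigen2 //; exact: jac_unit.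
Qed.

Let orthDD' c x u v : atlas c -> cimg c x -> u \in D c x -> v \in D' c x ->
  inner (g c x) u v = 0.
Proof.
move=> ac cx; rewrite memD // memD' // => /eqP uA /eqP vA.
have [ab _ _ _ _] := twoE ac cx; have [sAG _] := schouten_kn_at n2 conf ac cx.
have := selfadjoint (symG ac cx) sAG u v; rewrite uA vA innerZl innerZr => /eqP.
by rewrite -subr_eq0 -mulrBl mulf_eq0 subr_eq0 (negbTE ab) => /eqP.
Qed.

Let compl : orthogonally_complementary g D D'.
Proof.
move=> c x ac cx; split; first by move=> u v; exact: orthDD'.
have [ab E _ _ _] := twoE ac cx.
apply/vspaceP => v; rewrite memvf; set a := al c x in ab *; set b := be c x in ab *.
have -> : v = (a - b)^-1 *: (v *m (S c x - b%:M)) - (a - b)^-1 *: (v *m (S c x - a%:M)).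
  rewrite !mulmxBr !mul_mx_scalar; move: (v *m S c x) => w.
  by apply/rowP => k; rewrite !mxE; field; rewrite subr_eq0.
apply: rpredB; apply: memvZ.
  by apply: (subvP (addvSl _ _)); rewrite mem_rowspan submxMl.
by apply: (subvP (addvSr _ _)); rewrite mem_rowspan submxMl.
Qed.

Lemma quasi_space_form_of_two_eigen : q_quasi_space_form g q.
Proof.
split; first by []; split; first by []; exists D, D'; split; [exact: distrD|exact: distrD'|exact: compl|].
have [a aE] : exists a : M -> R, forall c x, atlas c -> cimg c x -> al c x = a (cinv c x).
  by apply: (descend_function n2 conf) => J A uJ; exact: conj_eigen1.
have [b bE] : exists b : M -> R, forall c x, atlas c -> cimg c x -> be c x = b (cinv c x).
  by apply: (descend_function n2 conf) => J A uJ; exact: conj_eigen2.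
have ab p : a p <> b p.
  have [c ac cp] := atlas_cover p; have cx := cmap_cimg cp.
  rewrite -(cmapK cp) -aE // -bE //; have [/eqP + _ _ _ _] := twoE ac cx; exact.
have sec c x (ac : atlas c) (cx : cimg c x) := @kn_sectional_two R n (g c x) (S c x)
  (symG ac cx) (D c x) (D' c x) (fun u v => @orthDD' c x u v ac cx) (al c x) (be c x).
have eD c x v : atlas c -> cimg c x -> v \in D c x -> v *m S c x = al c x *: v.
  by move=> ac cx; rewrite memD // => /eqP.
have eD' c x v : atlas c -> cimg c x -> v \in D' c x -> v *m S c x = be c x *: v.
  by move=> ac cx; rewrite memD' // => /eqP.
case: ifP => _.
  exists (fun p => a p + b p), (fun p => 2 * b p); split.
    by move=> p E; apply: (ab p); lra.
  move=> c x X X' Y' th ac cx XD X'D Y'D o _; rewrite sectional_schouten // -aE // -bE //.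
  have X1 : inner (g c x) X X = 1 := o 0%N 0%N isT isT.
  have X'1 : inner (g c x) X' X' = 1 := o 1%N 1%N isT isT.
  have Y'1 : inner (g c x) Y' Y' = 1 := o 2%N 2%N isT isT.
  have X'Y' : inner (g c x) X' Y' = 0 := o 1%N 2%N isT isT.
  have -> : Y' = 0 *: 0 + 1 *: Y' by rewrite scale0r add0r scale1r.
  rewrite (sec c x ac cx X 0 X' Y' _ _ 0 1 (fun v => eD c x v ac cx) (fun v => eD' c x v ac cx))
    ?mem0v ?inner0r // X1 X'1 Y'1.
  have cs := cos2Dsin2 th.
  have -> : sin th ^+ 2 = 1 - cos th ^+ 2 by rewrite -cs addrAC subrr add0r.
  by ring.
exists (fun p => 2 * a p), (fun p => 2 * b p); split.
  by move=> p E; apply: (ab p); lra.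
move=> c x X Y X' Y' th ph ac cx XD YD X'D Y'D o _ _ /=; rewrite sectional_schouten // -aE // -bE //.
have X1 : inner (g c x) X X = 1 := o 0%N 0%N isT isT.
have Y1 : inner (g c x) Y Y = 1 := o 1%N 1%N isT isT.
have X'1 : inner (g c x) X' X' = 1 := o 2%N 2%N isT isT.
have Y'1 : inner (g c x) Y' Y' = 1 := o 3%N 3%N isT isT.
have XY : inner (g c x) X Y = 0 := o 0%N 1%N isT isT.
have X'Y' : inner (g c x) X' Y' = 0 := o 2%N 3%N isT isT.
rewrite (sec c x ac cx X Y X' Y' _ _ _ _ (fun v => eD c x v ac cx) (fun v => eD' c x v ac cx)) //.
rewrite X1 Y1 X'1 Y'1.
have -> : sin th ^+ 2 = 1 - cos th ^+ 2 by rewrite -(cos2Dsin2 th) addrAC subrr add0r.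
have -> : sin ph ^+ 2 = 1 - cos ph ^+ 2 by rewrite -(cos2Dsin2 ph) addrAC subrr add0r.
by field.
Qed.

End TwoEigenspaces.
End Classification.

Theorem theorem4 (R : realType) (n : nat) (M : smoothManifold R n)
    (g : riemannianMetric M) :
  (4 <= n)%N ->
  connected [set: M]%classic ->
  conformally_euclidean g ->
  constant_ricci_multiplicities g ->
  (deszcz_symmetric g <-> (real_space_form g \/ quasi_space_form g)).
Proof.
move=> n4 cM conf [k [m mult]]; split; last first.
  by case=> [rsf|qsf]; [exact: deszcz_of_real_space_form|exact: deszcz_of_quasi_space_form].
move=> dz; have [k2|k2] := eqVneq k 2; last first.
  by left; apply: real_space_form_of_scalar => //; exact: schouten_scalar mult dz k2.
(* M may be empty, and is then a real space form. *)
have [[p _]|none] := pselect (exists p : M, True); last first.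
  by left; exists 0 => c x v w ac cx; case: none; exists (cinv c x).
right; have [q [q0 qn two]] := schouten_two_eigen n4 conf mult dz p k2.
by exists q; exact: quasi_space_form_of_two_eigen.
Qed.
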